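(* Let $\varphi:\mathbb{R}\to\mathbb{R}$ be continuous and nondecreasing with $\varphi(0)=0$, let $\mu\ge0$ be an even Radon measure on $\mathbb{R}^N\setminus\{0\}$ with $\int_{|z|\le1}|z|^2\mu(\mathrm{d}z)+\int_{|z|>1}\mu(\mathrm{d}z)<\infty$, and let $u_0\in L^1(\mathbb{R}^N)\cap L^\infty(\mathbb{R}^N)$. Then the (unique) distributional solution $u\in L^1(Q_T)\cap L^\infty(Q_T)\cap C([0,T];L^1_{\mathrm{loc}}(\mathbb{R}^N))$ of $\partial_tu-\mathcal{L}^\mu[\varphi(u)]=0$ in $Q_T$, $u(\cdot,0)=u_0$ on $\mathbb{R}^N$, satisfies $$|\varphi(u)|_{T,E_\mu}^2\le\|\varphi(u_0)\|_{L^\infty(\mathbb{R}^N)}\|u_0\|_{L^1(\mathbb{R}^N)}<\infty .$$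
   Context: $T>0$, $Q_T:=\mathbb{R}^N\times(0,T)$; $\mu$ even means $\mu(B)=\mu(-B)$ for all Borel $B$. The operator is $\mathcal{L}^\mu[\phi](x)=\int_{\mathbb{R}^N\setminus\{0\}}\big(\phi(x+z)-\phi(x)-z\cdot D\phi(x)\mathbf{1}_{|z|\le1}\big)\mu(\mathrm{d}z)$. Set $|f|_{E_\mu}^2:=\frac12\int_{\mathbb{R}^N}\int_{|z|>0}|f(x+z)-f(x)|^2\,\mu(\mathrm{d}z)\mathrm{d}x$ and $|f|_{T,E_\mu}^2:=\int_0^T|f(\cdot,t)|_{E_\mu}^2\,\mathrm{d}t$. Distributional solution: $u\in L^1_{\mathrm{loc}}(Q_T)$ such that, for all $\psi\in C_c^\infty(\mathbb{R}^N\times[0,T))$, $\iint_{Q_T}\big(u\,\partial_t\psi+\varphi(u)\mathcal{L}^\mu[\psi]\big)\mathrm{d}x\mathrm{d}t+\int_{\mathbb{R}^N}u_0(x)\psi(x,0)\,\mathrm{d}x=0$. Existence and uniqueness of a distributional solution in the class $L^1(Q_T)\cap L^\infty(Q_T)\cap C([0,T];L^1_{\mathrm{loc}}(\mathbb{R}^N))$ is known. *)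

(* Defs.v *)
From HB Require Import structures.
From mathcomp Require Import all_boot all_order all_algebra.
From mathcomp Require Import all_classical all_reals all_analysis.
From mathcomp Require Import measurable_realfun.

Set Implicit Arguments.
Unset Strict Implicit.
Unset Printing Implicit Defensive.

Import Order.TTheory GRing.Theory Num.Theory.
Import numFieldNormedType.Exports.

Local Open Scope classical_set_scope.
Local Open Scope ring_scope.

Section borel_rV.
Variables (R : realType) (n : nat).

HB.instance Definition _ :=
  @isMeasurable.Build default_measure_display 'rV[R]_n
    (<<s (@open 'rV[R]_n) >>)
    (@sigma_algebra0 _ setT (@open 'rV[R]_n))
    (@sigma_algebraC _ (@open 'rV[R]_n))
    (@sigma_algebra_bigcup _ setT (@open 'rV[R]_n)).

End borel_rV.

Section lebesgue_rV.
Context {R : realType}.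

Lemma open_measurable_rV n (U : set 'rV[R]_n) : open U -> measurable U.
Proof. exact: sub_sigma_algebra. Qed.

Lemma open_rV_bigcup_ball n (U : set 'rV[R]_n) : open U ->
  U = \bigcup_(q in [set q : 'rV[rat]_n * rat |
        ball (\row_i ratr (q.1 0 i) : 'rV[R]_n) (ratr q.2 : R) `<=` U])
      ball (\row_i ratr (q.1 0 i) : 'rV[R]_n) (ratr q.2 : R).
Proof.
move=> oU; apply/seteqP; split => [x Ux|x [q qU xq]]; last exact: qU.
have /nbhs_ballP[e /= e0 eU] : nbhs x U by exact: open_nbhs_nbhs.
have [r] := @rat_in_itvoo R 0 (e / 2) (divr_gt0 e0 (ltr0Sn _ 1)).
rewrite in_itv/= => /andP[r0 re].
have /choice[c Hc] : forall i : 'I_n, exists c : rat, `|x 0 i - ratr c| < ratr r.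
  move=> i; have [|c] := @rat_in_itvoo R (x 0 i - ratr r) (x 0 i + ratr r).
    by rewrite ltrD2l gtrN.
  rewrite in_itv/= => /andP[c1 c2]; exists c.
  by rewrite ltr_distlC c1 c2.
exists (\row_i c i, r) => /=.
  apply: subset_trans eU => y [_ yc]; split => // i j; move: (yc i j).
  rewrite !mxE /ball/= !ord1 => yc'.
  apply: (@le_lt_trans _ _ (`|x 0 j - ratr (c j)| + `|ratr (c j) - y 0 j|)).
    by rewrite (le_trans _ (ler_normD _ _))// addrA subrK.
  by rewrite [ltRHS](splitr e) ltrD// (lt_trans _ re).
by split => // i j; rewrite !mxE /ball/= ord1 distrC.
Qed.

Definition rv_cons n (p : 'rV[R]_n * measurableTypeR R) : 'rV[R]_n.+1 :=
  \row_i if unlift ord0 i is Some j then p.1 0 j else p.2.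

Lemma measurable_rv_cons n : measurable_fun setT (@rv_cons n).
Proof.
apply: (measurability (@open 'rV[R]_n.+1)) => //.
move=> _ [U oU <-]; rewrite setTI (open_rV_bigcup_ball oU) preimage_bigcup.
rewrite bigcup_mkcond; apply: countable_bigcupT_measurable => // q.
case: ifPn => // _.
have [r0|r0] := ltP 0 (ratr q.2 : R); last first.
  rewrite (_ : _ @^-1` _ = set0)//.
  by apply/seteqP; split => // x [] /=; rewrite ltNge r0.
rewrite (_ : _ @^-1` _ =
  ball ((\row_j ratr (q.1 0 (lift ord0 j))) : 'rV[R]_n) (ratr q.2) `*`
  ball (ratr (q.1 0 ord0) : R) (ratr q.2)); last first.
  apply/seteqP; split => [[v x] [_ /= H]|[v x] /= [[_ H1] H2]].
    split.
      split => // i j; move: (H 0 (lift ord0 j)).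
      by rewrite !mxE liftK (ord1 i).
    by move: (H 0 ord0); rewrite !mxE unlift_none.
  split => // i j; rewrite !mxE; case: unliftP => [k ->|->//].
  by move: (H1 0 k); rewrite !mxE.
apply: measurableX.
- by apply: open_measurable_rV; exact: ball_open.
- exact: measurable_ball.
Qed.

Section lebesgue_rV_step.
Variables (n : nat) (m : {measure set 'rV[R]_n -> \bar R}).

Definition lebesgue_rV_step : set 'rV[R]_n.+1 -> \bar R :=
  pushforward (m \x @lebesgue_measure R)%E (@rv_cons n).

Let m0 : lebesgue_rV_step set0 = 0%E.
Proof. by rewrite /lebesgue_rV_step /pushforward preimage_set0 measure0. Qed.

Let m_ge0 A : (0 <= lebesgue_rV_step A)%E.
Proof. by rewrite /lebesgue_rV_step /pushforward measure_ge0. Qed.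

Let m_sigma_additive : semi_sigma_additive lebesgue_rV_step.
Proof.
have mV A : measurable A -> measurable (@rv_cons n @^-1` A).
  by move=> mA; rewrite -[X in measurable X]setTI; exact: measurable_rv_cons.
move=> F mF tF mUF; rewrite /lebesgue_rV_step /pushforward preimage_bigcup.
apply: measure_semi_sigma_additive => [k||]; first exact: mV.
- apply/trivIsetP => i j _ _ ij; rewrite -preimage_setI.
  by move/trivIsetP : tF => /(_ _ _ _ _ ij) ->//; rewrite preimage_set0.
- by rewrite -preimage_bigcup; exact: mV.
Qed.

HB.instance Definition _ := isMeasure.Build _ _ _ lebesgue_rV_step
  m0 m_ge0 m_sigma_additive.

End lebesgue_rV_step.

Fixpoint lebesgue_rV n : {measure set 'rV[R]_n -> \bar R} :=
  match n return {measure set 'rV[R]_n -> \bar R} with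
  | 0 => \d_(0 : 'rV[R]_0)
  | n'.+1 => lebesgue_rV_step (lebesgue_rV n')
  end.

End lebesgue_rV.

Section lebesgue_rV_box.
Context {R : realType}.

Lemma measurable_coord n (i : 'I_n) :
  measurable_fun setT (fun x : 'rV[R]_n => x 0 i).
Proof.
apply: (measurability (@RGenOInfty.G R)); first exact: RGenOInfty.measurableE.
move=> _ [_ [a ->] <-]; rewrite setTI; apply: open_measurable_rV.
apply: open_comp; last exact: interval_open.
by move=> x _; exact: coord_continuous.
Qed.

Lemma measurable_box n (A : 'I_n -> set R) : (forall i, measurable (A i)) ->
  measurable [set x : 'rV[R]_n | forall i, A i (x 0 i)].
Proof.
move=> mA; rewrite (_ : [set x | _] =
    \bigcap_(i in [set: 'I_n]) ((fun x : 'rV[R]_n => x 0 i) @^-1` A i)).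
  apply: fin_bigcap_measurable => // i _.
  by rewrite -[X in measurable X]setTI; exact: measurable_coord.
by apply/seteqP; split => x /= Ax i => [_|]; exact: (Ax i).
Qed.

Lemma lebesgue_rV_box n (A : 'I_n -> set R) : (forall i, measurable (A i)) ->
  lebesgue_rV n [set x : 'rV[R]_n | forall i, A i (x 0 i)] =
  (\prod_(i < n) @lebesgue_measure R (A i))%E.
Proof.
elim: n A => [|n IH] A mA.
  by rewrite big_ord0 /= diracE mem_set// => -[].
rewrite /= /lebesgue_rV_step /pushforward.
rewrite (_ : _ @^-1` _ =
  [set x : 'rV[R]_n | forall i : 'I_n, A (lift ord0 i) (x 0 i)] `*` A ord0).
  have mB := @measurable_box n (fun i => A (lift ord0 i)) (fun i => mA _).
  apply: (eq_trans (product_measure1E (lebesgue_rV n)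
    (@lebesgue_measure R) mB (mA ord0))).
  by rewrite (IH (fun i => A (lift ord0 i)))// big_ord_recl muleC.
apply/seteqP; split => [[v x] /= H|[v x] /= [H H0] i].
  split; last by move: (H ord0); rewrite mxE unlift_none.
  by move=> i; move: (H (lift ord0 i)); rewrite mxE liftK.
by rewrite mxE; case: unliftP => [k ->|->].
Qed.

End lebesgue_rV_box.

Section calculus.
Context {R : realType}.

Definition iter_derive {V : normedModType R} (vs : seq V) (f : V -> R) : V -> R :=
  foldr (fun v g => 'D_v g) f vs.

(* C^oo: every iterated directional derivative exists and is continuous. *)
Definition smooth {V : normedModType R} (f : V -> R) :=
  forall vs : seq V, continuous (iter_derive vs f) /\
    forall x v, derivable (iter_derive vs f) x v.

(* The library norm on 'rV[R]_n is the sup norm. *)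
Definition euclid_norm n (z : 'rV[R]_n) : R := Num.sqrt (\sum_i z 0 i ^+ 2).

Definition dotprod n (y z : 'rV[R]_n) : R := \sum_i y 0 i * z 0 i.

Definition gradient n (f : 'rV[R]_n -> R) (x : 'rV[R]_n) : 'rV[R]_n :=
  \row_i 'D_(delta_mx 0 i) f x.

End calculus.

Section function_spaces.
Context d (X : measurableType d) (R : realType).
Variables (mu : {measure set X -> \bar R}) (D : set X).

Definition in_L1 (f : X -> R) := mu.-integrable D (EFin \o f).

Definition in_Linfty (f : X -> R) := measurable_fun D f /\
  exists M : R, {ae mu, forall x, D x -> `|f x| <= M}.

End function_spaces.

(* A measure on R^N \ {0} is encoded by its extension by zero, that is, by a
   Borel measure mu on R^N such that mu [set 0] = 0. *)
Section levy.
Context {R : realType} {N : nat}.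
Variable mu : {measure set 'rV[R]_N -> \bar R}.

Definition radon_punctured :=
  (forall K : set 'rV[R]_N, compact K -> K `<=` [set~ 0] -> (mu K < +oo)%E) /\
  (forall B : set 'rV[R]_N, measurable B -> B `<=` [set~ 0] ->
    mu B = ereal_sup [set mu K | K in [set K | compact K /\ K `<=` B]]).

Definition even_measure :=
  forall B : set 'rV[R]_N, measurable B -> mu B = mu [set - z | z in B].

Definition levy_integrable :=
  (\int[mu]_(z in [set z | (euclid_norm z <= 1)%R]) (euclid_norm z ^+ 2)%:E +
   \int[mu]_(z in [set z | (1 < euclid_norm z)%R]) 1 < +oo)%E.

Definition levy_op (f : 'rV[R]_N -> R) (x : 'rV[R]_N) : R :=
  \int[mu]_(z in [set~ 0])
    (f (x + z) - f x -
     dotprod z (gradient f x) * \1_[set y | euclid_norm y <= 1] z).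

Definition energy (f : 'rV[R]_N -> R) : \bar R :=
  ((2^-1)%:E * \int[lebesgue_rV N]_x
     \int[mu]_(z in [set~ 0%R]) (`|f (x + z) - f x| ^+ 2)%:E)%E.

Definition energy_time (T : R) (w : 'rV[R]_N * R -> R) : \bar R :=
  (\int[lebesgue_measure]_(t in `]0%R, T[) energy (fun x => w (x, t)))%E.

End levy.

Section evolution.
Context {R : realType} {N : nat}.

Definition QT (T : R) : set ('rV[R]_N * R) := [set p | 0 < p.2 < T].

Definition lebesgue_spacetime :
    {measure set ('rV[R]_N * measurableTypeR R) -> \bar R} :=
  (lebesgue_rV N \x lebesgue_measure)%E.

Definition in_L1loc_QT (T : R) (u : 'rV[R]_N * R -> R) :=
  measurable_fun (QT T : set ('rV[R]_N * measurableTypeR R)) u /\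
  forall K : set ('rV[R]_N * R), compact K -> K `<=` QT T ->
    in_L1 lebesgue_spacetime K u.

Definition in_L1loc (f : 'rV[R]_N -> R) :=
  measurable_fun setT f /\
  forall K : set 'rV[R]_N, compact K -> in_L1 (lebesgue_rV N) K f.

(* C([0,T]; L^1_loc): u is only determined almost everywhere, so the condition
   is that u has a version v which is continuous in time for the seminorms
   f |-> \int_K |f|, K compact. *)
Definition in_C_L1loc (T : R) (u : 'rV[R]_N * R -> R) :=
  exists v : R -> 'rV[R]_N -> R,
  [/\ forall t, t \in `[0, T] -> in_L1loc (v t),
      forall K : set 'rV[R]_N, compact K -> forall t, t \in `[0, T] ->
        (\int[lebesgue_rV N]_(x in K) `|v s x - v t x|%:E)%E
          @[s --> within `[0, T] (nbhs t)] --> 0%E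
    & {ae lebesgue_spacetime, forall p, QT T p -> u p = v p.2 p.1}].

(* C_c^oo(R^N x [0,T)): restrictions to R^N x [0,T) of smooth functions on
   R^N x R, with compact support in R^N x [0,T). *)
Definition test_function (T : R) (psi : 'rV[R]_N * R -> R) :=
  smooth psi /\
  exists K : set ('rV[R]_N * R), [/\ compact K, K `<=` [set p | 0 <= p.2 < T]
    & forall p, 0 <= p.2 < T -> ~ K p -> psi p = 0].

Definition distributional_solution (T : R) (phi : R -> R)
    (mu : {measure set 'rV[R]_N -> \bar R}) (u0 : 'rV[R]_N -> R)
    (u : 'rV[R]_N * R -> R) :=
  in_L1loc_QT T u /\
  forall psi, test_function T psi ->
    \int[lebesgue_spacetime]_(p in QT T)
      (u p * derive1 (fun t => psi (p.1, t)) p.2 +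
       phi (u p) * levy_op mu (fun x => psi (x, p.2)) p.1) +
    \int[lebesgue_rV N]_x (u0 x * psi (x, 0)) = 0.

End evolution.

(* Main.v *)
Require Import Defs.
From HB Require Import structures.
From mathcomp Require Import all_boot all_order all_algebra.
From mathcomp Require Import all_classical all_reals all_analysis.
From mathcomp Require Import measurable_realfun ess_sup_inf.
From mathcomp Require Import ring lra.

(**
  Write [w = phi(u)], let [Phi] be the primitive of [phi] vanishing at 0, and
  denote by [v] and [U] the averages of [w] and [u], mollified in space, against
  the density [lam exp(- lam s)] of the time elapsed, [u] being extended by [u0]
  to negative times. Testing the equation with mollifiers times
  [exp(lam s) (tau - s)_+] (smoothed) gives, for almost every time, the
  resolvent identity [f = - L v] with [f = lam (U - u_rho)], where [u_rho] is
  the space mollification of [u]. It holds uniformly for truncations of the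
  Levy measure up to a vanishing error; pairing it with a soft threshold of [v]
  and symmetrizing bounds the energy of [v] by the integral of [f v].

  Set [q = exp(- lam h)]. The positivity of the quadratic form shows that
  [(1 - q) f v] integrates to at most the integral of [f (v - q v(t - h))], and
  [v - q v(t - h)] averages [w] over a window of length [h] only, so that [f]
  is multiplied there by values [phi(u')] with [u'] close to [u]. By convexity
  [phi(u') (U - u) <= Phi(U) - Phi(u)] up to a small error, and Jensen's
  inequality for [Phi(U)] leaves exactly the integral of [Phi(u0)]. The error is
  controlled by the L1 modulus of continuity of [u]: for fixed [lam] it
  disappears when [h] and the mollifier shrink. Then [lam] goes to infinity, [v]
  converges to [w] in L1 on bounded sets, and the truncations are removed by
  monotone convergence. Finally [Phi(r) <= phi(r) r].
*)

Set Implicit Arguments.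
Unset Strict Implicit.
Unset Printing Implicit Defensive.

Import Order.TTheory GRing.Theory Num.Theory.
Import numFieldNormedType.Exports.

Local Open Scope classical_set_scope.
Local Open Scope ring_scope.

(** * Lebesgue measure on row vectors *)

Section measure_preserving.
Context d (T : measurableType d) (R : realType).
Variable m : {measure set T -> \bar R}.

(** Formally one multiplies the equation by [phi(u)]. This is not a legitimate test function: [u] is
    only integrable and bounded, without a time derivative, and [phi] is merely continuous, so no
    chain rule is available. The exponential average is a resolvent in time: it replaces the time
    derivative by the difference quotient [lam (U - u_rho)], an integrable function, so that a
    stationary estimate applies at almost every time. That estimate cannot be compared with the
    convex primitive directly, because [v] remembers the whole past of [w], while convexity needs
    [phi(u')] with [u'] near [u]. Subtracting [q v(t - h)] forgets all but a window of length [h];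
    the whole inequality then carries the factor [1 - q], which is divided out. The remaining error
    is proportional to [lam], so the window has to be chosen after [lam]. Integrability of [u] does
    not make [w] integrable, since [phi] is only continuous at 0: [w] is merely small off a set of
    finite measure. Hence the thresholding of [v] and the localization in the last limit. *)

Definition preserving (h : T -> T) :=
  measurable_fun setT h /\ forall A, measurable A -> m (h @^-1` A) = m A.

Variable h : T -> T.
Hypothesis ph : preserving h.

Lemma preserving_ge0_integral (f : T -> \bar R) : measurable_fun setT f ->
  (forall x, 0 <= f x)%E -> (\int[m]_x f (h x) = \int[m]_x f x)%E.
Proof.
move=> mf f0; case: ph => mh hm.
have := @ge0_integral_pushforward _ _ _ _ _ _ mh m setT f measurableT mf
  (fun x _ => f0 x).
rewrite preimage_setT => <-.
by apply: eq_measure_integral => A mA _; rewrite -hm.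
Qed.

Lemma preserving_integrable (f : T -> R) :
  m.-integrable setT (EFin \o f) -> m.-integrable setT (EFin \o (f \o h)).
Proof.
move=> /integrableP[mf fi]; case: ph => mh hm; apply/integrableP; split.
  exact: (measurableT_comp mf mh).
rewrite (@preserving_ge0_integral (fun x => `|(f x)%:E|)%E)//.
exact: (measurableT_comp (@abse_measurable _ setT) mf).
Qed.

Lemma preserving_integral (f : T -> \bar R) : measurable_fun setT f ->
  (\int[m]_x f (h x) = \int[m]_x f x)%E.
Proof.
move=> mf; rewrite integralE [RHS]integralE; congr (_ - _)%E.
  rewrite -[RHS]preserving_ge0_integral//; last exact: measurable_funepos.
  by apply: eq_integral => x _; rewrite !funeposE.
rewrite -[RHS]preserving_ge0_integral//; last exact: measurable_funeneg.
by apply: eq_integral => x _; rewrite !funenegE.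
Qed.

Lemma preserving_Rintegral (f : T -> R) : measurable_fun setT f ->
  \int[m]_x f (h x) = \int[m]_x f x.
Proof.
move=> mf; congr fine.
by rewrite -(@preserving_integral (EFin \o f))//; exact/measurable_EFinP.
Qed.

Lemma preserving_ae (P : T -> Prop) :
  {ae m, forall x, P x} -> {ae m, forall x, P (h x)}.
Proof.
case: ph => mh hm [A [mA A0 PA]]; exists (h @^-1` A); split.
- by rewrite -[X in measurable X]setTI; exact: mh.
- by rewrite hm.
- by move=> x /= /PA.
Qed.

End measure_preserving.

Lemma preserving_comp d (T : measurableType d) (R : realType)
    (m : {measure set T -> \bar R}) (g h : T -> T) :
  preserving m g -> preserving m h -> preserving m (g \o h).
Proof.
move=> [mg gm] [mh hm]; split; first exact: measurableT_comp.
move=> A mA; rewrite comp_preimage hm ?gm//.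
by rewrite -[X in measurable X]setTI; exact: mg.
Qed.

(** The push-forward of the product measure agrees with it on rectangles, and these determine a
    product of sigma-finite measures. *)
Lemma preserving_prod d1 d2 (T1 : measurableType d1) (T2 : measurableType d2)
    (R : realType) (m1 : {sigma_finite_measure set T1 -> \bar R})
    (m2 : {sigma_finite_measure set T2 -> \bar R}) g h :
  preserving m1 g -> preserving m2 h ->
  preserving (m1 \x m2)%E (fun p => (g p.1, h p.2)).
Proof.
move=> [mg gm] [mh hm].
have mgh : measurable_fun [set: T1 * T2] (fun p : T1 * T2 => (g p.1, h p.2)).
  apply/measurable_fun_pairP; split.
    exact: (measurableT_comp mg measurable_fst).
  exact: (measurableT_comp mh measurable_snd).
split=> // A mA.
pose hh (p : T1 * T2) := (g p.1, h p.2).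
pose m' : {measure set (T1 * T2) -> \bar R} := pushforward (m1 \x m2)%E hh.
apply/esym/(eq_trans (product_measure_unique (m' := m' mgh) _ mA)) => //.
move=> B C mB mC; rewrite /m' /= /pushforward /hh.
rewrite (_ : _ @^-1` _ = (g @^-1` B) `*` (h @^-1` C))//.
rewrite product_measure1E ?gm ?hm//.
  by rewrite -[X in measurable X]setTI; exact: mg.
by rewrite -[X in measurable X]setTI; exact: mh.
Qed.

Section lebesgue_line.
Context {R : realType}.
Notation lam := (@lebesgue_measure R).

Lemma preserving_opp : preserving lam (-%R : measurableTypeR R -> measurableTypeR R).
Proof. by split => // A mA; rewrite -[RHS]lebesgue_measureN. Qed.

Lemma preserving_shift (c : R) :
  preserving lam (fun x : measurableTypeR R => x + c).
Proof.
have mh : measurable_fun setT (fun x : measurableTypeR R => x + c).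
  by apply: measurable_funD => //; exact: measurable_cst.
split=> // A mA.
pose hh (x : measurableTypeR R) : measurableTypeR R := x + c.
pose m' : {measure set (measurableTypeR R) -> \bar R} := pushforward lam hh.
apply/esym/(eq_trans (lebesgue_measure_unique (mu := m' mh) _ mA)) => //.
move=> _ [[a b]] _ <-; rewrite /m' /= /pushforward /hh.
rewrite (_ : _ @^-1` _ = `](a - c), (b - c)]%classic); last first.
  by apply/seteqP; split => x /=; rewrite !in_itv/= ltrBlDr lerBrDr.
rewrite !lebesgue_measure_itv/= !lte_fin ltrD2r; case: ifPn => // _.
by rewrite -!EFinB; congr EFin; lra.
Qed.

Lemma preserving_reflect (c : R) :
  preserving lam (fun x : measurableTypeR R => c - x).
Proof.
rewrite (_ : (fun x => _) = (fun x : measurableTypeR R => x + c) \o -%R).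
  exact: preserving_comp (preserving_shift c) preserving_opp.
by apply/funext => x /=; rewrite addrC.
Qed.

End lebesgue_line.

Section measurable_rV.
Context {R : realType}.

(** Open sets of rows are countable unions of rational balls of the sup norm, and the preimage of
    such a ball is a finite intersection over coordinates. *)
Lemma measurable_rVP d (T : measurableType d) n (f : T -> 'rV[R]_n) :
  (forall i, measurable_fun setT (fun x => f x 0 i)) -> measurable_fun setT f.
Proof.
move=> mf; apply: (measurability (@open 'rV[R]_n)) => //.
move=> _ [U oU <-]; rewrite setTI (open_rV_bigcup_ball oU) preimage_bigcup.
rewrite bigcup_mkcond; apply: countable_bigcupT_measurable => // q.
case: ifPn => // _.
have [r0|r0] := ltP 0 (ratr q.2 : R); last first.
  rewrite (_ : _ @^-1` _ = set0)//.
  by apply/seteqP; split => // x [] /=; rewrite ltNge r0.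
rewrite (_ : _ @^-1` _ =
  \bigcap_(i in [set: 'I_n]) (fun x => f x 0 i) @^-1` ball (ratr (q.1 0 i) : R) (ratr q.2)).
  apply: fin_bigcap_measurable => // i _.
  by rewrite -[X in measurable X]setTI; apply: mf => //; exact: measurable_ball.
apply/seteqP; split => [x [_ /= H] i _|x H].
  by have := H 0 i; rewrite mxE.
by split => // i j; have := H j I; rewrite mxE/= (ord1 i).
Qed.

Lemma measurable_rV_coord d (T : measurableType d) n (f : T -> 'rV[R]_n) i :
  measurable_fun setT f -> measurable_fun setT (fun x => f x 0 i).
Proof. by move=> mf; exact: (measurableT_comp (measurable_coord i) mf). Qed.

Lemma measurable_rVD d (T : measurableType d) n (f g : T -> 'rV[R]_n) :
  measurable_fun setT f -> measurable_fun setT g ->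
  measurable_fun setT (fun x => f x + g x).
Proof.
move=> mf mg; apply: measurable_rVP => i.
under [X in measurable_fun _ X]eq_fun do rewrite mxE.
by apply: measurable_funD; exact: measurable_rV_coord.
Qed.

Lemma measurable_rVN d (T : measurableType d) n (f : T -> 'rV[R]_n) :
  measurable_fun setT f -> measurable_fun setT (fun x => - f x).
Proof.
move=> mf; apply: measurable_rVP => i.
under [X in measurable_fun _ X]eq_fun do rewrite mxE.
exact: (measurableT_comp (@oppr_measurable _ _) (measurable_rV_coord i mf)).
Qed.

Lemma measurable_rVB d (T : measurableType d) n (f g : T -> 'rV[R]_n) :
  measurable_fun setT f -> measurable_fun setT g ->
  measurable_fun setT (fun x => f x - g x).
Proof. by move=> mf mg; apply: measurable_rVD => //; exact: measurable_rVN. Qed.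

Lemma continuous_measurable_rV n (f : 'rV[R]_n -> R) :
  continuous f -> measurable_fun setT f.
Proof.
move=> cf; apply: (measurability (@RGenOInfty.G R)).
  exact: RGenOInfty.measurableE.
move=> _ [_ [a ->] <-]; rewrite setTI; apply: open_measurable_rV.
by apply: open_comp; [move=> x _; exact: cf|exact: interval_open].
Qed.

End measurable_rV.

Section lebesgue_rV.
Context {R : realType}.

(** [lebesgue_rV] is a fixpoint with values in bundled measures. This alias of plain function type
    is a head constant to which the measure and sigma-finiteness structures can be attached. *)
Definition leb n : set 'rV[R]_n -> \bar R := lebesgue_rV n.
Arguments leb : clear implicits.
HB.instance Definition _ n := Measure.on (leb n).

Lemma leb_box_lty n (a : R) : (leb n [set x : 'rV[R]_n | forall i, (`|x ord0 i| <= a)%R] < +oo)%E.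
Proof.
rewrite /leb (_ : mkset _ =
    [set x : 'rV[R]_n | forall i, `[- a, a]%classic (x ord0 i)]).
  rewrite (lebesgue_rV_box (A := fun=> `[- a, a]%classic))//.
  under eq_bigr do rewrite lebesgue_measure_itv/=.
  rewrite (_ : (\prod_(i < n) _)%E = (\prod_(i < n) (if - a < a then a + a else 0)%R)%:E) ?ltry//.
  rewrite -prodEFin; apply: eq_bigr => i _.
  by rewrite lte_fin; case: ifP => //; rewrite -EFinB opprK.
by apply/seteqP; split => x /= + i => /(_ i); rewrite in_itv/= ler_norml.
Qed.

Lemma measurable_cube n (a : R) :
  measurable [set x : 'rV[R]_n | forall i, `|x 0 i| <= a].
Proof.
apply: (@measurable_box R n (fun=> [set r | `|r| <= a])) => i.
rewrite (_ : mkset _ = `[- a, a]%classic)//.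
by apply/seteqP; split => x /=; rewrite in_itv/= ler_norml.
Qed.

Lemma leb_sigma_finite n : sigma_finite setT (leb n).
Proof.
exists (fun k => [set x : 'rV[R]_n | forall i, (`|x ord0 i| <= k%:R)%R]).
  apply/seteqP; split => // x _.
  have [k xk] : exists k : nat, forall i, `|x 0 i| <= k%:R.
    exists (Num.Def.trunc (\sum_i `|x 0 i|)).+1 => i.
    apply: le_trans (ltW (truncnS_gt _)).
    by rewrite (bigD1 i)//= lerDl sumr_ge0.
  by exists k.
move=> k; split; first exact: measurable_cube.
exact: leb_box_lty.
Qed.

HB.instance Definition _ n := @Measure_isSigmaFinite.Build _ _ _ (leb n) (@leb_sigma_finite n).

(** Induction on the dimension: [rv_cons] intertwines the translation by [y] with a product of two
    translations, so [preserving_prod] applies. In dimension 0 there is only one row. *)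
Lemma preserving_leb n (y : 'rV[R]_n) : preserving (leb n) (fun x => x + y).
Proof.
split; first by apply: measurable_rVD => //; exact: measurable_cst.
elim: n y => [|n IH] y A mA.
  by congr (leb _); apply/seteqP; split => x /=; rewrite !(thinmx0 _).
have mV B : measurable B -> measurable (@rv_cons R n @^-1` B).
  by move=> mB; rewrite -[X in measurable X]setTI; exact: measurable_rv_cons.
pose y' : 'rV[R]_n := \row_j y 0 (lift ord0 j).
have p1 : preserving (leb n) (fun x => x + y').
  by split; [apply: measurable_rVD => //; exact: measurable_cst|exact: IH].
have [_ /(_ _ (mV _ mA)) H] := preserving_prod p1 (preserving_shift (y 0 ord0)).
rewrite /leb/= /lebesgue_rV_step /pushforward -[RHS]H.
congr (product_measure1 _ _ _); apply/seteqP.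
suff E (v : 'rV[R]_n) (a : R) : rv_cons (v, a) + y = rv_cons (v + y', a + y 0 ord0).
  by split => -[v a] /=; rewrite -E.
apply/rowP => i; rewrite !mxE/=; case: unliftP => [j ->|->//].
by rewrite !mxE.
Qed.

End lebesgue_rV.
Arguments leb {R} n _.

(** * Continuity of translations in L1 *)

Section L1_norm.
Context d (T : measurableType d) (R : realType).
Variable m : {measure set T -> \bar R}.
Implicit Types f g : T -> R.

Definition nrm1 f : \bar R := (\int[m]_x `|f x|%:E)%E.

Lemma nrm1_ge0 f : (0 <= nrm1 f)%E.
Proof. by apply: integral_ge0 => x _; rewrite lee_fin. Qed.

Lemma measurable_normE f : measurable_fun setT f ->
  measurable_fun setT (fun x => `|f x|%:E).
Proof. by move=> mf; apply/measurable_EFinP; exact: measurableT_comp. Qed.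

Lemma le_integral_ge0 (F G : T -> \bar R) : measurable_fun setT F ->
  measurable_fun setT G -> (forall x, 0 <= F x <= G x)%E ->
  (\int[m]_x F x <= \int[m]_x G x)%E.
Proof.
by move=> mF mG FG; apply: ge0_le_integral => // x _; case/andP: (FG x).
Qed.

Lemma integralZl_ge0 (k : R) f : 0 <= k -> measurable_fun setT f ->
  (forall x, 0 <= f x) -> (\int[m]_x (k * f x)%:E = k%:E * \int[m]_x (f x)%:E)%E.
Proof.
move=> k0 mf f0; under eq_integral do rewrite EFinM.
rewrite ge0_integralZl//; first exact/measurable_EFinP.
by move=> x _; rewrite lee_fin.
Qed.

Lemma le_nrm1 f g : measurable_fun setT f -> measurable_fun setT g ->
  (forall x, `|f x| <= `|g x|) -> (nrm1 f <= nrm1 g)%E.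
Proof.
move=> mf mg fg; apply: le_integral_ge0; [exact: measurable_normE..|].
by move=> x; rewrite !lee_fin normr_ge0 fg.
Qed.

Lemma nrm1D f g : measurable_fun setT f -> measurable_fun setT g ->
  (nrm1 (fun x => f x + g x)%R <= nrm1 f + nrm1 g)%E.
Proof.
move=> mf mg; rewrite /nrm1 -ge0_integralD//; [|exact: measurable_normE..].
apply: le_integral_ge0.
- by apply: measurable_normE; exact: measurable_funD.
- by apply: emeasurable_funD; exact: measurable_normE.
- by move=> x; rewrite -EFinD !lee_fin normr_ge0 ler_normD.
Qed.

Lemma nrm1_triangle f g (h : T -> R) : measurable_fun setT f -> measurable_fun setT g ->
  measurable_fun setT h -> (nrm1 (fun x => f x - h x)%R <=
    nrm1 (fun x => f x - g x)%R + nrm1 (fun x => g x - h x)%R)%E.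
Proof.
move=> mf mg mh.
rewrite (_ : (fun x => f x - h x) = (fun x => (f x - g x) + (g x - h x))).
  by apply: nrm1D; exact: measurable_funB.
by apply/funext => x; rewrite addrA subrK.
Qed.

Lemma integrable_nrm1 f : measurable_fun setT f ->
  m.-integrable setT (EFin \o f) <-> (nrm1 f < +oo)%E.
Proof.
move=> mf; split => [/integrableP[]//|f1]; apply/integrableP; split => //.
exact/measurable_EFinP.
Qed.

Lemma integrable_measurable f :
  m.-integrable setT (EFin \o f) -> measurable_fun setT f.
Proof. by move=> /integrableP[/measurable_EFinP]. Qed.

Lemma dominated_nrm1 (f_ : nat -> T -> R) f g :
  (forall k, measurable_fun setT (f_ k)) -> measurable_fun setT f ->
  (forall x, f_ ^~ x @ \oo --> f x) ->
  m.-integrable setT (EFin \o g) -> (forall k x, `|f_ k x| <= g x) ->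
  nrm1 (fun x => f x - f_ k x) @[k --> \oo] --> 0%E.
Proof.
move=> mf_ mf f_f ig fg.
have [] := @dominated_convergence _ T R m setT measurableT
  (fun k x => (f_ k x)%:E) (EFin \o f) (EFin \o g).
- by move=> k; exact/measurable_EFinP.
- exact/measurable_EFinP.
- by apply: aeW => x _; apply: cvg_EFin; [exact: nearW|exact: f_f].
- exact: ig.
- by apply: aeW => x k _; rewrite lee_fin.
move=> _ + _.
apply: cvg_trans; apply: near_eq_cvg; apply: nearW => k.
by apply: eq_integral => x _; rewrite -EFinB abse_EFin distrC.
Qed.

Lemma cvg0_le (u : nat -> \bar R) (e : R) : 0 < e -> u @ \oo --> 0%E ->
  (forall k, 0 <= u k)%E -> exists K, forall k, (K <= k)%N -> (u k <= e%:E)%E.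
Proof.
move=> e0 /fine_cvgP[[K1 _ uf] /cvgrPdist_le /(_ _ e0)[K2 _ uK]] u0.
exists (maxn K1 K2) => k; rewrite geq_max => /andP[k1 k2].
have := uK _ k2; rewrite sub0r normrN /= => H.
by rewrite -(fineK (uf _ k1)) lee_fin (le_trans _ H)// ler_norm.
Qed.

End L1_norm.

Section translation_continuity.
Context {R : realType} {n : nat}.
Local Notation X := 'rV[R]_n.
Local Notation m := (@leb R n).
Implicit Types (f g : X -> R) (A : set X).

Definition shift_cvg f := forall e : R, 0 < e -> exists2 r : R, 0 < r &
  forall y : X, (forall i, `|y 0 i| < r) ->
    (nrm1 m (fun x => f (x + y) - f x)%R <= e%:E)%E.

Lemma measurable_shift (f : X -> R) (y : X) : measurable_fun setT f ->
  measurable_fun setT (fun x : X => f (x + y)).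
Proof. by move=> mf; exact: (measurableT_comp mf (preserving_leb y).1). Qed.

Lemma nrm1_shift f (y : X) : measurable_fun setT f ->
  nrm1 m (fun x : X => f (x + y)) = nrm1 m f.
Proof.
move=> mf; apply: (preserving_ge0_integral (preserving_leb y) (f := fun x => `|f x|%:E)).
  exact: measurable_normE.
by move=> x; rewrite lee_fin.
Qed.

Lemma shift_cvgB f g : measurable_fun setT f -> measurable_fun setT g ->
  shift_cvg f -> shift_cvg g -> shift_cvg (fun x => f x - g x).
Proof.
move=> mf mg tf tg e e0.
have e20 : 0 < e / 2 by rewrite divr_gt0.
have [r r0 fr] := tf _ e20; have [s s0 gs] := tg _ e20.
exists (Num.min r s) => [|y ym]; first by rewrite lt_min r0.
have yr i : `|y 0 i| < r by apply: lt_le_trans (ym i) _; rewrite ge_min lexx.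
have ys i : `|y 0 i| < s by apply: lt_le_trans (ym i) _; rewrite ge_min lexx orbT.
have mfy := measurable_funB (measurable_shift y mf) mf.
have mgy := measurable_funB (measurable_shift y mg) mg.
apply: (@le_trans _ _ (nrm1 m (fun x => f (x + y) - f x)%R +
   nrm1 m (fun x => g (x + y) - g x)%R)%E); last first.
  by rewrite [e in leRHS]splitr EFinD leeD// ?fr ?gs.
apply: (@le_trans _ _ (nrm1 m (fun x => f (x + y) - f x)%R +
   nrm1 m (fun x => - (g (x + y) - g x))%R)%E); last first.
  by rewrite leeD2l// /nrm1; under eq_integral do rewrite normrN.
apply: le_trans (nrm1D _ _ _) => //; last exact: measurableT_comp.
rewrite le_eqVlt; apply/orP; left; apply/eqP; congr (nrm1 m _).
by apply/funext => x; lra.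
Qed.

Lemma shift_cvgZ (k : R) f : measurable_fun setT f -> shift_cvg f -> shift_cvg (fun x => k * f x).
Proof.
move=> mf tf e e0.
have k10 : 0 < `|k| + 1 by rewrite ltr_pwDr.
have [r r0 fr] := tf (e / (`|k| + 1)) (divr_gt0 e0 k10).
exists r => // y /fr H.
have mfy := measurable_funB (measurable_shift y mf) mf.
apply: (@le_trans _ _ ((`|k| + 1)%:E * nrm1 m (fun x => f (x + y) - f x)%R)%E); last first.
  rewrite (_ : e%:E = (`|k| + 1)%:E * (e / (`|k| + 1))%:E)%E; last first.
    by rewrite -EFinM; congr EFin; field; rewrite gt_eqF.
  by rewrite lee_pmul2l// lte_fin.
rewrite /nrm1 -ge0_integralZl//; [|exact: measurable_normE].
apply: le_integral_ge0.
- apply: measurable_normE; apply: measurable_funB.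
    exact: measurable_funM (measurable_cst _) (measurable_shift _ _).
  exact: measurable_funM.
- by apply: measurable_funeM; exact: measurable_normE.
- move=> x; rewrite -EFinM !lee_fin normr_ge0/= -mulrBr normrM ler_wpM2r//.
  by rewrite lerDl.
Qed.

(** The usual argument with three thirds of [e]: translation invariance makes the error of the
    shifted functions equal to that of the unshifted ones. *)
Lemma shift_cvg_closed f : measurable_fun setT f ->
  (forall e : R, 0 < e -> exists g, [/\ measurable_fun setT g, shift_cvg g &
    (nrm1 m (fun x => f x - g x)%R <= e%:E)%E]) -> shift_cvg f.
Proof.
move=> mf H e e0; have e30 : 0 < e / 3 by rewrite divr_gt0.
have [g [mg tg fg]] := H _ e30; have [r r0 gr] := tg _ e30.
exists r => // y /gr {}gr.
have mfy := measurable_shift y mf; have mgy := measurable_shift y mg.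
apply: le_trans (nrm1_triangle _ mfy mgy mf) _.
have := nrm1_triangle m mgy mg mf.
rewrite (@nrm1_shift (fun x => f x - g x)); last exact: measurable_funB.
have -> : nrm1 m (fun x => g x - f x) = nrm1 m (fun x => f x - g x).
  by apply: eq_integral => x _; rewrite distrC.
move=> H1; apply: le_trans (leeD fg (le_trans H1 (leeD gr fg))) _.
by rewrite -!EFinD lee_fin; lra.
Qed.

Lemma shift_cvgD f g : measurable_fun setT f -> measurable_fun setT g ->
  shift_cvg f -> shift_cvg g -> shift_cvg (fun x => f x + g x).
Proof.
move=> mf mg tf tg.
rewrite (_ : (fun x => _) = (fun x => f x - (-1 * g x))).
  apply: shift_cvgB => //; first exact: measurable_funM.
  exact: shift_cvgZ.
by apply/funext => x; rewrite mulN1r opprK.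
Qed.

(* For an open set [U] the part of [U] that leaves [U] under a small shift
   vanishes by dominated convergence; the part entering [U] is the same
   quantity for the opposite shift. *)
Lemma shift_cvg_open (U : set X) : open U -> (m U < +oo)%E -> shift_cvg (\1_U : X -> R).
Proof.
move=> oU Uoo; have mU := open_measurable_rV oU.
have mi : measurable_fun setT (\1_U : X -> R) by exact: measurable_indic.
pose h (y x : X) : R := \1_U x * (1 - \1_U (x + y)).
have mh y : measurable_fun setT (h y).
  apply: measurable_funM => //; apply: measurable_funB => //.
  exact: (measurable_shift y mi).
have h0 y x : 0 <= h y x by rewrite mulr_ge0// subr_ge0 indicE lern1 leq_b1.
have hh y x : `|\1_U (x + y) - \1_U x| <= h y x + h (- y) (x + y) :> R.
  rewrite /h addrK !indicE; case: (_ \in _); case: (_ \in _) => /=;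
  by rewrite ?subrr ?normr0 ?subr0 ?sub0r ?normrN ?normr1; lra.
suff H : forall e : R, 0 < e -> exists2 r : R, 0 < r & forall y : X,
    (forall i, `|y 0 i| < r) -> (\int[m]_x (h y x)%:E <= e%:E)%E.
  move=> e e0; have [r r0 {}H] := H _ (divr_gt0 e0 (ltr0Sn R 1)).
  exists r => // y yr.
  have yr' i : `|(- y) 0 i| < r by rewrite mxE normrN.
  apply: (@le_trans _ _ (\int[m]_x ((h y x)%:E + (h (- y) (x + y))%:E))%E).
    apply: le_integral_ge0.
    - apply: measurable_normE; apply: measurable_funB => //.
      exact: (measurable_shift y mi).
    - apply: emeasurable_funD; apply/measurable_EFinP => //.
      exact: measurable_shift.
    - by move=> x; rewrite -EFinD !lee_fin normr_ge0 hh.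
  rewrite ge0_integralD//; last 4 first.
  - by move=> x _; rewrite lee_fin.
  - exact/measurable_EFinP.
  - by move=> x _; rewrite lee_fin.
  - by apply/measurable_EFinP; exact: measurable_shift.
  rewrite (preserving_ge0_integral (preserving_leb y) (f := fun x => (h (- y) x)%:E)).
  - by rewrite [e in leRHS]splitr EFinD leeD// H.
  - exact/measurable_EFinP.
  - by move=> x; rewrite lee_fin.
move=> e e0; apply: contrapT => /forall2NP H.
have {}H k : exists y : X, (forall i, `|y 0 i| < k.+1%:R^-1) /\
    (e%:E < \int[m]_x (h y x)%:E)%E.
  have [|] := H (k.+1%:R^-1); first by rewrite invr_gt0 ltr0Sn.
  move=> /existsNP[y /not_implyP[yk /negP]]; rewrite -ltNge => ye.
  by exists y.
have /choice[y yP] := H.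
have [] := @dominated_convergence _ X R m setT measurableT
  (fun k x => (h (y k) x)%:E) (cst 0%E) (fun x => (\1_U x)%:E).
- by move=> k; exact/measurable_EFinP.
- by [].
- apply: aeW => x _ /=.
  have [xU|xU] := pselect (U x); last first.
    rewrite (_ : (fun k => _) = cst 0%E); first exact: cvg_cst.
    by apply/funext => k; rewrite /h indicE memNset// mul0r.
  have /nbhs_ballP[r /= r0 rU] : nbhs x U by exact: open_nbhs_nbhs.
  apply: cvg_near_cst; near=> k.
  rewrite /h !indicE mem_set// mem_set ?subrr ?mulr0//.
  apply: rU; split => // i j; rewrite mxE /ball/= (ord1 i) opprD addNKr normrN.
  apply: (lt_trans ((yP k).1 j)).
  by near: k; exact: near_infty_natSinv_lt (PosNum r0).
- apply/integrableP; split; first exact/measurable_EFinP.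
  under eq_integral do rewrite abse_EFin ger0_norm//.
  by rewrite integral_indic// setIT.
- apply: aeW => x k _ /=; rewrite lee_fin ger0_norm// /h ler_piMr//.
move=> _ _; rewrite integral0 => /fine_cvgP[_ /cvgrPdist_lt /(_ _ e0)[k _ /(_ k (leqnn k))]].
rewrite sub0r normrN /= => H1.
have ifin : (\int[m]_x (h (y k) x)%:E < +oo)%E.
  apply: le_lt_trans Uoo.
  rewrite (_ : m U = \int[m]_x (\1_U x)%:E)%E; last by rewrite integral_indic// setIT.
  apply: le_integral_ge0.
  - exact/measurable_EFinP.
  - exact/measurable_EFinP.
  - by move=> x; rewrite !lee_fin h0 /h ler_piMr// lerBlDr lerDl.
have [_] := yP k; rewrite ltNge => /negP; apply.
have i0 : (0 <= \int[m]_x (h (y k) x)%:E)%E.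
  by apply: integral_ge0 => x _; rewrite lee_fin.
rewrite -[X in (X <= _)%E]fineK ?ge0_fin_numE//.
by rewrite lee_fin ltW// (le_lt_trans _ H1)// ler_norm.
Unshelve. all: by end_near. Qed.

Lemma shift_cvg_approx f (f_ : nat -> X -> R) : measurable_fun setT f ->
  (forall k, measurable_fun setT (f_ k)) -> (forall k, shift_cvg (f_ k)) ->
  nrm1 m (fun x => f x - f_ k x) @[k --> \oo] --> 0%E -> shift_cvg f.
Proof.
move=> mf mf_ tf_ ff_; apply: shift_cvg_closed => // e e0.
have [k /(_ k (leqnn k)) H] := cvg0_le e0 ff_ (fun=> nrm1_ge0 _ _).
by exists (f_ k).
Qed.

Lemma shift_cvg_sum (I : Type) (s : seq I) (F : I -> X -> R) :
  (forall i, measurable_fun setT (F i)) -> (forall i, shift_cvg (F i)) ->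
  shift_cvg (fun x => \sum_(i <- s) F i x).
Proof.
move=> mF tF; elim: s => [|i s IH].
  under eq_fun do rewrite big_nil.
  move=> e e0; exists 1 => // y _; rewrite /nrm1.
  by under eq_integral do rewrite subrr normr0; rewrite integral0 lee_fin ltW.
under eq_fun do rewrite big_cons.
by apply: shift_cvgD => //; exact: measurable_sum.
Qed.

Let Q k : set X := ball (0 : X) k.+1%:R.

Let Qopen k : open (Q k).
Proof. exact: ball_open. Qed.

Let QE k x : Q k x <-> forall i, `|x 0 i| < k.+1%:R.
Proof.
split => [[_ H] i|H]; first by have := H 0 i; rewrite /ball/= mxE sub0r normrN.
by split => // i j; rewrite /ball/= (ord1 i) mxE sub0r normrN.
Qed.

Let Qlty k A : A `<=` Q k -> measurable A -> (m A < +oo)%E.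
Proof.
move=> AQ mA; apply: le_lt_trans (leb_box_lty n k.+1%:R).
rewrite le_measure ?inE//; first exact: measurable_cube.
by move=> x /AQ /QE H i; exact: ltW.
Qed.

(** Intersecting with the box [Q k] keeps all measures finite, so that complements and countable
    disjoint unions preserve the property and Dynkin's theorem leads from open sets to all Borel
    sets. *)
Let shift_cvg_indicI k A : measurable A -> shift_cvg (\1_(A `&` Q k) : X -> R).
Proof.
have mQ := open_measurable_rV (@Qopen k).
move: A; apply: (@dynkin_induction _ X (@open X)) => //.
- exact: openI.
- rewrite setTI; apply: shift_cvg_open => //; exact: (@Qlty k).
- move=> U oU; apply: shift_cvg_open; first exact: openI.
  by apply: (@Qlty k) => //; apply: measurableI => //; exact: open_measurable_rV.
- move=> S mS tS.
  rewrite (_ : \1_ _ = fun x => \1_(Q k) x - \1_(S `&` Q k) x).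
    apply: shift_cvgB => //.
    - by apply: measurable_indic; exact: measurableI.
    - by apply: shift_cvg_open => //; exact: (@Qlty k).
  apply/funext => x; rewrite !indicE !in_setI in_setC.
  by case: (_ \in S); case: (_ \in Q k) => /=; rewrite ?subrr ?subr0.
- move=> F mF tF tcF.
  pose f_ j (x : X) : R := \sum_(i < j) \1_(F i `&` Q k) x.
  have mi i : measurable_fun setT (\1_(F i `&` Q k) : X -> R).
    by apply: measurable_indic; exact: measurableI.
  have mf_ j : measurable_fun setT (f_ j) by exact: measurable_sum.
  have f_1 j x i : (i < j)%N -> F i x -> Q k x -> f_ j x = 1.
    move=> ij Fix Qx; rewrite /f_ (bigD1 (Ordinal ij))//= indicE mem_set//.
    rewrite big1 ?addr0// => l /negP li; rewrite indicE memNset// => -[Fl _].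
    by apply: li; apply/eqP/val_inj => /=; apply: (tF _ _ I I); exists x.
  have f_0 j x : (~ exists i, (i < j)%N /\ F i x /\ Q k x) -> f_ j x = 0.
    move=> H; rewrite /f_ big1// => i _; rewrite indicE memNset// => -[Fi Qx].
    by apply: H; exists i.
  apply: (@shift_cvg_approx _ f_) => //.
  + apply: measurable_indic; apply: measurableI => //.
    exact: bigcup_measurable.
  + by move=> j; apply: shift_cvg_sum.
  + apply: (@dominated_nrm1 _ _ _ _ _ _ (\1_(Q k))) => //.
    * apply: measurable_indic; apply: measurableI => //.
      exact: bigcup_measurable.
    * move=> x; have [[[i _ Fi] Qx]|H] := pselect ((\bigcup_i F i `&` Q k) x).
        apply: cvg_near_cst; exists i.+1 => // j /= ij.
        by rewrite (f_1 _ _ i)// indicE mem_set//; split => //; exists i.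
      apply: cvg_near_cst; apply: nearW => j; rewrite indicE memNset//.
      by apply: f_0 => -[i [_ [Fi Qx]]]; apply: H; split => //; exists i.
    * apply/integrable_nrm1; first exact: measurable_indic.
      rewrite /nrm1; under eq_integral do rewrite ger0_norm//.
      by rewrite integral_indic// setIT; exact: (@Qlty k).
    * move=> j x; have [[i [ij [Fi Qx]]]|H] := pselect (exists i, (i < j)%N /\ F i x /\ Q k x).
        by rewrite (f_1 _ _ i)// normr1 indicE mem_set.
      by rewrite f_0// normr0 indicE.
Qed.

Let cvg_Q f : measurable_fun setT f -> m.-integrable setT (EFin \o f) ->
  nrm1 m (fun x => f x - f x * \1_(Q k) x) @[k --> \oo] --> 0%E.
Proof.
move=> mf fi; apply: (@dominated_nrm1 _ _ _ _ (fun k x => f x * \1_(Q k) x) _ (fun x => `|f x|)) => //.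
- move=> k; apply: measurable_funM => //; apply: measurable_indic.
  exact: open_measurable_rV.
- move=> x; apply: cvg_near_cst; near=> k.
  rewrite indicE mem_set ?mulr1//; apply/QE => i.
  apply: (@le_lt_trans _ _ (\sum_i `|x 0 i|)).
    by rewrite (bigD1 i)//= lerDl sumr_ge0.
  apply: (@lt_le_trans _ _ k%:R); last by rewrite ler_nat.
  by near: k; exact: nbhs_infty_gtr.
- exact: integrable_norm.
- by move=> k x /=; rewrite normrM ler_piMr// indicE ger0_norm// lern1 leq_b1.
Unshelve. all: by end_near. Qed.

Import HBSimple.

(** Simple functions approximate [f] in L1; cutting each of them down to boxes leaves finite
    combinations of indicators of sets of finite measure. *)
Lemma shift_cvg_integrable f : m.-integrable setT (EFin \o f) -> shift_cvg f.
Proof.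
move=> fi; have mf : measurable_fun setT f by exact: integrable_measurable fi.
have [g_ [gi _ gf]] := approximation_sfun_integrable measurableT fi.
apply: (@shift_cvg_approx _ (fun j => g_ j : X -> R)) => //.
move=> j; have mg : measurable_fun setT (g_ j) by [].
apply: (@shift_cvg_approx _ (fun k x => g_ j x * \1_(Q k) x)) => //; last exact: cvg_Q.
  move=> k; apply: measurable_funM => //; apply: measurable_indic.
  exact: open_measurable_rV.
move=> k; rewrite (_ : (fun x => _) = fun x => \sum_(y \in range (g_ j)) (y * \1_((g_ j @^-1` [set y]) `&` Q k) x)).
  under eq_fun do rewrite fsbig_finite//=.
  apply: shift_cvg_sum.
    move=> i; apply: measurable_funM => //; apply: measurable_indic.
    by apply: measurableI => //; exact: open_measurable_rV.
  move=> i; apply: shift_cvgZ; last by apply: shift_cvg_indicI.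
  apply: measurable_indic.
  by apply: measurableI => //; exact: open_measurable_rV.
apply/funext => x; rewrite {1}(fimfunE (g_ j)) !fsbig_finite//= mulr_suml.
by apply: eq_bigr => y _; rewrite -mulrA !indicE in_setI -natrM mulnb.
Qed.

End translation_continuity.

Section spacetime.
Context {R : realType} {N : nat}.
Local Notation X := 'rV[R]_N.
Local Notation Z := (X * measurableTypeR R)%type.
Local Notation lZ := (leb N \x @lebesgue_measure R)%E.

Lemma preserving_spacetime (y : X) (s : R) :
  preserving lZ (fun p : Z => (p.1 + y, p.2 + s)).
Proof. exact: preserving_prod (preserving_leb y) (preserving_shift s). Qed.

(** The inverse of [rv_cons]. Composing with it turns functions on space-time into functions on rows
    of length N + 1, where continuity of translations is already known. *)
Let split (v : 'rV[R]_N.+1) : Z := (\row_j v 0 (lift ord0 j), v 0 ord0).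

Let measurable_split : measurable_fun setT split.
Proof.
apply/measurable_fun_pairP; split; last exact: measurable_coord.
apply: measurable_rVP => i /=; under eq_fun do rewrite mxE.
exact: measurable_coord.
Qed.

Let splitK (p : Z) : split (rv_cons p) = p.
Proof.
case: p => x t; congr pair; last by rewrite mxE unlift_none.
by apply/rowP => j; rewrite !mxE liftK.
Qed.

Let integral_cons (f : 'rV[R]_N.+1 -> \bar R) : measurable_fun setT f ->
  (forall x, 0 <= f x)%E -> (\int[leb N.+1]_x f x = \int[lZ]_p f (rv_cons p))%E.
Proof.
move=> mf f0; have := ge0_integral_pushforward (@measurable_rv_cons R N)
  lZ measurableT mf (fun x _ => f0 x).
by rewrite preimage_setT => <-.
Qed.

Lemma translation_L1 (f : Z -> R) : lZ.-integrable setT (EFin \o f) ->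
  forall e : R, 0 < e -> exists2 r : R, 0 < r &
  forall (y : X) (s : R), (forall i, `|y 0 i| < r) -> `|s| < r ->
    (nrm1 lZ (fun p => f (p.1 + y, p.2 + s)%R - f p)%R <= e%:E)%E.
Proof.
move=> fi e e0; have mf := integrable_measurable fi.
have mfs : measurable_fun setT (f \o split) by exact: measurableT_comp.
have : (leb N.+1).-integrable setT (EFin \o (f \o split)).
  apply/integrable_nrm1 => //; rewrite /nrm1 integral_cons//; last first.
    exact: measurable_normE.
  under eq_integral do rewrite /= splitK.
  exact/(integrable_nrm1 _ mf).
move=> /shift_cvg_integrable /(_ _ e0)[r r0 H]; exists r => // y s yr sr.
apply: le_trans (H (rv_cons (y, s)) _); last first.
  by move=> i; rewrite mxE; case: unliftP.
rewrite /nrm1 [in leRHS]integral_cons//; last first.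
  apply: measurable_normE; apply: measurable_funB => //.
  exact: (measurable_shift (rv_cons (y, s)) mfs).
rewrite le_eqVlt; apply/orP; left; apply/eqP; apply: eq_integral => p _.
rewrite /= splitK; congr (`|f _ - _|%:E).
rewrite /split; congr pair; last by rewrite !mxE !unlift_none.
by apply/rowP => j; rewrite !mxE !liftK.
Qed.

End spacetime.

(** * Smooth functions *)

Section smooth_line.
Context {R : realType}.

(* Coinductive: [g] belongs to a class of functions closed under
   differentiation. *)
Definition smooth1 (g : R -> R) := exists2 P : (R -> R) -> Prop, P g &
  forall f, P f -> exists2 f', P f' & forall x : R, is_derive x 1 f (f' x).

Lemma smooth1_derive g : smooth1 g ->
  exists2 g', smooth1 g' & forall x : R, is_derive x 1 g (g' x).
Proof. by move=> [P Pg HP]; have [g' Pg' gg'] := HP _ Pg; exists g' => //; exists P. Qed.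

Lemma smooth1_affine (a b : R) : smooth1 (fun x => a * x + b).
Proof.
exists (fun f => exists a b, f = fun x => a * x + b); first by exists a, b.
move=> _ [c [d ->]]; exists (fun=> c); first by exists 0, c; apply/funext => x; rewrite mul0r add0r.
move=> x; apply: is_derive_eq; rewrite addr0.
by rewrite [c *: 1]mulr1.
Qed.

Lemma smooth1_expR : smooth1 (@expR R).
Proof. exists (fun f => f = @expR R) => // _ ->; exists (@expR R) => // x.
exact: is_derive_expR. Qed.

(** The functions [p(1/x) exp(-1/x)], extended by zero, form a class stable under differentiation;
    it contains the standard building block [e0] of bump functions. *)
Definition flat (p : {poly R}) (x : R) : R :=
  if 0 < x then p.[x^-1] * expR (- x^-1) else 0.

(** Each monomial is beaten by a single term of the exponential series, which is where the
    factorials come from. *)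
Lemma horner_expRN_bounded (p : {poly R}) :
  exists C : R, forall y, 0 <= y -> `|p.[y] * expR (- y)| <= C.
Proof.
elim/poly_ind: p => [|p c [C HC]].
  by exists 0 => y _; rewrite horner0 mul0r normr0.
suff [D HD] : exists D : R, forall y, 0 <= y -> `|p.[y] * y * expR (- y)| <= D.
  exists (D + `|c|) => y y0; rewrite hornerD hornerMX hornerC mulrDl.
  apply: le_trans (ler_normD _ _) _; apply: lerD; first exact: HD.
  by rewrite normrM ler_piMr// ger0_norm ?expR_ge0// expR_le1 oppr_le0.
clear C HC; exists (\sum_(i < size p) `|p`_i| * (i.+1)`!%:R) => y y0.
rewrite horner_coef !mulr_suml; apply: le_trans (ler_norm_sum _ _ _) _.
apply: ler_sum => i _; rewrite -!mulrA normrM ler_wpM2l//.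
rewrite mulrA -exprSr ger0_norm ?mulr_ge0 ?expR_ge0 ?exprn_ge0//.
rewrite expRN ler_pdivrMr ?expR_gt0//.
rewrite -ler_pdivrMl ?ltr0n ?fact_gt0// mulrC.
by apply: le_trans (expR_ge1Dxn i y0); rewrite lerDr.
Qed.

Lemma is_derive_flat p (x : R) :
  is_derive x 1 (flat p) (flat ('X^2 * (p - p^`())) x).
Proof.
have [x0|x0|->] := ltgtP x 0.
- rewrite {2}/flat ltNge (ltW x0)/=.
  apply: (@near_eq_is_derive R R R^o (cst 0)) => //.
  near=> y; rewrite /flat ltNge ltW//; near: y.
  exact: lt_nbhsl.
- rewrite {2}/flat x0.
  apply: (@near_eq_is_derive R _ _ (fun x : R => p.[x^-1] * expR (- x^-1) : R) (flat p) x 1).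
  + near=> y; rewrite /flat ifT//; near: y; exact: lt_nbhsr.
  have xn0 : x != 0 by rewrite gt_eqF.
  have dV : is_derive x 1 (fun y : R => y^-1) (- x ^- 2).
    have := @is_deriveV _ id x 1 1 xn0 (is_derive_id _ _).
    by rewrite /GRing.scale/= mulr1.
  have d1 : is_derive x 1 (fun y => p.[y^-1]) (p^`().[x^-1] * - x ^- 2).
    exact: (@is_derive1_comp _ (horner p) (fun y => y^-1)).
  have d2 : is_derive x 1 (fun y => expR (- y^-1)) (expR (- x^-1) * x ^- 2).
    have dN : is_derive x 1 (fun y : R => - y^-1) (x ^- 2).
      by have := is_deriveN dV; rewrite opprK.
    exact: (@is_derive1_comp _ expR (fun y => - y^-1)).
  have H := is_deriveM d1 d2; apply: (is_derive_eq H).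
  by rewrite !hornerE /GRing.scale/= exprVn; ring.
- rewrite {2}/flat ltxx.
  (* Bounding ['X^2 * p] instead of [p] yields a quadratic bound for [flat p] near 0, so that the
     difference quotient there tends to 0. *)
  have [C HC] := horner_expRN_bounded ('X^2 * p).
  have C0 : 0 <= C by rewrite (le_trans _ (HC 0 (lexx _))).
  have fC h : `|flat p h| <= C * h ^+ 2.
    rewrite /flat; case: ifPn => h0.
      have hn0 : h != 0 by rewrite gt_eqF.
      have := HC h^-1 (ltW (_ : 0 < h^-1)); rewrite invr_gt0 => /(_ h0).
      rewrite !hornerE -mulrA normrM -ler_pdivlMl ?normr_gt0 ?expf_neq0 ?invr_eq0//.
      move=> /le_trans; apply; rewrite ger0_norm; last by rewrite exprn_ge0// invr_ge0 ltW.
      by rewrite -exprVn invrK [leLHS]mulrC expr2 mulrA.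
    by rewrite normr0 mulr_ge0 ?sqr_ge0// (le_trans _ (HC 0 (lexx _))).
  have cvg0 : h^-1 *: (flat p (h *: 1 + 0) - flat p 0) @[h --> 0^'] --> 0.
    apply/cvgr0Pnorm_le => e e0; near=> h.
    have hn0 : h != 0 by near: h; exact: nbhs_dnbhs_neq.
    rewrite /GRing.scale/= mulr1 addr0 [flat p 0]/flat ltxx subr0 normrM normfV.
    rewrite ler_pdivrMl ?normr_gt0//; apply: le_trans (fC _) _.
    rewrite -normr_id -real_normK ?num_real// normr_id expr2 mulrA mulrC ler_wpM2l//.
    apply: (@le_trans _ _ ((C + 1) * `|h|)); first by rewrite ler_wpM2r// lerDl.
    rewrite -ler_pdivlMl ?ltr_pwDr//.
    near: h; apply: dnbhs0_le; by rewrite mulr_gt0// invr_gt0 ltr_pwDr.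
  apply: DeriveDef; first by apply/cvg_ex; exists 0.
  exact/cvg_lim.
Unshelve. all: by end_near. Qed.

Definition e0 : R -> R := flat 1.

Lemma e0E x : e0 x = if 0 < x then expR (- x^-1) else 0.
Proof. by rewrite /e0 /flat hornerC mul1r. Qed.

Lemma e0_ge0 x : 0 <= e0 x.
Proof. by rewrite e0E; case: ifP => // _; exact: expR_ge0. Qed.

Lemma e0_le1 x : e0 x <= 1.
Proof. by rewrite e0E; case: ifPn => // x0; rewrite expR_le1 oppr_le0 invr_ge0 ltW. Qed.

Lemma smooth1_e0 : smooth1 e0.
Proof.
exists (fun f => exists p, f = flat p); first by exists 1.
move=> _ [p ->]; exists (flat ('X^2 * (p - p^`()))); first by exists ('X^2 * (p - p^`())).
exact: is_derive_flat.
Qed.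

End smooth_line.

Section smooth_class.
Context {R : realType}.

Definition lin {V : normedModType R} (l : V -> R) :=
  (forall a u v, l (a *: u + v) = a * l u + l v) /\ forall x, differentiable l x.

(* A class of smooth functions, closed under differentiation, with all the
   closure properties needed to build test functions. *)
Inductive gen {V : normedModType R} : (V -> R) -> Prop :=
| gen_cst c : gen (fun=> c)
| gen_atom l c g : lin l -> smooth1 g -> gen (fun x => g (l x + c))
| gen_add f g : gen f -> gen g -> gen (fun x => f x + g x)
| gen_mul f g : gen f -> gen g -> gen (fun x => f x * g x).

Section smooth_expressions.
Context {V : normedModType R}.
Implicit Types (f g : V -> R) (l : V -> R).

Lemma lin_derive l x v : lin l -> is_derive x v l (l v).
Proof.
move=> [ll dl].
have H : (fun h : R => h^-1 *: (l (h *: v + x) - l x)) @ 0^' --> l v.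
  apply: cvg_near_cst; near=> h.
  have hn0 : h != 0 by near: h; exact: nbhs_dnbhs_neq.
  by rewrite ll addrK /GRing.scale/= mulKf.
by apply: DeriveDef; [apply/cvg_ex; exists (l v)|exact/cvg_lim].
Unshelve. all: by end_near. Qed.

Lemma atom_differentiable l c (g : R -> R) (x : V) : lin l -> smooth1 g ->
  differentiable (fun x => g (l x + c)) x.
Proof.
move=> [ll dl] sg; have [g' _ gg'] := smooth1_derive sg.
apply: (@differentiable_comp _ _ _ _ (fun x => l x + c) g).
  by apply: differentiableD => //; exact: differentiable_cst.
by apply/derivable1_diffP; case: (gg' (l x + c)).
Qed.

Lemma atom_derive l c (g g' : R -> R) (x v : V) : lin l -> (forall x : R, is_derive x 1 g (g' x)) ->
  is_derive x v (fun x => g (l x + c)) (l v * g' (l x + c)).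
Proof.
move=> ll gg'.
have dlc : differentiable (fun x => l x + c) x.
  by apply: differentiableD; [exact: ll.2|exact: differentiable_cst].
have dg : differentiable g (l x + c) by apply/derivable1_diffP; case: (gg' (l x + c)).
have dgl := differentiable_comp dlc dg.
apply: DeriveDef; first exact: diff_derivable.
rewrite deriveE// diff_comp//= -(deriveE v dlc).
have -> : 'D_v (fun x => l x + c) x = l v.
  have d1 := lin_derive x v ll.
  by rewrite (_ : (fun x => l x + c) = l \+ cst c)// deriveD// derive_cst addr0 derive_val.
rewrite -deriveE// -[l v in LHS]mulr1 -[l v * 1]/(l v *: 1) deriveE// linearZ/=.
by rewrite -deriveE// derive_val.
Qed.

Lemma gen_differentiable f x : gen f -> differentiable f x.
Proof.
elim=> [c|l c g ll sg|{}f g _ df _ dg|{}f g _ df _ dg].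
- exact: differentiable_cst.
- exact: atom_differentiable.
- exact: differentiableD.
- exact: differentiableM.
Qed.

Lemma gen_derive f v : gen f -> gen ('D_v f).
Proof.
elim=> [c|l c g ll sg|{}f g gf df gg dg|{}f g gf df gg dg].
- rewrite (_ : 'D_v _ = fun=> 0); first exact: gen_cst.
  by apply/funext => x; rewrite derive_cst.
- have [g' sg' gg'] := smooth1_derive sg.
  rewrite (_ : 'D_v _ = fun x => l v * g' (l x + c)).
    by apply: gen_mul; [exact: gen_cst|exact: gen_atom].
  by apply/funext => x; have [_ ->] := atom_derive c x v ll gg'.
- rewrite (_ : 'D_v _ = fun x => 'D_v f x + 'D_v g x); first exact: gen_add.
  by apply/funext => x; rewrite deriveD//; apply: diff_derivable; exact: gen_differentiable.
- rewrite (_ : 'D_v _ = fun x => f x * 'D_v g x + g x * 'D_v f x).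
    by apply: gen_add; exact: gen_mul.
  by apply/funext => x; rewrite deriveM//; apply: diff_derivable; exact: gen_differentiable.
Qed.

Lemma gen_continuous f : gen f -> continuous f.
Proof. by move=> gf x; exact/differentiable_continuous/gen_differentiable. Qed.

Lemma gen_smooth f : gen f -> smooth f.
Proof.
move=> gf vs; have {gf} : gen (iter_derive vs f).
  by elim: vs => //= v vs; exact: gen_derive.
move=> gf; split; first exact: gen_continuous.
by move=> x v; apply: diff_derivable; exact: gen_differentiable.
Qed.

Lemma gen_prod (I : Type) (s : seq I) (F : I -> V -> R) :
  (forall i, gen (F i)) -> gen (fun x => \prod_(i <- s) F i x).
Proof.
move=> gF; elim: s => [|i s IH].
  by under eq_fun do rewrite big_nil; exact: gen_cst.
by under eq_fun do rewrite big_cons; exact: gen_mul.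
Qed.

End smooth_expressions.

Lemma gen_precomp {V W : normedModType R} (p : W -> V) (b : V) (f : V -> R) :
  (forall a u v, p (a *: u + v) = a *: p u + p v) ->
  (forall x, differentiable p x) -> gen f -> gen (fun x => f (p x + b)).
Proof.
move=> pl dp; elim=> [c|l c g [ll dl] sg|f1 f2 _ g1 _ g2|f1 f2 _ g1 _ g2].
- exact: gen_cst.
- rewrite (_ : (fun x => _) = fun x => g ((l \o p) x + (l b + c))).
    apply: gen_atom => //; split; first by move=> a u v /=; rewrite pl ll.
    by move=> x; apply: differentiable_comp.
  apply/funext => x /=; have := ll 1 (p x) b; rewrite scale1r mul1r => ->.
  by rewrite addrA.
- exact: gen_add.
- exact: gen_mul.
Qed.

End smooth_class.

(** * Mollifiers and test functions *)

Section mollifier.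
Context {R : realType} {N : nat}.
Local Notation X := 'rV[R]_N.

Definition cube (a : R) : set X := [set x | forall i, `|x 0 i| <= a].

Lemma cube_compact a : compact (cube a).
Proof.
have : compact [set x : X | forall i, `[- a, a]%classic (x ord0 i)].
  apply: (@rV_compact R N (fun=> `[- a, a]%classic)) => i.
  exact: segment_compact.
congr compact; apply/seteqP; split => x /= + i => /(_ i);
by rewrite in_itv/= ler_norml.
Qed.

Lemma leb_cube (a : R) : 0 <= a -> leb N (cube a) = ((a *+ 2) ^+ N)%:E.
Proof.
move=> a0; have -> : cube a = [set x : X | forall i, `[- a, a]%classic (x ord0 i)].
  by apply/seteqP; split => x /= + i => /(_ i); rewrite in_itv/= ler_norml.
apply: (eq_trans (lebesgue_rV_box (A := fun=> `[- a, a]%classic) _)) => //.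
under eq_bigr do rewrite lebesgue_measure_itv/=.
rewrite (eq_bigr (fun=> (a *+ 2)%:E)) => [|i _].
  by rewrite prodEFin prodr_const card_ord.
rewrite lte_fin -EFinB opprK mulr2n; case: ltP => // aN.
by congr EFin; lra.
Qed.

Lemma lin_coord (i : 'I_N) (k : R) : lin (fun x : X => k * x 0 i).
Proof.
split=> [a u v|x]; first by rewrite !mxE; ring.
by apply: differentiableM; [exact: differentiable_cst|exact: differentiable_coord].
Qed.

Definition bump (r : R) : R := e0 (1 - r) * e0 (1 + r).

Lemma bump_ge0 r : 0 <= bump r.
Proof. by rewrite mulr_ge0 ?e0_ge0. Qed.

Lemma bump_le1 r : bump r <= 1.
Proof. by rewrite mulr_ile1 ?e0_ge0 ?e0_le1. Qed.

Lemma bump0 r : 1 < `|r| -> bump r = 0.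
Proof.
move=> r1; rewrite /bump !e0E; case: ifPn => r2; last by rewrite mul0r.
case: ifPn => r3; last by rewrite mulr0.
by move: r1; rewrite ltNge ler_norml; have -> : (- 1 <= r <= 1) by apply/andP; split; lra.
Qed.

(** Both factors of [bump r] have an argument of at least 1/2, where [e0] is at least exp(-2). The
    bound is used to see that the mollifier has positive mass before normalization. *)
Lemma bump_half r : `|r| <= 2^-1 -> expR (- 4) <= bump r.
Proof.
rewrite ler_norml => /andP[r1 r2].
have H (s : R) : 2^-1 <= s -> expR (- 2) <= e0 s.
  move=> s2; have s0 : 0 < s by apply: lt_le_trans s2; rewrite invr_gt0.
  by rewrite e0E s0 ler_expR lerN2 -[leRHS]invrK lef_pV2// posrE// invr_gt0.
rewrite (_ : - 4 = - 2 + - 2 :> R); last by ring.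
by rewrite expRD ler_pM ?expR_ge0// H//; lra.
Qed.

Let pre (e : R) (x : X) := \prod_(i < N) bump (e^-1 * x 0 i).

Let pre_gen e : gen (pre e).
Proof.
apply: gen_prod => i; apply: gen_mul.
  rewrite (_ : (fun x => _) = fun x : X => e0 ((- e^-1) * x 0 i + 1)).
    exact: gen_atom (lin_coord _ _) (smooth1_e0).
  by apply/funext => x; congr e0; ring.
rewrite (_ : (fun x => _) = fun x : X => e0 (e^-1 * x 0 i + 1)).
  exact: gen_atom (lin_coord _ _) (smooth1_e0).
by apply/funext => x; congr e0; ring.
Qed.

Let pre_ge0 e x : 0 <= pre e x.
Proof. by apply: prodr_ge0 => i _; exact: bump_ge0. Qed.

Let pre_le e x : 0 < e -> pre e x <= \1_(cube e) x.
Proof.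
move=> e0; rewrite indicE; have [xc|/negP xc] := pselect (x \in cube e).
  rewrite xc; apply: prodr_ile1 => i _.
  by rewrite bump_ge0 bump_le1.
rewrite (negbTE xc); move: xc; rewrite notin_setE => /existsNP[i /negP].
rewrite -ltNge => xi; rewrite /pre (bigD1 i)//= bump0 ?mul0r//.
by rewrite normrM gtr0_norm ?invr_gt0// ltr_pdivlMl ?mulr1.
Qed.

Let pre_ge e x : 0 < e -> expR (- 4) ^+ N * \1_(cube (e / 2)) x <= pre e x.
Proof.
move=> e0; rewrite indicE; have [xc|/negP xc] := pselect (x \in cube (e / 2)); last first.
  by rewrite (negbTE xc) mulr0.
rewrite xc mulr1 -[N in leLHS]card_ord -prodr_const; apply: ler_prod => i _.
rewrite expR_ge0/=; apply: bump_half.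
rewrite normrM gtr0_norm ?invr_gt0// ler_pdivrMl//.
by move: xc; rewrite inE => /(_ i).
Qed.

Lemma mollifier_exists (e : R) : 0 < e -> exists rho : X -> R,
  [/\ gen rho, forall x, 0 <= rho x, forall x, rho x != 0 -> cube e x &
      (\int[leb N]_x (rho x)%:E = 1)%E].
Proof.
move=> e0; have mp : measurable_fun setT (pre e).
  by apply: continuous_measurable_rV; exact: gen_continuous.
have mpE : measurable_fun setT (fun x => (pre e x)%:E) by exact/measurable_EFinP.
have mc a : measurable (cube a) by exact: measurable_cube.
set J := (\int[leb N]_x (pre e x)%:E)%E.
have J0 : (0 < J)%E.
  apply: (@lt_le_trans _ _ (\int[leb N]_x (expR (- 4) ^+ N * \1_(cube (e / 2)) x)%:E)%E).
    rewrite integralZl_ge0 ?exprn_ge0 ?expR_ge0//.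
    rewrite integral_indic// setIT.
    rewrite [X in (_ * X)%E](_ : _ = ((e / 2 *+ 2) ^+ N)%:E); last first.
      by apply: leb_cube; rewrite divr_ge0 ?(ltW e0).
    by rewrite -EFinM lte_fin mulr_gt0 ?exprn_gt0 ?expR_gt0 ?mulrn_wgt0 ?divr_gt0.
  apply: le_integral_ge0 => //.
    by apply/measurable_EFinP; exact: measurable_funM.
  by move=> x; rewrite !lee_fin mulr_ge0 ?exprn_ge0 ?expR_ge0//= pre_ge.
have Joo : (J < +oo)%E.
  apply: (@le_lt_trans _ _ (\int[leb N]_x (\1_(cube e) x)%:E)%E).
    apply: le_integral_ge0 => //; first exact/measurable_EFinP.
    by move=> x; rewrite !lee_fin pre_ge0 pre_le.
  rewrite integral_indic// setIT.
  by rewrite [X in (X < _)%E](_ : _ = ((e *+ 2) ^+ N)%:E) ?ltry//; exact/leb_cube/ltW.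
have Jf : J \is a fin_num by rewrite ge0_fin_numE// ltW.
have j0 : 0 < fine J by rewrite -lte_fin fineK.
exists (fun x => (fine J)^-1 * pre e x); split.
- by apply: gen_mul => //; exact: gen_cst.
- by move=> x; rewrite mulr_ge0// invr_ge0 ltW.
- move=> x; rewrite mulf_eq0 negb_or => /andP[_ px].
  have := pre_le x e0; rewrite indicE; have [|xc] := boolP (x \in cube e).
    by rewrite inE.
  by rewrite le_eqVlt ltNge pre_ge0 orbF (negbTE px).
- rewrite integralZl_ge0 ?invr_ge0 ?(ltW j0)//.
  by rewrite -/J -(fineK Jf) -EFinM mulVf// gt_eqF.
Qed.

End mollifier.

(** * Taylor's formula for compactly supported functions *)

Section taylor.
Context {R : realType} {N : nat}.
Local Notation X := 'rV[R]_N.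
Variables (rho : X -> R) (e : R).
Hypothesis grho : gen rho.
Hypothesis rho0 : forall x, rho x != 0 -> cube e x.

Lemma gen_supp_bounded (f : X -> R) : gen f -> (forall x, f x != 0 -> cube e x) ->
  exists C : R, forall x, `|f x| <= C.
Proof.
move=> gf f0; have [c0|/set0P[x0 x0c]] := eqVneq (@cube R N e) set0.
  exists 0 => x; have [->|/f0] := eqVneq (f x) 0; first by rewrite normr0.
  by rewrite c0.
have cn : {within cube e, continuous (fun x : X => `|f x|)}.
  apply: continuous_subspaceT => x; apply: continuous_comp; last exact: norm_continuous.
  exact: gen_continuous.
have [c cc cP] := compact_EVT_max (ex_intro _ x0 x0c) (@cube_compact R N e) cn.
exists `|f c| => x; have [->|/f0 xc] := eqVneq (f x) 0; first by rewrite normr0.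
by apply: cP; rewrite inE.
Qed.

Lemma gen_supp_derive (f : X -> R) v : gen f -> (forall x, f x != 0 -> cube e x) ->
  forall x, 'D_v f x != 0 -> cube e x.
Proof.
move=> gf f0 x; apply: contra_neqP => /existsNP[i /negP]; rewrite -ltNge => xi.
rewrite -(derive_cst (0 : R) x v); apply: near_eq_derive.
have : \forall y \near (x : X), e < `|(y : X) 0 i|.
  apply: (@open_nbhs_nbhs _ x [set y | e < `|y 0 i|]); split => //.
  apply: (@open_comp _ _ (fun y : X => `|y 0 i|) [set r | e < r]); last exact: open_gt.
  move=> y _; apply: continuous_comp; last exact: norm_continuous.
  exact: coord_continuous.
apply: filterS => y yi; apply/eqP; apply: contraTT yi => /f0 /(_ i).
by rewrite -leNgt.
Qed.

Lemma derive_gradient (f : X -> R) (x z : X) : gen f ->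
  'D_z f x = dotprod z (gradient f x).
Proof.
move=> gf; have df := gen_differentiable x gf.
rewrite deriveE// {1}[z]row_sum_delta linear_sum; apply: eq_bigr => i _.
by rewrite linearZ/= !mxE deriveE.
Qed.

Lemma sqr_coord_le (z : X) i : z 0 i ^+ 2 <= euclid_norm z ^+ 2.
Proof.
rewrite /euclid_norm sqr_sqrtr; last by apply: sumr_ge0 => j _; exact: sqr_ge0.
by rewrite (bigD1 i)//= lerDl sumr_ge0// => j _; exact: sqr_ge0.
Qed.

Lemma coord_le_euclid (z : X) i : `|z 0 i| <= euclid_norm z.
Proof. by rewrite -ler_sqr ?nnegrE ?sqrtr_ge0// real_normK ?num_real// sqr_coord_le. Qed.

(** In coordinates the second derivative is a quadratic form in [z] whose coefficients are compactly
    supported, hence bounded. *)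
Lemma second_derive_bound : exists2 C : R, 0 <= C &
  forall x z, `|'D_z ('D_z rho) x| <= C * euclid_norm z ^+ 2.
Proof.
have H (ij : 'I_N * 'I_N) : exists C : R, forall x,
    `|'D_(delta_mx 0 ij.1) ('D_(delta_mx 0 ij.2) rho) x| <= C.
  apply: gen_supp_bounded; first by do 2 apply: gen_derive.
  by do 2 (apply: gen_supp_derive => //; try exact: gen_derive).
have [C HC] := choice H.
have C0 ij : 0 <= C ij by apply: le_trans (HC ij 0).
exists (\sum_i \sum_j C (i, j)) => [|x z].
  by apply: sumr_ge0 => i _; apply: sumr_ge0.
have E : 'D_z rho = \sum_j (z 0 j *: 'D_(delta_mx 0 j) rho).
  apply/funext => y; rewrite derive_gradient// fct_sumE; apply: eq_bigr => j _.
  by rewrite mxE.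
have gj j y v : derivable ('D_(delta_mx 0 j) rho) y v.
  by apply: diff_derivable; apply: gen_differentiable; exact: gen_derive.
have -> : 'D_z ('D_z rho) x =
    \sum_i \sum_j z 0 i * (z 0 j * 'D_(delta_mx 0 i) ('D_(delta_mx 0 j) rho) x).
  rewrite derive_gradient; last exact: gen_derive.
  apply: eq_bigr => i _; rewrite mxE E derive_sum; last first.
    by move=> j; exact: derivableZ.
  rewrite mulr_sumr; apply: eq_bigr => j _; congr (_ * _).
  by rewrite deriveZ.
rewrite mulr_suml; apply: le_trans (ler_norm_sum _ _ _) _; apply: ler_sum => i _.
rewrite mulr_suml; apply: le_trans (ler_norm_sum _ _ _) _; apply: ler_sum => j _.
rewrite mulrA normrM mulrC ler_pM//.
  exact: HC (i, j) x.
by rewrite normrM expr2 ler_pM// coord_le_euclid.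
Qed.

(* Taylor's formula, by two applications of the mean value theorem along the
   segment [x, x + z]. *)
Lemma taylor2 : exists2 C : R, 0 <= C & forall x z, euclid_norm z <= 1 ->
  `|rho (x + z) - rho x - dotprod z (gradient rho x)| <=
  C * euclid_norm z ^+ 2 * \1_(cube (e + 1)) x.
Proof.
have [C C0 HC] := second_derive_bound; exists C => // x z z1.
rewrite -derive_gradient// indicE.
(* Outside the enlarged cube neither [x] nor [x + z] meets the support, and the gradient at [x]
   vanishes too. *)
have [xc|/negP xc] := pselect (x \in cube (e + 1)); last first.
  have {}xc (y : X) : (forall i, `|y 0 i| <= 1) -> ~ cube e (x + y).
    move=> y1 xyc; move/negP: xc; apply; rewrite inE => i.
    have := xyc i; rewrite mxE => H; rewrite -[x 0 i](addrK (y 0 i)).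
    by apply: le_trans (ler_normB _ _) _; rewrite lerD.
  have x0 (f : X -> R) : (forall x, f x != 0 -> cube e x) -> f x = 0 :> R.
    move=> f0; apply/eqP; apply: contrapT => /negP /f0.
    by rewrite -[x]addr0; apply: xc => i; rewrite mxE normr0.
  rewrite (x0 rho)// (x0 ('D_z rho)); last exact: gen_supp_derive.
  have -> : rho (x + z) = 0.
    apply/eqP; apply: contrapT => /negP /rho0; apply: xc => i.
    by apply: le_trans z1; exact: coord_le_euclid.
  by rewrite !subr0 normr0 mulr_ge0// mulr_ge0// sqr_ge0.
rewrite xc mulr1.
have dline f (s : R) : gen f ->
    is_derive s 1 (fun s : R => f (x + s *: z)) ('D_z f (x + s *: z)).
  move=> gf; have df y := gen_differentiable y gf.
  have dl : differentiable (fun s : R => x + s *: z) s.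
    by apply: differentiableD; [exact: differentiable_cst|exact: differentiableZl].
  have dfl : differentiable (fun s : R => f (x + s *: z)) s.
    exact: (@differentiable_comp _ _ _ _ (fun s : R => x + s *: z) f).
  apply: DeriveDef; first exact: diff_derivable.
  rewrite deriveE// (@diff_comp _ _ _ _ (fun s : R => x + s *: z) f)//= deriveE//.
  congr ('d f _ _); rewrite -deriveE//.
  rewrite (_ : (fun s => _) = cst x \+ (fun s : R => s *: z))//.
  rewrite deriveD//; last by apply: diff_derivable; exact: differentiableZl.
  rewrite derive_cst add0r deriveE; last exact: differentiableZl.
  by rewrite diffZl//= diff_val scale1r.
have cline f (b : R) : gen f -> {within `[0, b]%classic, continuous (fun s : R => f (x + s *: z))}.
  move=> gf; apply: continuous_subspaceT => s; apply/differentiable_continuous.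
  by apply/derivable1_diffP; case: (dline f s gf).
have [c + E1] := @MVT R (fun s => rho (x + s *: z)) _ 0 1 ltr01
  (fun s _ => dline _ s grho) (cline _ _ grho).
rewrite in_itv/= => /andP[c0 c1].
have [d _ E2] := @MVT R (fun s => 'D_z rho (x + s *: z)) _ 0 c c0
  (fun s _ => dline _ s (gen_derive z grho))
  (cline _ _ (gen_derive z grho)).
move: E1 E2; rewrite !scale1r !scale0r !addr0 !subr0 mulr1 => -> ->.
rewrite normrM; apply: (@le_trans _ _ (`|'D_z ('D_z rho) (x + d *: z)| * 1)).
  by rewrite ler_wpM2l// gtr0_norm// ltW.
by rewrite mulr1.
Qed.

End taylor.

Section test.
Context {R : realType} {N : nat}.
Local Notation X := 'rV[R]_N.

Lemma derive_translate (f : X -> R) (x y v : X) :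
  'D_v (fun x => f (x - y)) x = 'D_v f (x - y).
Proof.
apply: (congr1 (fun F : R -> R => lim (F @ (0 : R)^'))).
by apply/funext => h /=; rewrite addrA.
Qed.

(* The last factor is a smooth approximation of the indicator of [s < tau]. *)
Definition time_test (lam tau : R) (n : nat) (s : R) : R :=
  expR (lam * s) * ((tau - s) * e0 (n%:R * (tau - s))).

Let lin_scale (a : R) : lin (fun s : R => a * s).
Proof.
split=> [b u v|x]; first by rewrite /GRing.scale/= mulrDr mulrCA.
by apply: differentiableM; [exact: differentiable_cst|].
Qed.

Lemma time_test_gen lam tau n : gen (time_test lam tau n : R -> R).
Proof.
rewrite /time_test; apply: gen_mul.
  rewrite (_ : (fun s => _) = fun s => expR (lam * s + 0)).
    exact: gen_atom (lin_scale _) smooth1_expR.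
  by apply/funext => s; rewrite addr0.
apply: gen_mul.
  rewrite (_ : (fun s => _) = fun s => 1 * (-1 * s + tau) + 0).
    exact: (gen_atom _ (lin_scale (-1)) (smooth1_affine 1 0)).
  by apply/funext => s; ring.
rewrite (_ : (fun s => _) = fun s => e0 ((- n%:R) * s + n%:R * tau)).
  exact: gen_atom (lin_scale _) smooth1_e0.
by apply/funext => s; congr e0; ring.
Qed.

Lemma time_test0 lam tau n s : tau <= s -> time_test lam tau n s = 0.
Proof.
move=> ts; rewrite /time_test [e0 _]e0E ltNge mulr_ge0_le0 ?subr_le0//=.
by rewrite !mulr0.
Qed.

Lemma product_test_function (rho : X -> R) (e T tau lam : R) (n : nat) (y : X) :
  gen rho -> (forall x, rho x != 0 -> cube e x) -> 0 < tau < T ->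
  test_function T (fun p : X * R => rho (p.1 - y) * time_test lam tau n p.2).
Proof.
move=> grho rho0 /andP[tau0 tauT]; split.
  apply: gen_smooth; apply: gen_mul.
    apply: (gen_precomp (p := fst) (- y) _ _ grho) => // x.
    by apply: linear_differentiable => p; exact: cvg_fst.
  rewrite (_ : (fun x => _) = fun x : X * R => time_test lam tau n (x.2 + 0)).
    apply: (gen_precomp (p := snd) 0 _ _ (time_test_gen _ _ _)) => // x.
    by apply: linear_differentiable => p; exact: cvg_snd.
  by apply/funext => x; rewrite addr0.
exists ([set x | cube e (x - y)] `*` `[0, tau]%classic); split.
- apply: compact_setX; last exact: segment_compact.
  rewrite (_ : mkset _ = (fun x => x + y) @` cube e).
    apply: continuous_compact; last exact: cube_compact.
    apply: continuous_subspaceT => x; apply: continuousD; first exact: cvg_id.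
    exact: cst_continuous.
  apply/seteqP; split => [x /= xc|_ /= [x xc <-]]; last by rewrite addrK.
  by exists (x - y) => //; rewrite subrK.
- move=> [x t] /= [_]; rewrite in_itv/= => /andP[-> tt].
  exact: le_lt_trans tauT.
- move=> [x t] /= /andP[t0 tT] H.
  have [xc|xc] := eqVneq (rho (x - y)) 0; first by rewrite xc mul0r.
  have [tt|tt] := leP tau t; first by rewrite time_test0// mulr0.
  by exfalso; apply: H; split; [exact: rho0|rewrite /= in_itv/= t0 ltW].
Qed.

End test.

(** * Parametric integrals *)

(** Syntax-directed proofs of measurability. A function symbol in head position is resolved by a
    hypothesis [measurable_fun setT f] of the context, whence the many local facts of that form
    below. *)
Ltac mfun_step := match goal with
  | H : ?G |- ?G => exact: H
  | |- measurable_fun _ (fun x => (_)%:E) => apply/measurable_EFinP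
  | |- measurable_fun _ (EFin \o _) => apply/measurable_EFinP
  | H : measurable_fun setT ?f |- measurable_fun _ (fun x => ?f _) =>
      apply: (measurableT_comp H)
  | |- measurable_fun _ (fun x => `| _ |) => apply: measurableT_comp => //
  | |- measurable_fun _ (fun x => expR _) =>
      apply: (measurableT_comp (@measurable_expR _))
  | |- measurable_fun _ (fun x => (_, _)) => apply/measurable_fun_pairP; split
  | |- measurable_fun ?D (fst \o (fun x => (@?a x, @?b x))) => change (measurable_fun D a)
  | |- measurable_fun ?D (snd \o (fun x => (@?a x, @?b x))) => change (measurable_fun D b)
  | |- measurable_fun _ (fun x => - _) =>
      first [apply: (measurableT_comp (@oppr_measurable _ _)) | apply: measurable_rVN]
  | |- measurable_fun _ (fun x => _ - _) =>
      first [apply: measurable_funB | apply: measurable_rVB]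
  | |- measurable_fun _ (fun x => _ + _) =>
      first [apply: measurable_funD | apply: measurable_rVD]
  | |- measurable_fun _ (fun x => _ * _) => apply: measurable_funM
  | |- measurable_fun _ (fun x => _ ^+ _) => apply: measurable_funX
  | |- measurable_fun ?D (+%R ?a) => change (measurable_fun D (fun x => a + x))
  | |- measurable_fun ?D ( *%R ?a) => change (measurable_fun D (fun x => a * x))
  | |- measurable_fun _ (fun x => x) => exact: measurable_id
  | |- measurable_fun _ (fun x => x.1) => exact: measurable_fst
  | |- measurable_fun _ (fun x => x.2) => exact: measurable_snd
  | |- measurable_fun _ (fun x => fst _) => apply: (measurableT_comp measurable_fst)
  | |- measurable_fun _ (fun x => snd _) => apply: (measurableT_comp measurable_snd)
  | |- measurable_fun _ _ =>
      first [exact: measurable_cst | exact: measurable_id | exact: measurable_fst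
            | exact: measurable_snd]
  end.
Ltac mfun := repeat mfun_step.

Section parametric.
Context d1 d2 (T1 : measurableType d1) (T2 : measurableType d2) (R : realType).
Variables (m1 : {sigma_finite_measure set T1 -> \bar R})
  (m2 : {sigma_finite_measure set T2 -> \bar R}).
Implicit Types F : T1 * T2 -> R.

Lemma measurable_Rint2 F : measurable_fun setT F ->
  measurable_fun setT (fun x => \int[m2]_y F (x, y)).
Proof.
move=> mF; apply: (measurableT_comp (@fine_measurable R setT measurableT)).
have mFE : measurable_fun setT (EFin \o F) by mfun.
rewrite (_ : (fun x => _) = fun x => (\int[m2]_y (EFin \o F)^\+ (x, y) -
    \int[m2]_y (EFin \o F)^\- (x, y))%E).
  apply: emeasurable_funB.
    apply: (measurable_fun_fubini_tonelli_F ((EFin \o F)^\+)%E) => //.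
    exact: measurable_funepos.
  apply: (measurable_fun_fubini_tonelli_F ((EFin \o F)^\-)%E) => //.
  exact: measurable_funeneg.
apply/funext => x; rewrite integralE; congr (_ - _)%E;
by apply: eq_integral => y _; rewrite ?funeposE ?funenegE.
Qed.

Lemma measurable_Rint1 F : measurable_fun setT F ->
  measurable_fun setT (fun y => \int[m1]_x F (x, y)).
Proof.
move=> mF; apply: (measurableT_comp (@fine_measurable R setT measurableT)).
have mFE : measurable_fun setT (EFin \o F) by mfun.
rewrite (_ : (fun x => _) = fun y => (\int[m1]_x (EFin \o F)^\+ (x, y) -
    \int[m1]_x (EFin \o F)^\- (x, y))%E).
  apply: emeasurable_funB.
    apply: (measurable_fun_fubini_tonelli_G ((EFin \o F)^\+)%E) => //.
    exact: measurable_funepos.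
  apply: (measurable_fun_fubini_tonelli_G ((EFin \o F)^\-)%E) => //.
  exact: measurable_funeneg.
apply/funext => x; rewrite integralE; congr (_ - _)%E;
by apply: eq_integral => y _; rewrite ?funeposE ?funenegE.
Qed.

(** [Rintegral] is [fine] of an extended integral, so every section has to be integrable for the
    inner real integrals to be the extended ones. *)
Lemma Rfubini F : measurable_fun setT F ->
  (forall x, m2.-integrable setT (fun y => (F (x, y))%:E)) ->
  (forall y, m1.-integrable setT (fun x => (F (x, y))%:E)) ->
  (\int[m1]_x \int[m2]_y `|F (x, y)|%:E < +oo)%E ->
  \int[m1]_x \int[m2]_y F (x, y) = \int[m2]_y \int[m1]_x F (x, y).
Proof.
move=> mF i2 i1 Foo.
have iF : (m1 \x m2)%E.-integrable setT (EFin \o F).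
  by apply/integrable12ltyP => //; mfun.
have := Fubini iF; rewrite /Rintegral => E; congr fine.
under eq_integral => x _ do rewrite fineK ?(integrable_fin_num measurableT (i2 x))//.
by under [RHS]eq_integral => y _ do rewrite fineK ?(integrable_fin_num measurableT (i1 y))//.
Qed.

Lemma Rintegral_prod F : measurable_fun setT F ->
  (forall x, m2.-integrable setT (fun y => (F (x, y))%:E)) ->
  (\int[m1]_x \int[m2]_y `|F (x, y)|%:E < +oo)%E ->
  \int[(m1 \x m2)%E]_p F p = \int[m1]_x \int[m2]_y F (x, y).
Proof.
move=> mF i2 Foo.
have iF : (m1 \x m2)%E.-integrable setT (EFin \o F).
  by apply/integrable12ltyP => //; mfun.
have := integral12_prod_meas1 iF; rewrite /Rintegral => E; congr fine.
under [RHS]eq_integral => x _ do rewrite fineK ?(integrable_fin_num measurableT (i2 x))//.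
by rewrite -E.
Qed.

Lemma tonelli (F : T1 * T2 -> R) : measurable_fun setT F -> (forall p, 0 <= F p) ->
  (\int[m1]_x \int[m2]_y (F (x, y))%:E = \int[m2]_y \int[m1]_x (F (x, y))%:E)%E.
Proof.
move=> mF F0; apply: (fubini_tonelli (EFin \o F)) => //; by mfun.
Qed.

Lemma measurable_int2 (F : T1 * T2 -> R) : measurable_fun setT F ->
  (forall p, 0 <= F p) -> measurable_fun setT (fun x => \int[m2]_y (F (x, y))%:E)%E.
Proof.
move=> mF F0; apply: (measurable_fun_fubini_tonelli_F (EFin \o F)).
  by mfun.
by move=> p; rewrite lee_fin.
Qed.

Lemma measurable_int1 (F : T1 * T2 -> R) : measurable_fun setT F ->
  (forall p, 0 <= F p) -> measurable_fun setT (fun y => \int[m1]_x (F (x, y))%:E)%E.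
Proof.
move=> mF F0; apply: (measurable_fun_fubini_tonelli_G (EFin \o F)).
  by mfun.
by move=> p; rewrite lee_fin.
Qed.

End parametric.

Section Rint_tools.
Context d (T : measurableType d) (R : realType).
Variable m : {measure set T -> \bar R}.
Implicit Types f g : T -> R.

(** Measurability is enough: [fine] sends an infinite integral to 0, which only decreases the
    left-hand side. *)
Lemma normr_Rintegral_le f : measurable_fun setT f ->
  (`|\int[m]_x f x|%:E <= \int[m]_x `|f x|%:E)%E.
Proof.
move=> mf; have mfE : measurable_fun setT (EFin \o f) by mfun.
apply: (le_trans _ (le_abse_integral m measurableT mfE)).
by rewrite /Rintegral; case: (integral m setT (EFin \o f)) => [r| |]//=; rewrite normr0 leey.
Qed.

Lemma Rintegral_ge0_fin f : (forall x, 0 <= f x) -> (\int[m]_x (f x)%:E < +oo)%E ->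
  ((\int[m]_x f x)%:E = \int[m]_x (f x)%:E)%E.
Proof.
move=> f0 foo; rewrite fineK// ge0_fin_numE//.
by apply: integral_ge0 => x _; rewrite lee_fin.
Qed.

Lemma integrable_dom f g : measurable_fun setT f ->
  m.-integrable setT (EFin \o g) -> (forall x, `|f x| <= g x) ->
  m.-integrable setT (EFin \o f).
Proof.
move=> mf ig fg; apply: le_integrable ig => //; first by mfun.
by move=> x _; rewrite /= lee_fin (le_trans (fg x))// ler_norm.
Qed.

Lemma integrable_bM f g C : measurable_fun setT f -> m.-integrable setT (EFin \o g) ->
  (forall x, `|f x| <= C) -> m.-integrable setT (EFin \o (fun x => f x * g x)).
Proof.
move=> mf ig fC; have mg := integrable_measurable ig.
apply: (@integrable_dom _ (fun x => C * `|g x|)); first by mfun.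
  rewrite (_ : _ \o _ = fun x => (C%:E * (`|g x|)%:E)%E); last by apply/funext.
  by apply: integrableZl => //; exact: integrable_norm.
by move=> x; rewrite normrM ler_wpM2r.
Qed.

Lemma integrableD_R f g : m.-integrable setT (EFin \o f) ->
  m.-integrable setT (EFin \o g) -> m.-integrable setT (EFin \o (fun x => f x + g x)).
Proof. by move=> i1 i2; apply: (integrableD measurableT i1 i2). Qed.

Lemma integrableB_R f g : m.-integrable setT (EFin \o f) ->
  m.-integrable setT (EFin \o g) -> m.-integrable setT (EFin \o (fun x => f x - g x)).
Proof. by move=> i1 i2; apply: (integrableB measurableT i1 i2). Qed.

Lemma integrableZ_R k f : m.-integrable setT (EFin \o f) ->
  m.-integrable setT (EFin \o (fun x => k * f x)).
Proof. by move=> i1; apply: (integrableZl measurableT k i1). Qed.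

Lemma integrableM_b f g C : measurable_fun setT g -> m.-integrable setT (EFin \o f) ->
  (forall x, `|g x| <= C) -> m.-integrable setT (EFin \o (fun x => f x * g x)).
Proof.
move=> mg i gC; under eq_fun do rewrite mulrC.
exact: integrable_bM i gC.
Qed.

Lemma le_Rintegral_norm f g : m.-integrable setT (EFin \o f) ->
  m.-integrable setT (EFin \o g) -> (forall x, `|f x| <= g x) ->
  `|\int[m]_x f x| <= \int[m]_x g x.
Proof.
move=> i1 i2 fg; apply: le_trans (le_normr_Rintegral measurableT i1) _.
by apply: le_Rintegral => //; exact: integrable_norm.
Qed.

Lemma Rintegral_nrm1 f : m.-integrable setT (EFin \o f) ->
  (\int[m]_x `|f x|)%:E = nrm1 m f.
Proof.
move=> i1; rewrite /nrm1 -Rintegral_ge0_fin//.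
exact/(integrable_nrm1 _ (integrable_measurable i1)).
Qed.

Lemma ae_eq_Rintegral f g : measurable_fun setT f -> measurable_fun setT g ->
  {ae m, forall x, f x = g x} -> \int[m]_x f x = \int[m]_x g x.
Proof.
move=> mf mg fg; congr fine; apply: ae_eq_integral => //; [by mfun|by mfun|].
by apply: filterS fg => x /= + _ => ->.
Qed.

(** Replacing [f] by the almost everywhere equal function [min f g] turns the hypothesis into a
    pointwise inequality. *)
Lemma ae_le_Rintegral f g : m.-integrable setT (EFin \o f) ->
  m.-integrable setT (EFin \o g) -> {ae m, forall x, f x <= g x} ->
  \int[m]_x f x <= \int[m]_x g x.
Proof.
move=> i1 i2 fg; have mf := integrable_measurable i1.
have mg := integrable_measurable i2.
have E : {ae m, forall x, f x = Num.min (f x) (g x)}.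
  by apply: filterS fg => x fgx; rewrite min_l.
have mm : measurable_fun setT (fun x => Num.min (f x) (g x)).
  exact: measurable_minr.
rewrite (ae_eq_Rintegral mf mm E); apply: le_Rintegral => //.
  apply: (@integrable_dom _ (fun x => `|f x| + `|g x|)) => //.
    by apply: integrableD_R; exact: integrable_norm.
  by move=> x; rewrite minElt; case: ifP => _; rewrite ?lerDl ?lerDr.
by move=> x _; rewrite ge_min lexx orbT.
Qed.

Lemma integral_le_ae (F G : T -> \bar R) : measurable_fun setT F ->
  measurable_fun setT G -> (forall x, 0 <= F x)%E -> (forall x, 0 <= G x)%E ->
  {ae m, forall x, F x <= G x}%E -> (\int[m]_x F x <= \int[m]_x G x)%E.
Proof.
move=> mF mG F0 G0 FG; apply: ae_ge0_le_integral => //.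
by apply: filterS FG => x + _.
Qed.

End Rint_tools.

Section restriction.
Context d (T : measurableType d) (R : realType).
Variables (mu : {measure set T -> \bar R}) (D : set T) (mD : measurable D).

Lemma integral_mrestr (f : T -> \bar R) : measurable_fun setT f ->
  (\int[mrestr mu mD]_x f x = \int[mu]_(x in D) f x)%E.
Proof.
have H (g : T -> \bar R) : measurable_fun setT g -> (forall x, 0 <= g x)%E ->
    (\int[mrestr mu mD]_x g x = \int[mu]_(x in D) g x)%E.
  move=> mg g0.
  have mDC := measurableC mD.
  rewrite -(setvU D) ge0_integral_setU//; last 2 first.
    by rewrite setvU.
    by apply/disj_setPCr.
  rewrite [X in (X + _)%E](_ : _ = 0%E); last first.
    apply: null_set_integral => //; first exact: measurable_funS mg.
    by rewrite /= /mrestr setICl measure0.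
  rewrite add0e; apply: eq_measure_integral => A mA AD.
  by rewrite /= /mrestr setIidl.
move=> mf; rewrite [LHS]integralE [RHS]integralE; congr (_ - _)%E; apply: H => //.
  exact: measurable_funepos.
exact: measurable_funeneg.
Qed.

End restriction.

(** * The Levy operator and its truncations *)

Section truncated_operator.
Context {R : realType} {N : nat}.
Local Notation X := 'rV[R]_N.
Implicit Type nu : {finite_measure set X -> \bar R}.

Definition Lop nu (a : X -> R) (x : X) : R := \int[nu]_z (a (x + z) - a x).

Lemma measurable_Lop nu a : measurable_fun setT a -> measurable_fun setT (Lop nu a).
Proof.
move=> ma; apply: (measurable_Rint2 nu (F := fun p : X * X => a (p.1 + p.2) - a p.1)).
by mfun.
Qed.

Lemma finite_integrable nu (g : X -> R) C : measurable_fun setT g ->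
  (forall z, `|g z| <= C) -> nu.-integrable setT (EFin \o g).
Proof.
move=> mg gC; apply: (@integrable_dom _ _ _ _ _ (cst C)) => //.
by apply: finite_measure_integrable_cst.
Qed.

Lemma nrm1_Lop nu a : measurable_fun setT a ->
  (nrm1 (leb N) (Lop nu a) <= nu setT * (2%:E * nrm1 (leb N) a))%E.
Proof.
move=> ma; pose F (p : X * X) : R := `|a (p.1 + p.2) - a p.1|.
have mF : measurable_fun setT F by rewrite /F; mfun.
apply: (@le_trans _ _ (\int[leb N]_x \int[nu]_z (F (x, z))%:E)%E).
  apply: le_integral_ge0.
  - by apply: measurable_normE; exact: measurable_Lop.
  - by apply: measurable_int2 => // p; rewrite /F.
  - move=> x; rewrite lee_fin normr_ge0/= /F.
    apply: (normr_Rintegral_le nu (f := fun z => a (x + z) - a x)); mfun.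
rewrite tonelli//; last by move=> p; rewrite /F.
apply: (@le_trans _ _ (\int[nu]_z (2%:E * nrm1 (leb N) a))%E).
  apply: le_integral_ge0 => //.
    by apply: measurable_int1 => // p; rewrite /F.
  move=> z; rewrite integral_ge0 => [/=|x _]; last by rewrite lee_fin /F.
  have -> : (2%:E * nrm1 (leb N) a = nrm1 (leb N) (fun x => a (x + z))%R + nrm1 (leb N) (fun x => - a x)%R)%E.
    rewrite nrm1_shift// /nrm1; under [X in (_ + X)%E]eq_integral do rewrite normrN.
    by rewrite mule_natl mule2n.
  by apply: nrm1D; mfun.
by rewrite integral_cst// muleC.
Qed.

Lemma Lop_integrable nu a : (leb N).-integrable setT (EFin \o a) ->
  (leb N).-integrable setT (EFin \o Lop nu a).
Proof.
move=> ia; have ma := integrable_measurable ia.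
apply/integrable_nrm1; first exact: measurable_Lop.
apply: le_lt_trans (nrm1_Lop nu ma) _.
have : nu setT \is a fin_num by exact: fin_num_measure.
move/fineK => <-; rewrite lte_mul_pinfty//; first by rewrite lee_fin fine_ge0.
by rewrite lte_mul_pinfty//; exact/(integrable_nrm1 _ ma).
Qed.

End truncated_operator.

Section levy_measure.
Context {R : realType} {N : nat}.
Local Notation X := 'rV[R]_N.
Variable mu : {measure set X -> \bar R}.
Hypothesis mu_even : even_measure mu.
Hypothesis mu_levy : levy_integrable mu.

Lemma measurable_euclid : measurable_fun setT (@euclid_norm R N).
Proof.
apply: (measurableT_comp (@continuous_measurable_fun R Num.sqrt _)).
  by move=> x; exact: sqrt_continuous.
by apply: measurable_sum => i; apply: measurable_funX; exact: measurable_coord.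
Qed.

Lemma euclid_ge0 (z : X) : 0 <= euclid_norm z.
Proof. exact: sqrtr_ge0. Qed.

Lemma euclidN (z : X) : euclid_norm (- z) = euclid_norm z.
Proof. by congr Num.sqrt; apply: eq_bigr => i _; rewrite mxE sqrrN. Qed.

Lemma euclid_eq0 (z : X) : euclid_norm z = 0 -> z = 0.
Proof.
move=> z0; apply/rowP => i; rewrite mxE; apply/eqP; rewrite -normr_eq0 eq_le normr_ge0 andbT.
by rewrite -z0 coord_le_euclid.
Qed.

Definition far (k : nat) : set X := [set z | k.+1%:R^-1 < euclid_norm z].

Lemma measurable_far k : measurable (far k).
Proof.
rewrite -[far k]setTI; have := measurable_euclid measurableT (measurable_itv `]k.+1%:R^-1, +oo[).
by congr measurable; apply/seteqP; split => z /=; rewrite in_itv/= andbT.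
Qed.

Let measurable_unit : measurable [set z : X | euclid_norm z <= 1].
Proof.
rewrite -[X in measurable X]setTI; have := measurable_euclid measurableT (measurable_itv `]-oo, 1]).
by congr measurable; apply/seteqP; split => z /=; rewrite in_itv.
Qed.

Let measurable_sq : measurable_fun setT (fun z : X => (euclid_norm z ^+ 2)%:E).
Proof. by have := measurable_euclid => m; mfun. Qed.

Lemma levy_near : (\int[mu]_(z in [set z | (euclid_norm z <= 1)%R]) (euclid_norm z ^+ 2)%:E < +oo)%E.
Proof.
apply: le_lt_trans mu_levy; rewrite leeDl//.
exact: integral_ge0.
Qed.

Lemma levy_far : (mu (far 0) < +oo)%E.
Proof.
have m0 := measurable_far 0; have E := integral_cst mu m0 1.
apply: le_lt_trans mu_levy; rewrite -[X in (X <= _)%E]mul1e -E /far invr1 leeDr//.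
by apply: integral_ge0 => z _; rewrite lee_fin sqr_ge0.
Qed.

(** Chebyshev's inequality on the shell [1/(k+1) < |z| <= 1], where the square of the norm is
    integrable; the rest of the set is [far 0]. *)
Lemma far_lty k : (mu (far k) < +oo)%E.
Proof.
have k0 : 0 < k.+1%:R^-1 :> R by rewrite invr_gt0.
set A := far k `&` [set z | euclid_norm z <= 1].
have mA : measurable A by apply: measurableI => //; exact: measurable_far.
have Aoo : (mu A < +oo)%E.
  have H : ((k.+1%:R^-1 ^+ 2)%:E * mu A <= \int[mu]_(z in [set z | (euclid_norm z <= 1)%R]) (euclid_norm z ^+ 2)%:E)%E.
    rewrite -(integral_cst mu mA); apply: (@le_trans _ _ (\int[mu]_(z in A) (euclid_norm z ^+ 2)%:E)%E).
      apply: ge0_le_integral => //.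
      + by move=> z _; rewrite lee_fin sqr_ge0.
      + exact: measurable_funS measurable_sq.
      + by move=> z [zk _]; rewrite lee_fin lerXn2r ?nnegrE ?euclid_ge0// ltW.
    apply: ge0_subset_integral => //.
    + exact: measurable_funS measurable_sq.
    + by move=> z _; rewrite lee_fin sqr_ge0.
    + by move=> z [].
  have {}H := le_lt_trans H levy_near.
  rewrite ltNge; apply/negP; rewrite leye_eq => /eqP A1; move: H.
  by rewrite A1 mulry gtr0_sg ?exprn_gt0// mul1e ltxx.
have m0 := measurable_far 0.
apply: (@le_lt_trans _ _ (mu (A `|` far 0))).
  rewrite le_measure ?inE//; [exact: measurable_far|exact: measurableU|].
  move=> z zk; have [z1|z1] := leP (euclid_norm z) 1; first by left.
  by right; rewrite /far/= invr1.
by apply: le_lt_trans (measureU2 mu mA m0) _; rewrite lte_add_pinfty// levy_far.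
Qed.

Definition nu k : {finite_measure set X -> \bar R} := mfrestr (measurable_far k) (far_lty k).

Lemma integral_nu k (f : X -> \bar R) : measurable_fun setT f ->
  (\int[nu k]_z f z = \int[mu]_(z in far k) f z)%E.
Proof. by move=> mf; rewrite -(integral_mrestr mu (measurable_far k)). Qed.

Lemma nu_even k : preserving (nu k) (-%R : X -> X).
Proof.
have mN : measurable_fun setT (-%R : X -> X) by apply: measurable_rVN; exact: measurable_id.
split => // A mA; rewrite /nu /= /mfrestr /mrestr.
rewrite [RHS]mu_even; last by apply: measurableI => //; exact: measurable_far.
congr (mu _); apply/seteqP; split => [z [/= Az zk]|_ [z [Az zk] <-]] /=.
  by exists (- z); rewrite ?opprK//; split => //; rewrite /far/= euclidN.
by rewrite opprK; split => //; rewrite /far/= euclidN.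
Qed.

Lemma far_sub j k : (j <= k)%N -> far j `<=` far k.
Proof.
move=> jk z; rewrite /far/=; apply: le_lt_trans.
by rewrite lef_pV2 ?posrE// ler_nat.
Qed.

Definition near_mass k : R :=
  \int[mu]_(z in [set z : X | euclid_norm z <= k.+1%:R^-1]) (euclid_norm z ^+ 2).

Let measurable_near (r : R) : measurable [set z : X | euclid_norm z <= r].
Proof.
rewrite -[X in measurable X]setTI; have := measurable_euclid measurableT (measurable_itv `]-oo, r]).
by congr measurable; apply/seteqP; split => z /=; rewrite in_itv.
Qed.

Let near_integrable k : mu.-integrable [set z : X | euclid_norm z <= k.+1%:R^-1]
  (fun z => (euclid_norm z ^+ 2)%:E).
Proof.
apply: (@integrableS _ _ _ mu [set z | euclid_norm z <= 1]) => //.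
  move=> z /= zk; apply: le_trans zk _.
  by rewrite invf_le1// ler1n.
apply/integrableP; split; first exact: measurable_funS measurable_sq.
under eq_integral do rewrite abse_EFin ger0_norm ?sqr_ge0//.
exact: levy_near.
Qed.

(** Dominated convergence on the unit ball. A nonzero point eventually leaves the shrinking balls,
    and at the origin the integrand is zero. *)
Lemma near_mass_cvg : near_mass @ \oo --> 0.
Proof.
have [] := @dominated_convergence _ X R mu [set z | euclid_norm z <= 1] measurable_unit
  (fun k z => (euclid_norm z ^+ 2 * \1_[set z : X | euclid_norm z <= k.+1%:R^-1] z)%:E)
  (cst 0%E) (fun z => (euclid_norm z ^+ 2)%:E).
- move=> k; apply: (@measurable_funS _ _ _ _ setT) => //.
  apply/measurable_EFinP; apply: measurable_funM; first exact/measurable_EFinP.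
  exact: measurable_indic.
- by [].
- apply: aeW => z _ /=; have [->|z0] := eqVneq z 0.
    have e0 : euclid_norm (0 : X) = 0.
      by rewrite /euclid_norm big1 ?sqrtr0// => i _; rewrite mxE expr0n.
    by under eq_fun do rewrite e0 expr0n mul0r; exact: cvg_cst.
  have zp : 0 < euclid_norm z.
    by rewrite lt_neqAle eq_sym euclid_ge0 andbT; apply: contra_neq z0; exact: euclid_eq0.
  apply: cvg_near_cst; near=> k; rewrite indicE memNset ?mulr0//=.
  apply/negP; rewrite -ltNge; near: k; exact: (near_infty_natSinv_lt (PosNum zp)).
- have := near_integrable 0; by rewrite invr1.
- apply: aeW => z k _ /=; rewrite lee_fin ger0_norm ?mulr_ge0 ?euclid_ge0//.
  by rewrite ler_piMr ?sqr_ge0// indicE lern1 leq_b1.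
move=> _ _; rewrite integral0 => /fine_cvgP[_].
apply: cvg_trans; apply: near_eq_cvg; apply: nearW => k /=.
rewrite /near_mass /Rintegral; congr fine.
have k1 : [set z : X | euclid_norm z <= k.+1%:R^-1] =
    [set z | euclid_norm z <= 1] `&` [set z : X | euclid_norm z <= k.+1%:R^-1].
  apply/seteqP; split => [z /= zk|z []//]; split => //.
  by apply: le_trans zk _; rewrite invf_le1// ler1n.
rewrite [in RHS]k1 integral_mkcondr; apply: eq_integral => z _.
rewrite patchE indicE; case: ifPn => _; first by rewrite mulr1.
by rewrite mulr0.
Unshelve. all: by end_near. Qed.

Lemma measurable_punctured : measurable ([set~ 0] : set X).
Proof.
apply: measurableC; have := @measurable_cube R N 0; congr measurable.
apply/seteqP; split => [x /= x0|x -> i]; last by rewrite mxE normr0.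
by apply/rowP => i; rewrite mxE; apply/eqP; rewrite -normr_le0.
Qed.

Lemma measurable_dotprod (y : X) : measurable_fun setT (fun z : X => dotprod z y).
Proof.
apply: measurable_sum => i; apply: measurable_funM; last exact: measurable_cst.
exact: measurable_coord.
Qed.

Section smooth_function.
Variables (rho : X -> R) (e : R).
Hypothesis grho : gen rho.
Hypothesis rho0 : forall x, rho x != 0 -> cube e x.

Definition levy_integrand (x z : X) : R := rho (x + z) - rho x -
  dotprod z (gradient rho x) * \1_[set y : X | euclid_norm y <= 1] z.

Let mrho : measurable_fun setT rho.
Proof. by apply: continuous_measurable_rV; exact: gen_continuous. Qed.

Let mG x : measurable_fun setT (levy_integrand x).
Proof.
rewrite /levy_integrand; have mr := mrho.
apply: measurable_funB; first by mfun.
apply: measurable_funM; first exact: measurable_dotprod.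
exact: measurable_indic.
Qed.

(** Outside the unit ball the integrand is bounded and the measure is finite; inside, Taylor's
    formula bounds it by a multiple of the integrable [euclid_norm z ^+ 2]. *)
Lemma levy_integrand_integrable x :
  mu.-integrable setT (EFin \o levy_integrand x).
Proof.
have [C C0 HC] := taylor2 grho rho0; have [B HB] := gen_supp_bounded grho rho0.
have mE : measurable_fun setT (fun z => `|levy_integrand x z|%:E).
  by apply: measurable_normE.
apply/integrable_nrm1 => //; rewrite /nrm1.
have m0 := measurable_far 0; have m1 := measurable_unit.
have E : far 0 `|` [set z | euclid_norm z <= 1] = setT.
  apply/seteqP; split => // z _; have [z1|z1] := leP (euclid_norm z) 1; first by right.
  by left; rewrite /far/= invr1.
rewrite -E ge0_integral_setU//; last 2 first.
- exact: measurable_funS mE.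
- apply/disj_setPS => z [/=]; rewrite /far/= invr1 => z1.
  by rewrite leNgt z1.
apply: lte_add_pinfty.
  apply: (@le_lt_trans _ _ (\int[mu]_(z in far 0) (B + B)%:E)%E).
    apply: ge0_le_integral => //; first exact: measurable_funS mE.
    move=> z; rewrite /far/= invr1 => z1; rewrite lee_fin /levy_integrand indicE memNset/=.
      by rewrite mulr0 subr0; apply: le_trans (ler_normB _ _) _; rewrite lerD.
    by apply/negP; rewrite -ltNge.
  rewrite integral_cst//; have f : mu (far 0) \is a fin_num by rewrite ge0_fin_numE// levy_far.
  by rewrite -(fineK f) -EFinM ltry.
apply: (@le_lt_trans _ _ (C%:E * \int[mu]_(z in [set z | (euclid_norm z <= 1)%R]) (euclid_norm z ^+ 2)%:E)%E).
  rewrite -ge0_integralZl//; last first.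
  - by move=> z _; rewrite lee_fin sqr_ge0.
  - exact: measurable_funS measurable_sq.
  apply: ge0_le_integral => //.
  - exact: measurable_funS mE.
  - by apply: measurable_funeM; exact: measurable_funS measurable_sq.
  move=> z z1; rewrite -EFinM lee_fin /levy_integrand indicE mem_set// mulr1.
  apply: le_trans (HC x z z1) _; rewrite ler_piMr ?mulr_ge0 ?euclid_ge0//.
by rewrite lte_mul_pinfty// levy_near.
Qed.

(* On [1/(k+1) < |z| <= 1] the gradient term is odd in [z], hence it drops
   out of the integral. *)
Lemma levy_truncation : exists2 C : R, 0 <= C & forall k x,
  `|levy_op mu rho x - Lop (nu k) rho x| <= C * near_mass k * \1_(cube (e + 1)) x.
Proof.
have [C C0 HC] := taylor2 grho rho0; have [B HB] := gen_supp_bounded grho rho0.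
exists C => // k x; have iG := levy_integrand_integrable x.
have mfar := measurable_far k.
pose D := [set~ 0] `&` [set z : X | euclid_norm z <= k.+1%:R^-1].
have mD : measurable D by apply: measurableI => //; exact: measurable_punctured.
have E : [set~ 0] = far k `|` D.
  apply/seteqP; split => [z z0|z [/= zk|[]//]].
    have [z1|z1] := leP (euclid_norm z) k.+1%:R^-1; first by right.
    by left.
  move=> z0; move: zk; rewrite z0 /far/= /euclid_norm big1 => [|i _].
    by rewrite sqrtr0 ltNge invr_ge0 ler0n.
  by rewrite mxE expr0n.
rewrite /levy_op -/(levy_integrand x).
rewrite [X in `|X - _|](_ : _ = \int[mu]_(z in far k `|` D) levy_integrand x z); last by rewrite E.
rewrite Rintegral_setU//; last 2 first.
- by apply: integrableS iG => //; exact: measurableU.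
- apply/disj_setPS => z [/=]; rewrite /far/= => z1 [_].
  by rewrite /= leNgt z1.
have -> : \int[mu]_(z in far k) levy_integrand x z = Lop (nu k) rho x.
  transitivity (\int[nu k]_z levy_integrand x z).
    by rewrite /Rintegral integral_nu//; have mGx := mG x; mfun.
  have mi : measurable_fun setT (\1_[set y : X | euclid_norm y <= 1] : X -> R).
    exact: measurable_indic.
  pose o z := dotprod z (gradient rho x) * \1_[set y : X | euclid_norm y <= 1] z.
  have mo : measurable_fun setT o.
    by apply: measurable_funM => //; exact: measurable_dotprod.
  have oN z : o (- z) = - o z.
    rewrite /o -mulNr; congr (_ * _).
      by rewrite /dotprod -sumrN; apply: eq_bigr => i _; rewrite mxE mulNr.
    by rewrite !indicE; congr (_%:R); congr nat_of_bool; apply/idP/idP;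
      rewrite !inE/= euclidN.
  have iO : (nu k).-integrable setT (EFin \o o).
    apply: (@finite_integrable _ _ _ _ (\sum_i `|gradient rho x 0 i|)) => // z.
    rewrite /o indicE; case: (boolP (z \in _)); last first.
      by rewrite mulr0 normr0 => _; apply: sumr_ge0.
    rewrite inE/= mulr1 => z1; apply: le_trans (ler_norm_sum _ _ _) _.
    apply: ler_sum => i _; rewrite normrM ler_piMl//.
    by apply: le_trans z1; exact: coord_le_euclid.
  rewrite /levy_integrand RintegralB//; last first.
    apply: (@finite_integrable _ _ _ _ (B + B)); first by mfun.
    by move=> z; apply: le_trans (ler_normB _ _) _; rewrite lerD.
  suff -> : \int[nu k]_z o z = 0 by rewrite subr0.
  have : \int[nu k]_z o z = - \int[nu k]_z o z.
    rewrite -[LHS](preserving_Rintegral (nu_even k))//.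
    under eq_Rintegral do rewrite oN -mulN1r.
    by rewrite RintegralZl// mulN1r.
  by lra.
rewrite addrC addKr.
have iGD : mu.-integrable D (EFin \o levy_integrand x) by exact: integrableS iG.
have inr := near_integrable k.
have iD : mu.-integrable D (EFin \o (fun z : X => euclid_norm z ^+ 2)).
  by apply: integrableS inr => //; exact: subIsetr.
have c01 : 0 <= \1_(cube (e + 1)) x :> R by rewrite indicE.
apply: le_trans (le_normr_Rintegral mD iGD) _.
apply: (@le_trans _ _ (\int[mu]_(z in D) ((C * \1_(cube (e + 1)) x) * euclid_norm z ^+ 2))).
  apply: le_Rintegral => //; first exact: integrable_norm.
    exact: (integrableZl mD _ iD).
  move=> z [_ /= zk].
  have z1 : euclid_norm z <= 1 by apply: le_trans zk _; rewrite invf_le1// ler1n.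
  rewrite /levy_integrand indicE mem_set// mulr1.
  by apply: le_trans (HC x z z1) _; rewrite mulrAC.
rewrite RintegralZl// [leRHS]mulrAC ler_wpM2l// ?mulr_ge0//.
rewrite /near_mass /Rintegral fine_le//.
- exact: (integrable_fin_num mD iD).
- exact: (integrable_fin_num _ inr).
- apply: ge0_subset_integral => //.
  + exact: measurable_funS measurable_sq.
  + by move=> z _; rewrite lee_fin sqr_ge0.
  + exact: subIsetr.
Qed.

End smooth_function.

End levy_measure.

(** * Energy of solutions of the stationary problem *)

Section soft_threshold.
Context {R : realType}.
Implicit Types d p q : R.

(** Soft thresholding [sign(p) max(|p| - d, 0)]. It is 1-Lipschitz and monotone, and it makes
    functions that are small at infinity integrable while acting well on increments. *)
Definition soft d p := Num.max (p - d) 0 + Num.min (p + d) 0.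

Lemma softE d p : 0 <= d ->
  [\/ d <= p /\ soft d p = p - d, (- d <= p <= d) /\ soft d p = 0
    | p <= - d /\ soft d p = p + d].
Proof.
move=> d0; rewrite /soft; have [pd|pd] := leP d p.
  by apply: Or31; split => //; rewrite max_l ?subr_ge0// min_r ?addr0// addr_ge0// (le_trans d0).
have [pd'|pd'] := leP (- d) p.
  apply: Or32; rewrite (ltW pd); split => //; rewrite max_r ?subr_le0 ?(ltW pd)//.
  by rewrite min_r ?addr0//; lra.
by apply: Or33; split; [lra|rewrite max_r ?min_l ?add0r//; lra].
Qed.

Lemma soft_mono d p q : 0 <= d -> q <= p -> 0 <= soft d p - soft d q <= p - q.
Proof.
by move=> d0 qp; apply/andP; case: (softE p d0) => -[+ ->]; case: (softE q d0) => -[+ ->];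
  split; lra.
Qed.

(** Firm nonexpansiveness: the increments of [soft d] have the sign of those of the identity and are
    no larger. It lets the pairing of [a] with [soft d a] control the energy of [soft d a]. *)
Lemma soft_sqr d p q : 0 <= d ->
  (soft d p - soft d q) ^+ 2 <= (p - q) * (soft d p - soft d q).
Proof.
move=> d0; case: (leP q p) => [qp|/ltW pq].
  by have /andP[? ?] := soft_mono d0 qp; rewrite expr2 ler_wpM2r.
have /andP[h1 h2] := soft_mono d0 pq.
rewrite -sqrrN opprB expr2 -[leRHS]mulrNN !opprB; exact: ler_wpM2r.
Qed.

Lemma soft_lip d p q : 0 <= d -> `|soft d p - soft d q| <= `|p - q|.
Proof.
move=> d0; wlog qp : p q / q <= p.
  by move=> H; case: (leP q p) => [/H//|/ltW /H]; rewrite distrC [leRHS]distrC.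
have /andP[h1 h2] := soft_mono d0 qp.
by rewrite !ger0_norm// subr_ge0.
Qed.

Lemma soft0 d : 0 <= d -> soft d 0 = 0.
Proof. by move=> d0; rewrite /soft max_r ?min_r ?addr0//; lra. Qed.

Lemma soft_le d p : 0 <= d -> `|soft d p| <= `|p|.
Proof. by move=> d0; have := soft_lip p 0 d0; rewrite soft0// !subr0. Qed.

Lemma soft_dist d p : 0 <= d -> `|p - soft d p| <= d.
Proof.
move=> d0; rewrite ler_norml.
by case: (softE p d0) => -[+ ->]; move=> *; apply/andP; split; lra.
Qed.

(** This is how the bound [|a| <= d + |g|] with [g] integrable makes the thresholded function
    integrable. *)
Lemma soft_dom d p g : 0 <= d -> 0 <= g -> `|p| <= d + g -> `|soft d p| <= g.
Proof.
move=> d0 g0; rewrite !ler_norml => /andP[p1 p2].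
by case: (softE p d0) => -[+ ->]; move=> *; apply/andP; split; lra.
Qed.

(** Thresholds compose additively, and [soft (d - d')] is 1-Lipschitz. Hence energies of thresholded
    functions increase as the threshold decreases. *)
Lemma soft_soft d d' p q : 0 <= d' -> d' <= d ->
  `|soft d p - soft d q| <= `|soft d' p - soft d' q|.
Proof.
move=> d'0 d'd; have d0 : 0 <= d by lra.
have dd0 : 0 <= d - d' by lra.
suff H r : soft d r = soft (d - d') (soft d' r) by rewrite !H soft_lip.
case: (softE r d'0) => -[+ ->]; case: (softE r d0) => -[+ ->];
 [case: (softE (r - d') dd0)|case: (softE (r - d') dd0)|case: (softE (r - d') dd0)
 |case: (softE 0 dd0)|case: (softE 0 dd0)|case: (softE 0 dd0)
 |case: (softE (r + d') dd0)|case: (softE (r + d') dd0)|case: (softE (r + d') dd0)];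
 by move=> -[+ ->] => *; lra.
Qed.

Lemma measurable_soft d : measurable_fun setT (soft d).
Proof.
apply: measurable_funD.
  apply: measurable_maxr; last exact: measurable_cst.
  by apply: measurable_funB => //; exact: measurable_cst.
apply: measurable_minr; last exact: measurable_cst.
by apply: measurable_funD => //; exact: measurable_cst.
Qed.

End soft_threshold.

Lemma dist_le_trans (R : realType) (A B C : R) : `|B - A| <= C -> A <= B + C.
Proof. by move=> /ler_normlP[+ _]; lra. Qed.

Lemma dist_le_trans2 (R : realType) (A B C D : R) : A <= D -> `|B - A| <= C -> B <= D + C.
Proof. by move=> + /ler_normlP[_]; lra. Qed.

Lemma dist_le_trans3 (R : realType) (A B C D : R) : A <= D -> `|A - B| <= C -> B <= D + C.
Proof. by move=> + /ler_normlP[+ _]; lra. Qed.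

Lemma half_opp (R : realType) (A B : R) : A + A = -1 * B -> - A = 2^-1 * B.
Proof. lra. Qed.

(** * Symmetrized pairing for a finite even measure *)

Section pairing.
Context {R : realType} {N : nat}.
Local Notation X := 'rV[R]_N.
Variable nu : {finite_measure set X -> \bar R}.
Hypothesis nu_even : preserving nu (-%R : X -> X).
Implicit Types (a g b : X -> R).

Definition trunc_energy a : \bar R :=
  ((2^-1)%:E * \int[leb N]_x \int[nu]_z (`|a (x + z) - a x| ^+ 2)%:E)%E.

Let nu_fin : (nu setT < +oo)%E.
Proof. by have := fin_num_measure nu _ measurableT; rewrite ge0_fin_numE. Qed.

Let M := fine (nu setT).

Let int_cst (c : \bar R) : (\int[nu]__ c = c * M%:E)%E.
Proof. by rewrite integral_cst// /M fineK// ge0_fin_numE. Qed.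

Let dlt a (x z : X) := a (x + z) - a x.

Let dlt_integrable a z : (leb N).-integrable setT (EFin \o a) ->
  (leb N).-integrable setT (EFin \o dlt a ^~ z).
Proof.
move=> ia; apply: integrableB_R => //.
exact: (preserving_integrable (preserving_leb z) ia).
Qed.

Let dlt_bound a C : (forall x, `|a x| <= C) -> forall x z, `|dlt a x z| <= C + C.
Proof. by move=> aC x z; apply: le_trans (ler_normB _ _) _; rewrite lerD. Qed.

Let nrm1_dlt g z : measurable_fun setT g ->
  (\int[leb N]_x `|dlt g x z|%:E <= 2%:E * nrm1 (leb N) g)%E.
Proof.
move=> mg.
have -> : (2%:E * nrm1 (leb N) g = nrm1 (leb N) (fun x => g (x + z))%R +
    nrm1 (leb N) (fun x => - g x)%R)%E.
  rewrite nrm1_shift// /nrm1; under [X in (_ + X)%E]eq_integral do rewrite normrN.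
  by rewrite mule_natl mule2n.
by apply: nrm1D; mfun.
Qed.

Section pairings.
Variables (a g : X -> R) (C : R).
Hypothesis ma : measurable_fun setT a.
Hypothesis aC : forall x, `|a x| <= C.
Hypothesis ig : (leb N).-integrable setT (EFin \o g).

Let mg : measurable_fun setT g.
Proof. exact: integrable_measurable ig. Qed.

Let C0 : 0 <= C.
Proof. exact: le_trans (aC 0). Qed.

Let goo : (nrm1 (leb N) g < +oo)%E.
Proof. exact/(integrable_nrm1 _ mg). Qed.

Let mdlt : measurable_fun setT (fun p : X * X => dlt a p.1 p.2).
Proof. by rewrite /dlt; mfun. Qed.

Let mdltz z : measurable_fun setT (dlt a ^~ z).
Proof. by rewrite /dlt; mfun. Qed.

Let mdltx x : measurable_fun setT (dlt a x).
Proof. by rewrite /dlt; mfun. Qed.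

Lemma pairing_integrable z :
  (leb N).-integrable setT (EFin \o (fun x => dlt a x z * dlt g x z)).
Proof. by apply: integrable_bM (dlt_integrable z ig) _ => // x; exact: dlt_bound. Qed.

Lemma pairing_lty : (\int[nu]_z \int[leb N]_x `|dlt a x z * dlt g x z|%:E < +oo)%E.
Proof.
have mgz : measurable_fun setT (fun p : X * X => dlt g p.1 p.2) by rewrite /dlt; mfun.
apply: (@le_lt_trans _ _ (\int[nu]_z ((C + C)%:E * (2%:E * nrm1 (leb N) g)))%E).
  apply: le_integral_ge0 => //.
    apply: (measurable_int1 (leb N) (F := fun p : X * X => `|dlt a p.1 p.2 * dlt g p.1 p.2|)) => //.
    by mfun.
  move=> z; rewrite integral_ge0/=; last by move=> x _; rewrite lee_fin.
  apply: (@le_trans _ _ ((C + C)%:E * \int[leb N]_x `|dlt g x z|%:E)%E); last first.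
    by rewrite lee_wpmul2l// ?nrm1_dlt// lee_fin addr_ge0.
  rewrite -integralZl_ge0 ?addr_ge0//; last by rewrite /dlt; mfun.
  apply: le_integral_ge0; [by rewrite /dlt; mfun|by rewrite /dlt; mfun|].
  move=> x; rewrite !lee_fin normr_ge0/= normrM ler_wpM2r//.
  exact: dlt_bound.
by rewrite int_cst -[nrm1 (leb N) g]fineK ?ge0_fin_numE ?nrm1_ge0// -!EFinM ltry.
Qed.

(* Two-point symmetrization: the substitution [z -> -z] in [nu] and a
   translation in [x] exchange the two endpoints [x] and [x + z]. *)
Lemma Lop_pairing : - (\int[leb N]_x (Lop nu a x * g x)) =
  2^-1 * \int[nu]_z \int[leb N]_x (dlt a x z * dlt g x z).
Proof.
pose F (p : X * X) := dlt a p.1 p.2 * g p.1.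
have mF : measurable_fun setT F by rewrite /F; mfun.
pose I z := \int[leb N]_x (dlt a x z * g x).
have iz z : (leb N).-integrable setT (EFin \o (fun x => dlt a x z * g x)).
  by apply: integrable_bM ig _ => // x; exact: dlt_bound.
have izN z : (leb N).-integrable setT (EFin \o (fun x => - dlt a x z * g (x + z))).
  apply: (integrable_bM (C := C + C)); first by mfun.
    exact: (preserving_integrable (preserving_leb z) ig).
  by move=> x; rewrite normrN; exact: dlt_bound.
have IN z : I (- z) = \int[leb N]_x (- dlt a x z * g (x + z)).
  rewrite /I -(preserving_Rintegral (preserving_leb z)); last by rewrite /dlt; mfun.
  by apply: eq_Rintegral => x _; rewrite /dlt addrK opprB.
have mI : measurable_fun setT I by exact: (measurable_Rint1 (leb N) mF).
have Ib z : `|I z| <= (C + C) * \int[leb N]_x `|g x|.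
  rewrite -RintegralZl//; last exact: integrable_norm.
  apply: le_Rintegral_norm => //.
    by apply: integrableZ_R; exact: integrable_norm.
  by move=> x; rewrite normrM ler_wpM2r// dlt_bound.
have iI : nu.-integrable setT (EFin \o I) by exact: finite_integrable Ib.
have iIN : nu.-integrable setT (EFin \o (I \o -%R)) by exact: preserving_integrable.
have -> : \int[leb N]_x (Lop nu a x * g x) = \int[nu]_z I z.
  rewrite /I -(@Rfubini _ _ _ _ _ (leb N) nu F)//.
  - apply: eq_Rintegral => x _; rewrite /F/= RintegralZr//.
    by apply: (@finite_integrable _ _ nu _ (C + C)) => // z; exact: dlt_bound.
  - move=> x; apply: (@finite_integrable _ _ nu _ ((C + C) * `|g x|)); first by mfun.
    by move=> z; rewrite /F normrM ler_wpM2r// dlt_bound.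
  - rewrite (@tonelli _ _ _ _ _ (leb N) nu (fun p => `|F p|)) => [||p]; [|by mfun|exact: normr_ge0].
    apply: (@le_lt_trans _ _ (\int[nu]_z ((C + C)%:E * nrm1 (leb N) g))%E).
      apply: le_integral_ge0 => //.
        by apply: (measurable_int1 (leb N) (F := fun p => `|F p|)) => //; mfun.
      move=> z; rewrite integral_ge0/=; last by move=> x _; rewrite lee_fin.
      rewrite /nrm1 -integralZl_ge0 ?addr_ge0//; last by mfun.
      apply: le_integral_ge0; [by mfun|by mfun|].
      move=> x; rewrite !lee_fin normr_ge0/= normrM ler_wpM2r//.
      exact: dlt_bound.
    by rewrite int_cst -[nrm1 (leb N) g]fineK ?ge0_fin_numE ?nrm1_ge0// -!EFinM ltry.
pose J z := \int[leb N]_x (dlt a x z * dlt g x z).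
(* In the expanded product, the term containing [g (x + z)] is the value of [I] at [- z], up to
   sign, by the translation carried out in [IN]. *)
have JI z : J z = - (I z + I (- z)).
  rewrite IN -RintegralD// -mulN1r -RintegralZl//; last exact: integrableD_R.
  by apply: eq_Rintegral => x _; rewrite /dlt; ring.
have mJ : measurable_fun setT J.
  by apply: (measurable_Rint1 (leb N) (F := fun p : X * X => dlt a p.1 p.2 * dlt g p.1 p.2)); rewrite /dlt; mfun.
have iJ : nu.-integrable setT (EFin \o J).
  apply: (@finite_integrable _ _ nu _ ((C + C) * \int[leb N]_x `|g x| + (C + C) * \int[leb N]_x `|g x|)) => // z.
  by rewrite JI normrN; apply: le_trans (ler_normD _ _) _; rewrite lerD.
have E1 : \int[nu]_z (I \o -%R) z = \int[nu]_z I z := preserving_Rintegral nu_even mI.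
have E2 := RintegralD measurableT iI iIN.
have E3 : \int[nu]_z (-1 * J z) = -1 * \int[nu]_z J z by exact: (RintegralZl (-1) measurableT iJ).
have E4 : \int[nu]_z (I z + (I \o -%R) z) = \int[nu]_z (-1 * J z).
  by apply: eq_Rintegral => z _; rewrite JI mulN1r opprK.
have E5 : \int[nu]_z I z + \int[nu]_z I z = -1 * \int[nu]_z J z.
  exact: etrans (esym (etrans E2 (congr1 (fun t => _ + t) E1))) (etrans E4 E3).
change (- (\int[nu]_z I z) = 2^-1 * \int[nu]_z J z).
exact: half_opp E5.
Qed.

End pairings.

Let trunc_energyE a : measurable_fun setT a -> trunc_energy a =
  ((2^-1)%:E * \int[nu]_z \int[leb N]_x (`|dlt a x z| ^+ 2)%:E)%E.
Proof.
move=> ma; congr (_ * _)%E.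
rewrite (@tonelli _ _ _ _ _ (leb N) nu (fun p : X * X => `|dlt a p.1 p.2| ^+ 2))//.
by rewrite /dlt; mfun.
Qed.

Let pairE a g C : measurable_fun setT a -> (forall x, `|a x| <= C) ->
  (leb N).-integrable setT (EFin \o g) ->
  ((\int[nu]_z \int[leb N]_x (dlt a x z * dlt g x z))%:E <=
   \int[nu]_z \int[leb N]_x `|dlt a x z * dlt g x z|%:E)%E.
Proof.
move=> ma aC ig; have mg := integrable_measurable ig.
have mP : measurable_fun setT (fun p : X * X => dlt a p.1 p.2 * dlt g p.1 p.2).
  by rewrite /dlt; mfun.
have mI := measurable_Rint1 (leb N) mP.
apply: (@le_trans _ _ (\int[nu]_z `|\int[leb N]_x (dlt a x z * dlt g x z)|%:E)%E).
  apply: le_trans (normr_Rintegral_le nu mI).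
  by rewrite lee_fin ler_norm.
apply: le_integral_ge0; first exact: measurable_normE.
  by apply: (measurable_int1 (leb N) (F := fun p : X * X => `|dlt a p.1 p.2 * dlt g p.1 p.2|)) => //; mfun.
move=> z; rewrite lee_fin normr_ge0/=; apply: normr_Rintegral_le.
by rewrite /dlt; mfun.
Qed.

(** After symmetrization the integrand dominates the squared increment of [soft d a] pointwise, by
    [soft_sqr]. It is nonnegative, so its real and extended integrals can be identified. *)
Lemma energy_soft_le a C d : measurable_fun setT a -> (forall x, `|a x| <= C) ->
  0 <= d -> (leb N).-integrable setT (EFin \o (soft d \o a)) ->
  (trunc_energy (soft d \o a) <= (- \int[leb N]_x (Lop nu a x * soft d (a x)))%:E)%E.
Proof.
move=> ma aC d0 ig; have mg := integrable_measurable ig.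
rewrite (Lop_pairing ma aC ig) trunc_energyE// EFinM lee_wpmul2l// ?lee_fin//.
have K0 p : 0 <= dlt a p.1 p.2 * dlt (soft d \o a) p.1 p.2.
  by rewrite /dlt/=; apply: le_trans (soft_sqr _ _ d0); exact: sqr_ge0.
have mK : measurable_fun setT (fun p : X * X => dlt a p.1 p.2 * dlt (soft d \o a) p.1 p.2).
  by rewrite /dlt; mfun.
have E2 z : ((\int[leb N]_x (dlt a x z * dlt (soft d \o a) x z))%:E =
    \int[leb N]_x (dlt a x z * dlt (soft d \o a) x z)%:E)%E.
  rewrite Rintegral_ge0_fin// => [x|]; first exact: (K0 (x, z)).
  have /integrableP[_] := pairing_integrable ma aC ig z.
  apply: le_lt_trans; rewrite le_eqVlt; apply/orP; left; apply/eqP.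
  by apply: eq_integral => x _; rewrite /= ger0_norm// (K0 (x, z)).
have L : (\int[nu]_z (\int[leb N]_x (dlt a x z * dlt (soft d \o a) x z))%:E < +oo)%E.
  apply: le_lt_trans (pairing_lty ma aC ig); rewrite le_eqVlt; apply/orP; left.
  apply/eqP; apply: eq_integral => z _; rewrite E2; apply: eq_integral => x _.
  by rewrite ger0_norm// (K0 (x, z)).
rewrite Rintegral_ge0_fin//; last first.
  by move=> z; apply: Rintegral_ge0 => x _; exact: (K0 (x, z)).
apply: le_integral_ge0.
- apply: (measurable_int1 (leb N) (F := fun p : X * X => `|dlt (soft d \o a) p.1 p.2| ^+ 2)) => //.
  by rewrite /dlt; mfun.
- by apply/measurable_EFinP; exact: (measurable_Rint1 (leb N) mK).
move=> z; rewrite integral_ge0/=; last by move=> x _; rewrite lee_fin.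
rewrite E2.
apply: le_integral_ge0; [by rewrite /dlt; mfun|by rewrite /dlt; mfun|].
move=> x; rewrite !lee_fin exprn_ge0//= real_normK ?num_real//.
exact: soft_sqr.
Qed.

(** Young's inequality under the symmetrized integral. Thresholding shrinks the increments of [b],
    so the bound does not depend on [d]. *)
Lemma pairing_soft_le a b C d : measurable_fun setT a -> (forall x, `|a x| <= C) ->
  measurable_fun setT b -> 0 <= d -> (leb N).-integrable setT (EFin \o (soft d \o b)) ->
  ((- \int[leb N]_x (Lop nu a x * soft d (b x)))%:E <=
    (2^-1)%:E * (trunc_energy a + trunc_energy b))%E.
Proof.
move=> ma aC mb d0 ig; have mg := integrable_measurable ig.
rewrite (Lop_pairing ma aC ig) EFinM lee_wpmul2l// ?lee_fin//.
apply: le_trans (pairE ma aC ig) _.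
have m2 c : measurable_fun setT c ->
    measurable_fun setT (fun p : X * X => 2^-1 * `|dlt c p.1 p.2| ^+ 2).
  by move=> mc; rewrite /dlt; mfun.
have E c : measurable_fun setT c -> trunc_energy c =
    (\int[nu]_z \int[leb N]_x (2^-1 * `|dlt c x z| ^+ 2)%:E)%E.
  move=> mc; rewrite trunc_energyE// -ge0_integralZl//.
  - apply: eq_integral => z _; by rewrite -integralZl_ge0//; rewrite /dlt; mfun.
  - apply: (measurable_int1 (leb N) (F := fun p : X * X => `|dlt c p.1 p.2| ^+ 2)) => //.
    by rewrite /dlt; mfun.
  - by move=> z _; apply: integral_ge0 => x _; rewrite lee_fin.
rewrite !E// -ge0_integralD//; last 4 first.
- by move=> z _; apply: integral_ge0 => x _; rewrite lee_fin mulr_ge0.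
- by apply: (measurable_int1 (leb N) (F := fun p : X * X => 2^-1 * `|dlt a p.1 p.2| ^+ 2)); [exact: m2|move=> p; rewrite mulr_ge0].
- by move=> z _; apply: integral_ge0 => x _; rewrite lee_fin mulr_ge0.
- by apply: (measurable_int1 (leb N) (F := fun p : X * X => 2^-1 * `|dlt b p.1 p.2| ^+ 2)); [exact: m2|move=> p; rewrite mulr_ge0].
apply: le_integral_ge0.
- apply: (measurable_int1 (leb N) (F := fun p : X * X => `|dlt a p.1 p.2 * dlt (soft d \o b) p.1 p.2|)) => //.
  by rewrite /dlt; mfun.
- apply: emeasurable_funD.
    by apply: (measurable_int1 (leb N) (F := fun p : X * X => 2^-1 * `|dlt a p.1 p.2| ^+ 2)); [exact: m2|move=> p; rewrite mulr_ge0].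
  by apply: (measurable_int1 (leb N) (F := fun p : X * X => 2^-1 * `|dlt b p.1 p.2| ^+ 2)); [exact: m2|move=> p; rewrite mulr_ge0].
move=> z; rewrite integral_ge0/=; last by move=> x _; rewrite lee_fin.
rewrite -ge0_integralD//; [|by rewrite /dlt; mfun|by rewrite /dlt; mfun].
apply: le_integral_ge0; [by rewrite /dlt; mfun|by apply: emeasurable_funD; rewrite /dlt; mfun|].
move=> x; rewrite -EFinD !lee_fin normr_ge0/= normrM.
have : `|dlt (soft d \o b) x z| <= `|dlt b x z| by exact: soft_lip.
move: (`|dlt (soft d \o b) x z|) (`|dlt b x z|) (`|dlt a x z|) (normr_ge0 (dlt a x z)) => s t r r0 st.
apply: (@le_trans _ _ (r * t)); first exact: ler_wpM2l.
by have := sqr_ge0 (r - t); rewrite sqrrB; lra.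
Qed.

End pairing.

Section product_form.
Context {R : realType} {N : nat}.
Local Notation X := 'rV[R]_N.
Variable nu : {finite_measure set X -> \bar R}.
Implicit Types a : X -> R.

Definition square_diff a (p : X * X) : R := 2^-1 * `|a (p.1 + p.2) - a p.1| ^+ 2.

Lemma measurable_square_diff a : measurable_fun setT a -> measurable_fun setT (square_diff a).
Proof. by move=> ma; rewrite /square_diff; mfun. Qed.

Lemma square_diff_ge0 a p : 0 <= square_diff a p.
Proof. by rewrite mulr_ge0// sqr_ge0. Qed.

Lemma trunc_energy_prod a : measurable_fun setT a ->
  (trunc_energy nu a = \int[leb N \x nu]_p (square_diff a p)%:E)%E.
Proof.
move=> ma; have mG := measurable_square_diff ma.
rewrite /trunc_energy -ge0_integralZl//; last 2 first.
- by apply: (measurable_int2 nu (F := fun p : X * X => `|a (p.1 + p.2) - a p.1| ^+ 2)) => //; mfun.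
- by move=> x _; apply: integral_ge0 => z _; rewrite lee_fin.
rewrite (@fubini_tonelli1 _ _ _ _ _ (leb N) nu (fun p : X * X => (square_diff a p)%:E))//.
- apply: eq_integral => x _; rewrite /fubini_F/= -integralZl_ge0//; mfun.
- by mfun.
- by move=> p; rewrite lee_fin square_diff_ge0.
Qed.

End product_form.

(** * From truncated operators to the limit operator *)

Section regular_pairs.
Context {R : realType} {N : nat}.
Local Notation X := 'rV[R]_N.
Variable nu : nat -> {finite_measure set X -> \bar R}.
Hypothesis nu_even : forall k, preserving (nu k) (-%R : X -> X).
Hypothesis nu_mono : forall j k, (j <= k)%N -> forall A, measurable A -> (nu j A <= nu k A)%E.

(* [f] plays the role of minus the (unbounded) operator applied to [a]; the
   last condition says that the truncated operators converge to it uniformly.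
   The third one says that [a] vanishes at infinity in measure. *)
Definition regular (c : nat -> R) (a f : X -> R) :=
  [/\ measurable_fun setT a, exists C, forall x, `|a x| <= C,
      forall d, 0 < d -> exists2 g, (leb N).-integrable setT (EFin \o g) &
        forall x, `|a x| <= d + `|g x|,
      (leb N).-integrable setT (EFin \o f) &
      forall k, {ae leb N, forall x, `|Lop (nu k) a x + f x| <= c k}].

Variable c : nat -> R.
Hypothesis c0 : c @ \oo --> 0.
Implicit Types a b f g : X -> R.

Lemma regular_soft a f d : regular c a f -> 0 < d ->
  (leb N).-integrable setT (EFin \o (soft d \o a)).
Proof.
move=> [ma _ H _ _] d0; have [g ig ag] := H d d0; have md := measurable_soft d.
have msa : measurable_fun setT (soft d \o a) by exact: measurableT_comp md ma.
apply: (@integrable_dom _ _ _ _ _ (fun x => `|g x|)) => //.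
  exact: integrable_norm.
by move=> x; apply: soft_dom (ag x) => //; exact: ltW.
Qed.

Lemma Lop_bound k a C : measurable_fun setT a -> (forall x, `|a x| <= C) ->
  forall x, `|Lop (nu k) a x| <= (C + C) * fine (nu k setT).
Proof.
move=> ma aC x; have b z : `|a (x + z) - a x| <= C + C.
  by apply: le_trans (ler_normB _ _) _; rewrite lerD.
rewrite -(Rintegral_cst (nu k) measurableT).
apply: le_Rintegral_norm => //; first by apply: finite_integrable b; mfun.
exact: finite_measure_integrable_cst.
Qed.

(** The error [c k] is uniform in space, so it costs [c k] times the L1 norm of the partner [b].
    This is why partners have to be made integrable by thresholding. *)
Lemma regular_pair a f b k : regular c a f ->
  (exists C, forall x, `|b x| <= C) ->
  (leb N).-integrable setT (EFin \o b) ->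
  `|\int[leb N]_x (f x * b x) - - (\int[leb N]_x (Lop (nu k) a x * b x))| <=
     c k * \int[leb N]_x `|b x|.
Proof.
move=> [ma [C aC] _ jf H] [D bD] ib; have mb := integrable_measurable ib.
have mf := integrable_measurable jf.
have mL := measurable_Lop (nu k) ma.
have iL : (leb N).-integrable setT (EFin \o (fun x => Lop (nu k) a x * b x)).
  exact: integrable_bM ib (Lop_bound k ma aC).
have jfb : (leb N).-integrable setT (EFin \o (fun x => f x * b x)).
  exact: integrableM_b jf bD.
rewrite opprK -RintegralD//.
have jn : (leb N).-integrable setT (EFin \o (fun x => `|b x|)) by exact: integrable_norm.
rewrite -RintegralZl//.
apply: le_trans (le_normr_Rintegral measurableT _) _; first exact: integrableD_R.
apply: ae_le_Rintegral.
- by apply: integrable_norm => //; exact: integrableD_R.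
- exact: integrableZ_R.
- by apply: filterS (H k) => x Hx; rewrite addrC -mulrDl normrM ler_wpM2r.
Qed.

Lemma limit_error (u : nat -> R) (A B K : R) n : u @ \oo --> 0 ->
  (forall k, (n <= k)%N -> A <= B + u k * K) -> A <= B.
Proof.
move=> u0 H; have cK : B + u k * K @[k --> \oo] --> B.
  rewrite -[X in _ --> X]addr0 -(mul0r K).
  by apply: cvgD; [exact: cvg_cst|apply: cvgM => //; exact: cvg_cst].
apply: (@cvgr_to_ge _ _ _ _ _ _ _ cK).
by exists n => // k /= /H.
Qed.

Let scale_cvg0 : (fun k => k.+1%:R^-1 : R) @ \oo --> 0.
Proof. exact: cvg_harmonic. Qed.

Lemma trunc_energy_mono j k a : measurable_fun setT a -> (j <= k)%N ->
  (trunc_energy (nu j) a <= trunc_energy (nu k) a)%E.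
Proof.
move=> ma jk; rewrite lee_wpmul2l// ?lee_fin//.
have mF : measurable_fun setT (fun p : X * X => `|a (p.1 + p.2) - a p.1| ^+ 2) by mfun.
apply: le_integral_ge0.
- by apply: (measurable_int2 (nu j) (F := fun p : X * X => `|a (p.1 + p.2) - a p.1| ^+ 2)).
- by apply: (measurable_int2 (nu k) (F := fun p : X * X => `|a (p.1 + p.2) - a p.1| ^+ 2)).
move=> x; rewrite integral_ge0/=; last by move=> z _; rewrite lee_fin sqr_ge0.
apply: ge0_le_measure_integral => //.
- by move=> A mA; exact: nu_mono.
- by mfun.
Qed.

Lemma soft_error a f d : measurable_fun setT a -> (exists C, forall x, `|a x| <= C) -> 0 <= d ->
  (leb N).-integrable setT (EFin \o f) ->
  `|\int[leb N]_x (f x * soft d (a x)) - \int[leb N]_x (f x * a x)| <=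
    d * \int[leb N]_x `|f x|.
Proof.
move=> ma [C aC] d0 jf; have md := measurable_soft d.
have msa : measurable_fun setT (soft d \o a) by exact: measurableT_comp md ma.
have i1 : (leb N).-integrable setT (EFin \o (fun x => f x * soft d (a x))).
  by apply: (integrableM_b (C := C)) => // x; apply: le_trans (soft_le _ d0) _.
have i2 : (leb N).-integrable setT (EFin \o (fun x => f x * a x)).
  exact: integrableM_b jf aC.
rewrite -RintegralB// -RintegralZl//; last exact: integrable_norm.
apply: le_Rintegral_norm; first exact: integrableB_R.
  by apply: integrableZ_R; exact: integrable_norm.
by move=> x; rewrite -mulrBr normrM mulrC ler_wpM2r// distrC soft_dist.
Qed.

Lemma integral_limit_le d (Y : measurableType d) (m : {measure set Y -> \bar R})
    (F_ : nat -> Y -> R) (F : Y -> R) (B : \bar R) :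
  (forall j, measurable_fun setT (F_ j)) -> (forall j y, 0 <= F_ j y) ->
  (forall y, F_ ^~ y @ \oo --> F y) ->
  (forall j, \int[m]_y (F_ j y)%:E <= B)%E -> (\int[m]_y (F y)%:E <= B)%E.
Proof.
move=> mF F0 FF H.
have -> : (\int[m]_y (F y)%:E = \int[m]_y limn_einf (fun j => (F_ j y)%:E))%E.
  apply: eq_integral => y _.
  have cF : (fun j => (F_ j y)%:E) @ \oo --> (F y)%:E.
    by apply/fine_cvgP; split; [near=> j|exact: FF].
  by rewrite is_cvg_limn_einfE ?(cvg_lim _ cF)//; apply/cvg_ex; exists (F y)%:E.
apply: le_trans (fatou m measurableT _ _) _.
- by move=> j; apply/measurable_EFinP.
- by move=> j y _; rewrite lee_fin.
rewrite limn_einf_lim; apply: lime_le.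
  exact: is_cvg_einfs.
apply: nearW => k; apply: le_trans (H k).
by apply: ereal_inf_lbound; exists k => /=.
Unshelve. all: by end_near. Qed.

(** The order of limits matters. For a fixed threshold the truncation index goes to infinity first,
    because its error is multiplied by the L1 norm of [soft d a], which may blow up as [d]
    decreases. Only then does [d] tend to 0, by Fatou's lemma. *)
Lemma regular_energy a f n : regular c a f ->
  (trunc_energy (nu n) a <= (\int[leb N]_x (f x * a x))%:E)%E.
Proof.
move=> ra; have [ma [C aC] _ jf _] := ra.
have E1 d : 0 < d -> (trunc_energy (nu n) (soft d \o a) <=
    (\int[leb N]_x (f x * soft d (a x)))%:E)%E.
  move=> d0; have isa := regular_soft ra d0.
  have msa := integrable_measurable isa.
  have H k : (n <= k)%N -> (trunc_energy (nu n) (soft d \o a) <=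
      (\int[leb N]_x (f x * soft d (a x)) + c k * \int[leb N]_x `|soft d (a x)|)%:E)%E.
    move=> nk; apply: le_trans (trunc_energy_mono msa nk) _.
    apply: le_trans (energy_soft_le (nu_even k) ma aC (ltW d0) isa) _.
    have bs : exists C, forall x, `|(soft d \o a) x| <= C.
      by exists C => x; apply: le_trans (soft_le _ (ltW d0)) _.
    have := regular_pair k ra bs isa.
    by rewrite lee_fin /=; exact: dist_le_trans.
  have := H n (leqnn n); move: H.
  have : (0 <= trunc_energy (nu n) (soft d \o a))%E.
    rewrite mule_ge0//; apply: integral_ge0 => x _.
    by apply: integral_ge0 => z _; rewrite lee_fin sqr_ge0.
  case: (trunc_energy _ _) => [r| |] //= _ H _; rewrite lee_fin.
  apply: (@limit_error c r _ (\int[leb N]_x `|soft d (a x)|) n c0) => k nk.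
  by have := H k nk; rewrite lee_fin.
pose F_ j (p : X * X) := 2^-1 * `|soft j.+1%:R^-1 (a (p.1 + p.2)) - soft j.+1%:R^-1 (a p.1)| ^+ 2.
have ms j := @measurable_soft R j.+1%:R^-1.
have mF g : measurable_fun setT g ->
    measurable_fun setT (fun p : X * X => 2^-1 * `|g (p.1 + p.2) - g p.1| ^+ 2) by move=> mg; mfun.
have msa j : measurable_fun setT (soft j.+1%:R^-1 \o a) by exact: measurableT_comp (ms j) ma.
have mF_ j : measurable_fun setT (F_ j) := mF _ (msa j).
have F0 j p : 0 <= F_ j p by rewrite mulr_ge0.
have scv (r : R) : soft j.+1%:R^-1 r @[j --> \oo] --> r.
  apply/cvgrPdist_le => e e0; near=> j.
  apply: le_trans (soft_dist _ _) _ => //.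
  near: j; move/cvgrPdist_le: scale_cvg0 => /(_ e e0); apply: filterS => j.
  by rewrite sub0r normrN ger0_norm.
have FF p : F_ ^~ p @ \oo --> 2^-1 * `|a (p.1 + p.2) - a p.1| ^+ 2.
  by apply: cvgM; [exact: cvg_cst|apply: cvgM; (apply: cvg_norm; apply: cvgB; exact: scv)].
have teE g : measurable_fun setT g -> (trunc_energy (nu n) g =
    \int[leb N \x nu n]_p (2^-1 * `|g (p.1 + p.2)%R - g p.1| ^+ 2)%:E)%E.
  exact: trunc_energy_prod.
rewrite teE//; apply: (integral_limit_le mF_ F0 FF) => j.
(* Fatou's lemma asks for the exact bound at each index [j]. Comparing with a larger index [i] by
   [soft_soft] and letting [i] go to infinity removes the thresholding error. *)
have jle i : (j <= i)%N -> (\int[leb N \x nu n]_p (F_ j p)%:E <=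
   (\int[leb N]_x (f x * a x) + i.+1%:R^-1 * \int[leb N]_x `|f x|)%:E)%E.
  move=> ji; apply: (@le_trans _ _ (\int[leb N \x nu n]_p (F_ i p)%:E)%E).
    apply: le_integral_ge0; [exact/measurable_EFinP|exact/measurable_EFinP|].
    move=> p; rewrite !lee_fin F0/= ler_wpM2l// lerXn2r ?nnegrE// soft_soft//.
    by rewrite lef_pV2 ?posrE// ler_nat.
  rewrite -(teE _ (msa i)); apply: le_trans (E1 _ _) _; first by rewrite invr_gt0.
  have i0 : 0 <= i.+1%:R^-1 :> R by rewrite invr_ge0.
  have := soft_error ma (ex_intro _ C aC) i0 jf; rewrite lee_fin.
  by move=> /ler_normlP[_]; rewrite lerBlDl.
have := jle j (leqnn j); move: jle.
have : (0 <= \int[leb N \x nu n]_p (F_ j p)%:E)%E.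
  by apply: integral_ge0 => p _; rewrite lee_fin.
case: (integral _ _ _) => [r| |] //= _ jle _; rewrite lee_fin.
apply: (@limit_error _ r _ (\int[leb N]_x `|f x|) j scale_cvg0) => k jk.
by have := jle k jk; rewrite lee_fin.
Unshelve. all: by end_near. Qed.

(** Young's inequality for the nonnegative quadratic form of the operator, again with the truncation
    removed before the threshold. It will be applied to the same function at two different times. *)
Lemma regular_cross a b f g : regular c a f -> regular c b g ->
  \int[leb N]_x (f x * b x) <=
    2^-1 * (\int[leb N]_x (f x * a x) + \int[leb N]_x (g x * b x)).
Proof.
move=> ra rb; have [ma [C aC] _ jf _] := ra; have [mb [D bD] _ _ _] := rb.
have E1 d : 0 < d -> \int[leb N]_x (f x * soft d (b x)) <=
    2^-1 * (\int[leb N]_x (f x * a x) + \int[leb N]_x (g x * b x)).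
  move=> d0; have isb := regular_soft rb d0.
  have bs : exists C, forall x, `|(soft d \o b) x| <= C.
    by exists D => x; apply: le_trans (soft_le _ (ltW d0)) _.
  apply: (limit_error (n := 0) (K := \int[leb N]_x `|soft d (b x)|) c0) => k _.
  have := regular_pair k ra bs isb.
  have : - (\int[leb N]_x (Lop (nu k) a x * soft d (b x))) <=
      2^-1 * (\int[leb N]_x (f x * a x) + \int[leb N]_x (g x * b x)).
    rewrite -lee_fin; apply: le_trans (pairing_soft_le (nu_even k) ma aC mb (ltW d0) isb) _.
    by rewrite EFinM lee_wpmul2l// ?lee_fin// EFinD leeD//; exact: regular_energy.
  exact: dist_le_trans2.
apply: (limit_error (n := 0) (K := \int[leb N]_x `|f x|) scale_cvg0) => i _.
have i0 : 0 < i.+1%:R^-1 :> R by rewrite invr_gt0.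
have := soft_error mb (ex_intro _ D bD) (ltW i0) jf.
have := E1 _ i0; exact: dist_le_trans3.
Qed.

End regular_pairs.

Section parametric_ae.
Context d1 d2 (T1 : measurableType d1) (T2 : measurableType d2) (R : realType).
Variables (m1 : {sigma_finite_measure set T1 -> \bar R})
  (m2 : {sigma_finite_measure set T2 -> \bar R}) (F : T1 * T2 -> R).
Hypothesis iF : (m1 \x m2)%E.-integrable setT (EFin \o F).

Let mF : measurable_fun setT F.
Proof. exact: integrable_measurable iF. Qed.

Lemma section2_integrable : m2.-integrable setT (EFin \o (fun y => \int[m1]_x F (x, y))).
Proof.
have mR := measurable_Rint1 m1 mF.
apply/(integrable_nrm1 _ mR).
have mFE : measurable_fun setT (EFin \o F) by mfun.
have := (integrable21ltyP m1 m2 mFE).1 iF; apply: le_lt_trans.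
apply: le_integral_ge0; first exact: measurable_normE.
  by apply: (measurable_int1 m1 (F := fun p => `|F p|)) => //; mfun.
move=> y; rewrite lee_fin normr_ge0/=.
by apply: (normr_Rintegral_le m1 (f := fun x => F (x, y))); mfun.
Qed.

Lemma Rintegral_prod_ae2 : \int[(m1 \x m2)%E]_p F p = \int[m2]_y \int[m1]_x F (x, y).
Proof.
congr fine; rewrite -integral21_prod_meas1//; apply: ae_eq_integral => //.
- exact: measurable_fubini_G iF.
- by apply/measurable_EFinP; exact: (measurable_Rint1 m1 mF).
- apply: filterS (ae_integrable2 iF) => y iy _ /=.
  by rewrite fineK//; exact: (integrable_fin_num measurableT iy).
Qed.

End parametric_ae.

(** * Integration of the stationary estimates in time *)

Section time_positivity.
Context {R : realType} {N : nat}.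
Local Notation X := 'rV[R]_N.
Local Notation Z := (X * measurableTypeR R)%type.
Local Notation lam := (@lebesgue_measure R).
Local Notation lZ := (leb N \x lam)%E.
Variable nu : nat -> {finite_measure set X -> \bar R}.
Hypothesis nu_even : forall k, preserving (nu k) (-%R : X -> X).
Hypothesis nu_mono : forall j k, (j <= k)%N -> forall A, measurable A -> (nu j A <= nu k A)%E.
Variables (c : nat -> R) (v f : Z -> R) (C T : R).
Hypothesis c0 : c @ \oo --> 0.
Hypothesis mv : measurable_fun setT v.
Hypothesis vC : forall p, `|v p| <= C.
Hypothesis jf : lZ.-integrable setT (EFin \o f).
Hypothesis fT : forall p, T <= p.2 -> f p = 0.
Hypothesis reg : {ae lam, forall t : measurableTypeR R, t < T ->
  regular nu c (fun x => v (x, t)) (fun x => f (x, t))}.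

Let B (t : measurableTypeR R) := \int[leb N]_x (f (x, t) * v (x, t)).

Let iB : lam.-integrable setT (EFin \o B).
Proof. by apply: (section2_integrable (F := fun p => f p * v p)); exact: integrableM_b jf vC. Qed.

Let B_ge0 : {ae lam, forall t : measurableTypeR R, 0 <= B t}.
Proof.
apply: filterS reg => t H; have [/H r|tT] := ltP t T.
  rewrite -lee_fin; apply: le_trans (regular_energy nu_even nu_mono c0 0 r).
  rewrite mule_ge0//; apply: integral_ge0 => x _.
  by apply: integral_ge0 => z _; rewrite lee_fin sqr_ge0.
rewrite /B; under eq_Rintegral do rewrite fT// mul0r.
by rewrite Rintegral_cst// mul0r.
Qed.

(** [regular_energy] is integrated over (0, T). Its right-hand side is nonnegative at almost every
    time of the whole line, so enlarging the domain only increases the integral. *)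
Lemma time_energy n : (\int[lam]_(t in `]0%R, T[)
    trunc_energy (nu n) (fun x => v (x, t)) <= (\int[lZ]_p (f p * v p))%:E)%E.
Proof.
have jfv : lZ.-integrable setT (EFin \o (fun p => f p * v p)) by exact: integrableM_b jf vC.
have mB := integrable_measurable iB.
have -> : (\int[lZ]_p (f p * v p))%:E = (\int[lam]_t `|B t|%:E)%E.
  rewrite (Rintegral_prod_ae2 jfv) -/B.
  rewrite (_ : \int[lam]_y _ = \int[lam]_t `|B t|).
    rewrite Rintegral_ge0_fin//; exact/(integrable_nrm1 _ mB).
  apply: ae_eq_Rintegral => //; first by mfun.
  by apply: filterS B_ge0 => t B0; rewrite ger0_norm.
have mE : measurable_fun setT (fun t : measurableTypeR R => trunc_energy (nu n) (fun x => v (x, t))).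
  apply: measurable_funeM.
  pose G (q : (measurableTypeR R * X) * X) := `|v (q.1.2 + q.2, q.1.1) - v (q.1.2, q.1.1)| ^+ 2.
  have mG : measurable_fun setT (fun q => (G q)%:E) by rewrite /G; mfun.
  have m1 := measurable_fun_fubini_tonelli_F (m2 := nu n) _ mG.
  have := measurable_fun_fubini_tonelli_F (m2 := leb N) _ (m1 _).
  apply.
  - by move=> q; rewrite lee_fin sqr_ge0.
  - by move=> q; apply: integral_ge0 => z _; rewrite lee_fin sqr_ge0.
apply: (@le_trans _ _ (\int[lam]_(t in `]0%R, T[) `|B t|%:E)%E).
  apply: ae_ge0_le_integral => //.
  - move=> t _; rewrite mule_ge0//; apply: integral_ge0 => x _.
    by apply: integral_ge0 => z _; rewrite lee_fin sqr_ge0.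
  - exact: measurable_funS mE.
  - by apply: measurable_funS (measurable_normE mB).
  - apply: filterS reg => t H; rewrite /= in_itv/= => /andP[_ /H r].
    apply: le_trans (regular_energy nu_even nu_mono c0 n r) _.
    by rewrite lee_fin ler_norm.
by apply: ge0_subset_integral => //; exact: measurable_normE.
Qed.

(** The claim amounts to bounding the integral of [f v(t - h)] by that of [f v]. At almost every
    time [regular_cross] bounds the former by the mean of [B t] and [B (t - h)], and both have the
    same integral. *)
Lemma time_positivity h q : 0 < h -> 0 <= q ->
  (1 - q) * \int[lZ]_p (f p * v p) <=
  \int[lZ]_p (f p * (v p - q * v (p.1, p.2 - h))).
Proof.
move=> h0 q0.
have mvh : measurable_fun setT (fun p : Z => v (p.1, p.2 - h)) by mfun.
have vhC (p : Z) : `|v (p.1, p.2 - h)| <= C by [].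
have j1 : lZ.-integrable setT (EFin \o (fun p => f p * v p)) by exact: integrableM_b jf vC.
have j2 : lZ.-integrable setT (EFin \o (fun p : Z => f p * v (p.1, p.2 - h))).
  exact: integrableM_b jf vhC.
have -> : \int[lZ]_p (f p * (v p - q * v (p.1, p.2 - h))) =
    \int[lZ]_p (f p * v p) - q * \int[lZ]_p (f p * v (p.1, p.2 - h)).
  rewrite -RintegralZl// -RintegralB//; last exact: integrableZ_R.
  by apply: eq_Rintegral => p _; rewrite mulrBr mulrCA.
suff H : \int[lZ]_p (f p * v (p.1, p.2 - h)) <= \int[lZ]_p (f p * v p).
  by rewrite mulrBl mul1r lerB// ler_wpM2l.
rewrite (Rintegral_prod_ae2 j1) (Rintegral_prod_ae2 j2) -/B /=.
have iBh : lam.-integrable setT (EFin \o (fun t => B (t - h))).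
  exact: (preserving_integrable (preserving_shift (- h)) iB).
(* Translation invariance in time lets the total of [B] be written as the total of the mean of [B t]
   and [B (t - h)]. *)
have -> : \int[lam]_t B t = \int[lam]_t (2^-1 * (B t + B (t - h))).
  rewrite RintegralZl//; last exact: integrableD_R.
  rewrite RintegralD// (preserving_Rintegral (preserving_shift (- h)) (f := B)).
    by move: (\int[lam]_x _) => b; lra.
  exact: integrable_measurable iB.
apply: ae_le_Rintegral.
- exact: (section2_integrable (F := fun p : Z => f p * v (p.1, p.2 - h))).
- by apply: integrableZ_R; exact: integrableD_R.
have regh := preserving_ae (preserving_shift (- h)) reg.
have Bh := preserving_ae (preserving_shift (- h)) B_ge0.
apply: filterS3 reg regh Bh => t H Hh Bh0.
have [tT|tT] := ltP t T.
  apply: (regular_cross nu_even nu_mono c0 (H tT) (Hh _)).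
  by apply: le_lt_trans tT; rewrite gerBl ltW.
under eq_Rintegral do rewrite fT// mul0r.
rewrite Rintegral_cst// mul0r mulr_ge0 ?addr_ge0//.
rewrite /B; under eq_Rintegral do rewrite fT// mul0r.
by rewrite Rintegral_cst// mul0r.
Qed.

End time_positivity.

(** * The weak formulation in time *)

Lemma dominated_Rint d (T : measurableType d) (R : realType)
    (m : {measure set T -> \bar R}) (f_ : nat -> T -> R) (f g : T -> R) :
  (forall k, measurable_fun setT (f_ k)) -> measurable_fun setT f ->
  (forall x, f_ ^~ x @ \oo --> f x) ->
  m.-integrable setT (EFin \o g) -> (forall k x, `|f_ k x| <= g x) ->
  \int[m]_x f_ k x @[k --> \oo] --> \int[m]_x f x.
Proof.
move=> mf_ mf f_f ig fg.
have fgx x : `|f x| <= g x.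
  apply: (@cvgr_to_le _ _ _ _ _ _ _ (cvg_norm (f_f x))).
  exact: nearW.
have if_ k : m.-integrable setT (EFin \o f_ k).
  exact: (integrable_dom (mf_ k) ig (fg k)).
have jf : m.-integrable setT (EFin \o f) by exact: integrable_dom fgx.
have D := dominated_nrm1 mf_ mf f_f ig fg.
apply/cvgrPdist_le => e e0; have [K HK] := cvg0_le e0 D (fun=> nrm1_ge0 _ _).
exists K => // k /= /HK; rewrite -lee_fin; apply: le_trans.
by rewrite -RintegralB//; apply: normr_Rintegral_le; mfun.
Qed.

Section e0_limits.
Context {R : realType}.

Definition e0' : R -> R := flat ('X^2 * (1 - 1^`())).

Lemma is_derive_e0 (x : R) : is_derive x 1 e0 (e0' x).
Proof. exact: is_derive_flat. Qed.

Lemma mul_e0' x : x * e0' x = if 0 < x then x^-1 * expR (- x^-1) else 0.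
Proof.
rewrite /e0' /flat; case: ifPn => x0; last by rewrite mulr0.
rewrite -[1]/(1%:P) derivC subr0 polyC1 mulr1 hornerXn expr2 !mulrA mulfV ?gt_eqF//.
by rewrite mul1r.
Qed.

(** Differentiating the smooth cut-off [e0 (n (tau - s))] produces a factor [n]; together with
    [tau - s] it forms [x * e0' x], which is bounded uniformly in [n]. *)
Lemma mul_e0'_bound x : 0 <= x * e0' x <= 1.
Proof.
rewrite mul_e0'; case: ifPn => x0; last by rewrite lexx ler01.
have y0 : 0 < x^-1 by rewrite invr_gt0.
move: y0; move: (x^-1) => y y0; rewrite mulr_ge0 ?expR_ge0 ?(ltW y0)//=.
rewrite expRN ler_pdivrMr ?expR_gt0// mul1r.
by apply: le_trans (expR_ge1Dx y); rewrite lerDr.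
Qed.

Let inv_cvg0 (r : R) : 0 < r -> (fun n => (n%:R * r)^-1) @ \oo --> 0.
Proof.
move=> r0; rewrite -(mul0r r^-1); under eq_fun do rewrite invfM.
apply: cvgM; last exact: cvg_cst.
rewrite -cvg_shiftS; exact: cvg_harmonic.
Qed.

Let expR_inv_cvg (r : R) : 0 < r ->
  (fun n => expR (- (n.+1%:R * r)^-1)) @ \oo --> (1 : R).
Proof.
move=> r0; have H : (fun n => - (n.+1%:R * r)^-1) @ \oo --> (0 : R).
  rewrite -oppr0; apply: cvgN.
  by have := inv_cvg0 r0; rewrite -cvg_shiftS.
have c0 : {for (0 : R), continuous (@expR R)} by exact: continuous_expR.
have := continuous_cvg _ c0 H.
rewrite expR0; exact.
Qed.

Lemma e0_cvg (r : R) : 0 < r -> (fun n => e0 (n%:R * r)) @ \oo --> (1 : R).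
Proof.
move=> r0; rewrite -cvg_shiftS.
under eq_fun do rewrite e0E mulr_gt0//.
exact: expR_inv_cvg.
Qed.

Lemma mul_e0'_cvg (r : R) : 0 < r ->
  (fun n => (n%:R * r) * e0' (n%:R * r)) @ \oo --> (0 : R).
Proof.
move=> r0; rewrite -cvg_shiftS.
under eq_fun do rewrite mul_e0' mulr_gt0//.
have H : (fun n => (n.+1%:R * r)^-1) @ \oo --> (0 : R).
  by have := inv_cvg0 r0; rewrite -cvg_shiftS.
have := cvgM H (expR_inv_cvg r0); rewrite mul0r => H2.
exact: H2.
Qed.

End e0_limits.

Section time_test_derivative.
Context {R : realType}.
Variables (lam tau : R) (n : nat).

Definition time_test' (s : R) : R := expR (lam * s) *
  (lam * ((tau - s) * e0 (n%:R * (tau - s))) - e0 (n%:R * (tau - s)) -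
   n%:R * (tau - s) * e0' (n%:R * (tau - s))).

Lemma derive1_time_test s : derive1 (time_test lam tau n) s = time_test' s.
Proof.
rewrite derive1E; apply: derive_val.
have H1 : is_derive s 1 (fun s => expR (lam * s)) (lam * expR (lam * s)).
  rewrite mulrC; apply: (@is_derive1_comp R (@expR R) (fun s : R => lam * s)).
  by apply: is_derive_eq; rewrite ?[_ *: 1]mulr1.
have H2 : is_derive s 1 (fun s => tau - s) (-1).
  rewrite (_ : (fun s => _) = fun s => -1 * s + tau); last first.
    by apply/funext => r; rewrite mulN1r addrC.
  by apply: is_derive_eq; rewrite addr0 [_ *: 1]mulr1.
have H3 : is_derive s 1 (fun s => e0 (n%:R * (tau - s))) (e0' (n%:R * (tau - s)) * - n%:R).
  apply: (@is_derive1_comp R e0 (fun s => n%:R * (tau - s))); first exact: is_derive_e0.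
  rewrite (_ : (fun s => _) = fun s => - n%:R * s + n%:R * tau); last first.
    by apply/funext => r; ring.
  by apply: is_derive_eq; rewrite addr0 [_ *: 1]mulr1.
have H4 := is_deriveM H1 (is_deriveM H2 H3).
apply: (is_derive_eq H4); rewrite /time_test' /GRing.scale/=.
have E (a b : R -> R) : (a * b) s = a s * b s by [].
rewrite E; ring.
Qed.

Lemma measurable_time_test : measurable_fun setT (time_test lam tau n).
Proof.
apply: continuous_measurable_fun => s.
exact: (gen_continuous (time_test_gen lam tau n)).
Qed.

End time_test_derivative.

Lemma measurable_fun_cvg_lim d (T : measurableType d) (R : realType) (f_ : nat -> T -> R) (f : T -> R) :
  (forall k, measurable_fun setT (f_ k)) -> (forall x, f_ ^~ x @ \oo --> f x) ->
  measurable_fun setT f.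
Proof.
move=> mf_ ff; apply/measurable_EFinP.
apply: (emeasurable_fun_cvg (fun k x => (f_ k x)%:E)) => [k|x _].
  exact/measurable_EFinP.
by apply: cvg_EFin; [exact: nearW|exact: ff].
Qed.

Notation ind b := ((nat_of_bool b%R)%:R).

Section order_indicators.
Context d (T : measurableType d) (R : realType).

Lemma measurable_le (f g : T -> R) : measurable_fun setT f -> measurable_fun setT g ->
  measurable_fun setT (fun x => ind (f x <= g x) : R).
Proof.
move=> mf mg; have := measurable_fun_ler mf mg => H.
rewrite (_ : (fun x => _) = (fun x => if f x <= g x then 1 else 0)).
  by apply: measurable_fun_ifT.
by apply/funext => x; case: ifP.
Qed.

Lemma measurable_lt (f g : T -> R) : measurable_fun setT f -> measurable_fun setT g ->
  measurable_fun setT (fun x => ind (f x < g x) : R).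
Proof.
move=> mf mg; have := measurable_fun_ltr mf mg => H.
rewrite (_ : (fun x => _) = (fun x => if f x < g x then 1 else 0)).
  by apply: measurable_fun_ifT.
by apply/funext => x; case: ifP.
Qed.

End order_indicators.

Lemma measurable_flat (R : realType) (p : {poly R}) : measurable_fun setT (flat p).
Proof.
apply: continuous_measurable_fun => x; apply: differentiable_continuous.
by apply/derivable1_diffP; case: (is_derive_flat p x).
Qed.

(** * Duhamel's formula from the weak form on the time line *)

Section duhamel.
Context {R : realType}.
Local Notation leb1 := (@lebesgue_measure R).
Variables (lam T a0 : R) (a b : measurableTypeR R -> R) (C : R).
Hypothesis lam0 : 0 < lam.
Hypothesis ma : measurable_fun setT a.
Hypothesis mb : measurable_fun setT b.
Hypothesis aC : forall s, `|a s| <= C.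
Hypothesis bC : forall s, `|b s| <= C.
Hypothesis aT : forall s, ~~ (0 < s < T) -> a s = 0.
Hypothesis bT : forall s, ~~ (0 < s < T) -> b s = 0.
Hypothesis weak : forall tau n, 0 < tau < T ->
  \int[leb1]_s (time_test' lam tau n s * a s + time_test lam tau n s * b s) +
    a0 * time_test lam tau n 0 = 0.

Let I01 : set (measurableTypeR R) := `[0, T[%classic.

Let box_integrable (D : R) : leb1.-integrable setT (EFin \o (fun s => D * \1_I01 s)).
Proof.
apply: integrableZ_R; apply/integrable_nrm1.
  by apply: measurable_indic; exact: measurable_itv.
have Ioo : (leb1 I01 < +oo)%E.
  by rewrite /I01 lebesgue_measure_itv/=; case: ifP => _; rewrite ?ltry// -EFinD ltry.
rewrite /nrm1; under eq_integral do rewrite ger0_norm//.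
by rewrite integral_indic ?setIT//; exact: measurable_itv.
Qed.

Let integrable_box (f : measurableTypeR R -> R) D : measurable_fun setT f ->
  (forall s, 0 <= s < T -> `|f s| <= D) -> (forall s, ~~ (0 <= s < T) -> f s = 0) ->
  leb1.-integrable setT (EFin \o f).
Proof.
move=> mf fD f0; apply: (integrable_dom mf (box_integrable D)) => s.
rewrite indicE; have [sI|sI] := boolP (0 <= s < T).
  by rewrite mem_set ?mulr1 ?fD//= /I01/= in_itv.
rewrite f0// normr0 memNset ?mulr0//= /I01/= in_itv/=; exact/negP.
Qed.

Let outside s : ~~ (0 <= s < T) -> ~~ (0 < s < T).
Proof. by apply: contra => /andP[/ltW -> ->]. Qed.

Let A s := expR (lam * s) * a s.
Let G s := expR (lam * s) * (lam * a s + b s).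
Let D := expR (lam * T) * (lam * C + C).

Let C0 : 0 <= C. Proof. exact: le_trans (aC 0). Qed.

Let AD s : 0 <= s < T -> `|A s| <= expR (lam * T) * C.
Proof.
move=> /andP[s0 sT]; rewrite /A normrM ler_pM// ger0_norm ?expR_ge0//.
by rewrite ler_expR ler_wpM2l ?ltW.
Qed.

Let GD s : 0 <= s < T -> `|G s| <= D.
Proof.
move=> /andP[s0 sT]; rewrite /G normrM; apply: ler_pM => //.
  by rewrite ger0_norm ?expR_ge0// ler_expR ler_wpM2l ?ltW.
apply: le_trans (ler_normD _ _) _; rewrite lerD// normrM gtr0_norm//.
by rewrite ler_wpM2l// ltW.
Qed.

Let mA : measurable_fun setT A. Proof. by rewrite /A; mfun. Qed.
Let mG : measurable_fun setT G. Proof. by rewrite /G; mfun. Qed.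

Let iA : leb1.-integrable setT (EFin \o A).
Proof. by apply: (integrable_box mA AD) => s /outside s0; rewrite /A aT// mulr0. Qed.

Let iG : leb1.-integrable setT (EFin \o G).
Proof. by apply: (integrable_box mG GD) => s /outside s0; rewrite /G aT// bT// mulr0 addr0 mulr0. Qed.

Let pos_part (x : R) := Num.max x 0.

(** As [n] grows, [e0 (n r)] tends to 1 for [r > 0], is 0 for [r <= 0], and the term with [e0']
    disappears. What remains is an integrated equation: differentiating it formally in [tau] gives
    [A = a0 +] the integral of [G] up to [tau]. *)
Let limit_identity tau : 0 < tau < T ->
  \int[leb1]_s (pos_part (tau - s) * G s - (if s < tau then A s else 0)) + a0 * tau = 0.
Proof.
move=> tauT; have /andP[tau0 _] := tauT.
pose f_ n (s : measurableTypeR R) := time_test' lam tau n s * a s + time_test lam tau n s * b s.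
pose F (s : measurableTypeR R) := pos_part (tau - s) * G s - (if s < tau then A s else 0).
have mt n : measurable_fun setT (time_test lam tau n : measurableTypeR R -> R).
  exact: measurable_time_test.
have me0 : measurable_fun setT (@e0 R) by exact: measurable_flat.
have me0' : measurable_fun setT (@e0' R) by exact: measurable_flat.
have mf_ n : measurable_fun setT (f_ n).
  rewrite /f_; have mtn := mt n; apply: measurable_funD; last by mfun.
  by apply: measurable_funM => //; rewrite /time_test'; mfun.
have t0 n s : tau <= s -> time_test' lam tau n s = 0 /\ time_test lam tau n s = 0.
  move=> ts; split; last exact: time_test0.
  have ns : n%:R * (tau - s) <= 0 by rewrite mulr_ge0_le0// subr_le0.
  by rewrite /time_test' mul_e0' e0E ltNge ns/= mulr0 mulr0 !subr0 mulr0.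
have f_F s : f_ ^~ s @ \oo --> F s.
  rewrite /F /pos_part; have [st|ts] := ltP s tau; last first.
    rewrite max_r ?subr_le0// mul0r subr0.
    apply: cvg_near_cst; apply: nearW => n; rewrite /f_.
    by have [-> ->] := t0 n s ts; rewrite !mul0r addr0.
  have ts : 0 < tau - s by rewrite subr_gt0.
  rewrite max_l ?(ltW ts)//.
  have -> : (tau - s) * G s - A s = expR (lam * s) *
      (lam * ((tau - s) * 1) - 1 - 0) * a s + expR (lam * s) * ((tau - s) * 1) * b s.
    by rewrite /G /A; ring.
  have c1 := e0_cvg ts; have c2 := mul_e0'_cvg ts.
  have c3 (x : R) : (fun _ : nat => x) @ \oo --> x by exact: cvg_cst.
  rewrite /f_ /time_test' /time_test; apply: cvgD; apply: cvgM => //; apply: cvgM => //.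
    by apply: cvgB => //; apply: cvgB => //; apply: cvgM => //; exact: cvgM.
  exact: cvgM.
pose D' := expR (lam * T) * (lam * (T * 1) + 1 + 1) * C + expR (lam * T) * (T * 1) * C.
have fD n s : `|f_ n s| <= D' * \1_I01 s.
  rewrite indicE; have [sI|/[dup] /outside ? sI] := boolP (0 <= s < T); last first.
    rewrite /f_ aT// bT// !mulr0 addr0 normr0 memNset ?mulr0//= /I01/= in_itv/=.
    exact/negP.
  have /andP[s0 sT] := sI.
  rewrite mem_set ?mulr1; last by rewrite /I01/= in_itv.
  have T0 : 0 < T by exact: le_lt_trans sT.
  have L1 : `|expR (lam * s)| <= expR (lam * T).
    by rewrite ger0_norm ?expR_ge0// ler_expR ler_wpM2l ?ltW.
  have [st|ts] := ltP s tau; last first.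
    rewrite /f_; have [-> ->] := t0 n s ts; rewrite !mul0r addr0 normr0 /D'.
    rewrite addr_ge0// mulr_ge0// mulr_ge0 ?expR_ge0// ?mulr1 ?(ltW T0)//.
    by rewrite !addr_ge0// mulr_ge0// ltW.
  have L2 : `|tau - s| <= T.
    case/andP: tauT => _ /ltW tT; rewrite ger0_norm ?subr_ge0 ?(ltW st)//.
    by rewrite lerBlDr (le_trans tT)// lerDl.
  have L3 x : `|e0 x : R| <= 1 by rewrite ger0_norm ?e0_ge0// e0_le1.
  have L4 x : `|x * e0' x : R| <= 1 by have /andP[x0 x1] := mul_e0'_bound x; rewrite ger0_norm.
  have L5 : `|(tau - s) * e0 (n%:R * (tau - s))| <= T * 1 by rewrite normrM ler_pM.
  apply: le_trans (ler_normD _ _) _; rewrite lerD//.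
    rewrite normrM ler_pM// normrM ler_pM//.
    apply: le_trans (ler_normB _ _) _; rewrite lerD//.
    apply: le_trans (ler_normB _ _) _; rewrite lerD//.
    by rewrite normrM gtr0_norm// ler_wpM2l// ltW.
  by rewrite normrM ler_pM// normrM ler_pM.
have mF : measurable_fun setT F by exact: measurable_fun_cvg_lim mf_ f_F.
have c1 := dominated_Rint mf_ mF f_F (box_integrable D') fD.
have c2 : a0 * time_test lam tau n 0 @[n --> \oo] --> a0 * tau.
  apply: cvgM; first exact: cvg_cst.
  rewrite /time_test mulr0 expR0 subr0 -[X in _ --> X]mulr1 -[X in _ --> X]mul1r.
  apply: cvgM; first exact: cvg_cst.
  by apply: cvgM; [exact: cvg_cst|exact: e0_cvg].
have c3 : (fun k => \int[leb1]_s f_ k s + a0 * time_test lam tau k 0) @ \oo -->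
    \int[leb1]_s F s + a0 * tau by exact: cvgD.
have E : (fun k => \int[leb1]_s f_ k s + a0 * time_test lam tau k 0) = fun=> 0.
  by apply/funext => k; exact: weak.
by rewrite E in c3; have := cvg_lim (@Rhausdorff R) c3; rewrite lim_cst// => <-.
Qed.

Let g r := \int[leb1]_s (ind (s <= r) * G s).

Let mg : measurable_fun setT g.
Proof.
apply: (measurable_Rint2 leb1 (F := fun p : measurableTypeR R * measurableTypeR R =>
  ind (p.2 <= p.1) * G p.2)).
by apply: measurable_funM; [apply: measurable_le|]; mfun.
Qed.

Let iGr r : leb1.-integrable setT (EFin \o (fun s : measurableTypeR R => ind (s <= r) * G s)).
Proof.
apply: (integrable_dom (g := fun s : measurableTypeR R => `|G s|)); last 2 first.
- exact: integrable_norm.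
- by move=> s; rewrite normrM ler_piMl// normr_nat lern1 leq_b1.
by apply: measurable_funM; [apply: measurable_le|]; mfun.
Qed.

Let itv_length (s t : R) : leb1.-integrable setT (EFin \o (\1_(`[s, t[%classic : set (measurableTypeR R)))) /\
  \int[leb1]_r \1_(`[s, t[%classic : set (measurableTypeR R)) r = pos_part (t - s).
Proof.
have mI : measurable (`[s, t[%classic : set (measurableTypeR R)) by exact: measurable_itv.
have E : leb1 (`[s, t[%classic) = (pos_part (t - s))%:E.
  rewrite lebesgue_measure_itv/= lte_fin /pos_part; case: ltP => st.
    by rewrite max_l ?subr_ge0 ?(ltW st)// EFinB.
  by rewrite max_r// subr_le0.
have Eoo : (leb1 (`[s, t[%classic) < +oo)%E by rewrite E ltry.
split; last by rewrite /Rintegral integral_indic// setIT; exact: (congr1 fine E).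
apply/integrable_nrm1; first exact: measurable_indic.
rewrite /nrm1; under eq_integral do rewrite ger0_norm//.
by rewrite integral_indic// setIT.
Qed.

(** Cauchy's formula for an iterated integral, by Fubini: the interval [[s, tau[] has length the
    positive part of [tau - s]. *)
Let gE tau : 0 < tau < T ->
  \int[leb1]_r (ind (0 <= r) * ind (r < tau) * g r) = \int[leb1]_s (pos_part (tau - s) * G s).
Proof.
move=> /andP[tau0 tauT].
pose F (p : measurableTypeR R * measurableTypeR R) : R :=
  (ind (0 <= p.1) * ind (p.1 < tau)) * (ind (p.2 <= p.1) * G p.2).
have mF : measurable_fun setT F.
  rewrite /F; apply: measurable_funM; apply: measurable_funM; (try apply: measurable_le);
    (try apply: measurable_lt); mfun.
have -> : \int[leb1]_r (ind (0 <= r) * ind (r < tau) * g r) = \int[leb1]_r \int[leb1]_s F (r, s).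
  apply: eq_Rintegral => r _; rewrite /g -(RintegralZl _ measurableT (iGr r)).
  by apply: eq_Rintegral => s _; rewrite /F/=.
have FG r s : `|F (r, s)| <= \1_I01 r * `|G s|.
  rewrite /F/= normrM; apply: ler_pM => //.
    rewrite normrM !normr_nat indicE -natrM ler_nat mulnb.
    have [/andP[r0 rt]|//] := boolP ((0 <= r) && (r < tau)).
    by rewrite mem_set// /I01/= in_itv/= r0 (lt_trans rt).
  by rewrite normrM ler_piMl// normr_nat lern1 leq_b1.
have mI : measurable_fun setT (\1_I01 : measurableTypeR R -> R).
  by apply: measurable_indic; exact: measurable_itv.
have i1 : leb1.-integrable setT (EFin \o (\1_I01 : measurableTypeR R -> R)).
  have := box_integrable 1; under eq_fun do rewrite mul1r.
  by [].
have iGn : leb1.-integrable setT (EFin \o (fun s => `|G s|)) by exact: integrable_norm.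
rewrite (@Rfubini _ _ _ _ _ leb1 leb1 F)//.
- apply: eq_Rintegral => s _; have [/andP[s0 sT]|sI] := boolP (0 < s < T); last first.
    have G0 : G s = 0 by rewrite /G aT// bT// mulr0 addr0 mulr0.
    rewrite /F/= G0 mulr0; under eq_Rintegral do rewrite !mulr0.
    by rewrite Rintegral_cst// mul0r.
  have [J1 J2] := itv_length s tau.
  rewrite -J2 mulrC -(RintegralZl (G s) measurableT J1).
  apply: eq_Rintegral => r _; rewrite /F/= mulrA [LHS]mulrC -!natrM !mulnb indicE.
  congr (_ * (nat_of_bool _)%:R); apply/idP/idP => [/andP[/andP[_ rt] sr]|].
    by rewrite inE/= in_itv/= sr.
  by rewrite inE/= in_itv/= => /andP[sr ->]; rewrite sr (le_trans (ltW s0)).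
- move=> r; apply: (integrable_dom (f := fun s => F (r, s))
    (g := fun s : measurableTypeR R => \1_I01 r * `|G s|)) => //.
    by mfun.
  exact: integrableZ_R.
- move=> s; apply: (integrable_dom (f := fun r => F (r, s))
    (g := fun r : measurableTypeR R => \1_I01 r * `|G s|)) => //.
    by mfun.
  by under eq_fun do rewrite mulrC; exact: integrableZ_R.
- apply: (@le_lt_trans _ _ (\int[leb1]_r (\int[leb1]_s `|G s| * \1_I01 r)%:E)%E).
    apply: le_integral_ge0.
    + by apply: (measurable_int2 leb1 (F := fun p => `|F p|)) => //; mfun.
    + by mfun.
    move=> r; rewrite integral_ge0/=; last by move=> s _; rewrite lee_fin.
    rewrite EFinM Rintegral_nrm1// muleC /nrm1 -integralZl_ge0//; last by mfun.
    apply: le_integral_ge0; [by mfun|by mfun|].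
    by move=> s; rewrite !lee_fin normr_ge0/=; exact: FG.
  have iZ := integrableZ_R (\int[leb1]_s `|G s|) i1.
  apply: le_lt_trans ((integrable_nrm1 leb1 (integrable_measurable iZ)).1 iZ).
  rewrite /nrm1 le_eqVlt; apply/orP; left; apply/eqP; apply: eq_integral => r _.
  by rewrite ger0_norm// mulr_ge0//; apply: Rintegral_ge0.
Qed.

Let H (r : measurableTypeR R) := ind (0 <= r) * ind (r < T) * (g r - A r + a0).

Let mH : measurable_fun setT H.
Proof.
have m0 : measurable_fun setT (fun r : measurableTypeR R => ind (0 <= r) : R).
  by apply: measurable_le; mfun.
have m1 : measurable_fun setT (fun r : measurableTypeR R => ind (r < T) : R).
  by apply: measurable_lt; mfun.
by rewrite /H; mfun.
Qed.

Let g_bound r : `|g r| <= \int[leb1]_s `|G s|.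
Proof.
apply: le_Rintegral_norm; [exact: iGr|exact: integrable_norm|].
by move=> s; rewrite normrM ler_piMl// normr_nat lern1 leq_b1.
Qed.

Let iH : leb1.-integrable setT (EFin \o H).
Proof.
apply: (integrable_box (D := \int[leb1]_s `|G s| + expR (lam * T) * C + `|a0|) mH).
  move=> s sI; have /andP[s0 sT] := sI; rewrite /H s0 sT !mul1r.
  apply: le_trans (ler_normD _ _) _; rewrite lerD//.
  by apply: le_trans (ler_normB _ _) _; rewrite lerD// AD.
by move=> s /nandP[|] /negbTE sI; rewrite /H sI ?mul0r// mulr0 mul0r.
Qed.

(** Read through [gE], [limit_identity] says that the primitive of [H] vanishes; at negative times
    [H] itself is zero. *)
Let H_primitive0 tau : 0 < tau < T -> \int[leb1]_(r in `]-oo, tau]) H r = 0.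
Proof.
move=> tauT; have /andP[tau0 tT] := tauT.
rewrite -Rintegral_itv_bndo_bndc; last by apply: integrableS iH => //; exact: measurable_itv.
rewrite Rintegral_mkcond.
have L := limit_identity tauT.
have [J1 J2] := itv_length 0 tau.
have mi0 : measurable_fun setT (fun r : measurableTypeR R => ind (0 <= r) : R).
  by apply: measurable_le; mfun.
have mi1 : measurable_fun setT (fun r : measurableTypeR R => ind (r < tau) : R).
  by apply: measurable_lt; mfun.
pose f1 (r : measurableTypeR R) := ind (0 <= r) * ind (r < tau) * g r.
pose f2 (r : measurableTypeR R) := ind (r < tau) * A r.
pose f3 (r : measurableTypeR R) := pos_part (tau - r) * G r.
have i1 : leb1.-integrable setT (EFin \o f1).
  apply: (integrable_box (D := \int[leb1]_s `|G s|)); first by rewrite /f1; mfun.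
    move=> s _; apply: le_trans (g_bound s).
    by rewrite /f1 normrM ler_piMl// -natrM normr_nat mulnb lern1 leq_b1.
  move=> s /nandP[/negbTE|] s0; first by rewrite /f1 s0 !mul0r.
  rewrite /f1 [s < tau]lt_neqAle; case: (leP s tau) => st; last by rewrite andbF mulr0 mul0r.
  by rewrite (le_lt_trans st tT) in s0.
have i2 : leb1.-integrable setT (EFin \o f2).
  apply: (integrable_dom (g := fun r : measurableTypeR R => `|A r|)); [by rewrite /f2; mfun|exact: integrable_norm|].
  by move=> r; rewrite normrM ler_piMl// normr_nat lern1 leq_b1.
have i3 : leb1.-integrable setT (EFin \o f3).
  apply: (integrable_box (D := T * D)).
  - apply: measurable_funM => //; apply: measurable_maxr; last exact: measurable_cst.
    by mfun.
  - move=> s /[dup] sT /andP[s0 _]; rewrite normrM ler_pM ?GD//.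
    rewrite /pos_part ger0_norm ?le_max ?lexx ?orbT// ge_max (ltW (lt_trans tau0 tT)) andbT.
    by rewrite lerBlDr (le_trans (ltW tT))// lerDl.
  - by move=> s /outside sT; rewrite /f3 /G aT// bT// mulr0 addr0 !mulr0.
have L2 : \int[leb1]_s f3 s - \int[leb1]_s f2 s + a0 * tau = 0.
  rewrite -L -RintegralB//; congr (_ + _); apply: eq_Rintegral => s _.
  by rewrite /f3 /f2; case: ifP => _; rewrite ?mul1r ?mul0r.
have L3 : \int[leb1]_s f1 s = \int[leb1]_s f3 s := gE tauT.
rewrite -L3 in L2; rewrite -L2 -[in a0 * tau](_ : \int[leb1]_r \1_(`[0, tau[%classic : set (measurableTypeR R)) r = tau); last first.
  by rewrite J2 /pos_part subr0 max_l// ltW.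
rewrite -(RintegralZl a0 measurableT J1) -RintegralB// -RintegralD//; last 2 first.
- exact: integrableB_R.
- exact: integrableZ_R.
apply: eq_Rintegral => r _; rewrite patchE /f1 /f2 indicE; case: ifPn.
  rewrite inE/= in_itv/= => rt; rewrite rt /H (lt_trans rt tT) !mulr1.
  have [r0|r0] := leP 0 r.
    by rewrite !mul1r mem_set ?mulr1//= in_itv/= r0.
  rewrite !mul0r memNset; last by rewrite /= in_itv/= leNgt r0.
  rewrite /A aT ?mulr0 ?mul1r ?mulr0 ?subr0 ?addr0//.
  by rewrite negb_and -leNgt (ltW r0).
rewrite notin_setE/= in_itv/= => /negP/negbTE rt; rewrite rt mulr0 !mul0r subr0 add0r.
by rewrite memNset ?mulr0//= in_itv/= rt andbF.
Qed.

(** A function whose primitive vanishes is zero almost everywhere, so [A = a0 + g] at almost every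
    time. Reflecting [s] into [t - s] produces [exp(- lam s)], the exponential density divided by
    [lam]; this is the origin of the factor [lam^-1] on [b]. *)
Lemma duhamel : {ae leb1, forall t : measurableTypeR R, 0 < t < T ->
  a t = expR (- lam * t) * a0 +
    \int[leb1]_s (exponential_pdf lam s * (a (t - s) + lam^-1 * b (t - s)))}.
Proof.
have locH : locally_integrable setT H.
  by apply: open_integrable_locally => //; exact: openT.
have iHy y : leb1.-integrable `]-oo, y] (EFin \o H).
  by apply: integrableS iH => //; exact: measurable_itv.
have := FTC1Ny iHy locH.
apply: (@filterS _ _ (ae_filter_ringOfSetsType leb1)) => t [_ Ht] tT.
have {Ht} : H t = 0.
  rewrite -Ht derive1E; rewrite -(derive_cst (0 : R) t (1 : R)).
  apply: near_eq_derive.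
  have /andP[t0 t1] := tT.
  near=> r; apply: H_primitive0; apply/andP; split; near: r.
    exact: lt_nbhsr.
  exact: lt_nbhsl.
have /andP[t0 t1] := tT.
rewrite /H (ltW t0) t1 !mul1r => E.
have {E} : a t = expR (- lam * t) * a0 + expR (- lam * t) * g t.
  rewrite -mulrDr addrC; have -> : g t + a0 = A t by move/eqP: E; rewrite addrAC subr_eq0 => /eqP.
  by rewrite /A mulrA -expRD mulNr addNr expR0 mul1r.
move=> ->; congr (_ + _).
rewrite /g -(RintegralZl _ measurableT (iGr t)).
have mI : measurable_fun setT (fun s : measurableTypeR R => expR (- lam * t) * (ind (s <= t) * G s)).
  by apply: measurable_funM; [exact: measurable_cst|exact: integrable_measurable (iGr t)].
rewrite -(preserving_Rintegral (preserving_reflect t) mI).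
apply: eq_Rintegral => s _; rewrite gerBl.
have [s0|s0] := leP 0 s; last by rewrite lt0_exponential_pdf// !mul0r mulr0.
rewrite exponential_pdfE// /G mul1r mulrA -expRD.
have -> : - lam * t + lam * (t - s) = - lam * s by ring.
by field; rewrite gt_eqF.
Unshelve. all: by end_near. Qed.

End duhamel.

(** * Convolution and exponential averaging *)

Section convolution.
Context {R : realType} {N : nat}.
Local Notation X := 'rV[R]_N.
Local Notation Z := (X * measurableTypeR R)%type.
Local Notation leb1 := (@lebesgue_measure R).
Local Notation lZ := (leb N \x leb1)%E.
Implicit Types k g : Z -> R.

(* The canonical sigma-finite structure on a product is hidden by the one for
   pairs of subprobabilities, hence this explicit packing. *)
Let product_sigma_finite : sigma_finite setT (lZ : {measure set Z -> \bar R}).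
Proof.
have /sigma_finiteP[F [TF ndF Foo]] := @sigma_finiteT _ X R (leb N).
have /sigma_finiteP[G [TG ndG Goo]] := @sigma_finiteT _ (measurableTypeR R) R leb1.
exists (fun n => F n `*` G n).
  rewrite -setXTT TF TG predeqE => -[x y]; split.
    move=> [/= [n _ Fnx] [k _ Gky]]; exists (maxn n k) => //; split.
    - by move: x Fnx; exact/subsetPset/ndF/leq_maxl.
    - by move: y Gky; exact/subsetPset/ndG/leq_maxr.
  by move=> [n _ []/= ? ?]; split; exists n.
move=> k; have [? ?] := Foo k; have [? ?] := Goo k.
split; first exact: measurableX.
have E : lZ (F k `*` G k) = (leb N (F k) * leb1 (G k))%E by exact: product_measure1E.
apply: (@le_lt_trans _ _ (leb N (F k) * leb1 (G k))%E); first by rewrite -E.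
by rewrite lte_mul_pinfty// ge0_fin_numE.
Qed.

Definition lebZ : set Z -> \bar R := lZ.
HB.instance Definition _ := Measure.on lebZ.
HB.instance Definition _ := Measure_isSigmaFinite.Build _ _ _ lebZ product_sigma_finite.

(** Space is correlated rather than convolved, because the tests are [rho (x - y)] with centre [y].
    In time the kernel looks backwards: [q.2] is the time elapsed. *)
Definition step (p q : Z) : Z := (p.1 + q.1, p.2 - q.2).

Definition stconv k g (p : Z) : R := \int[lZ]_q (k q * g (step p q)).

Lemma measurable_step d (T : measurableType d) (p q : T -> Z) : measurable_fun setT p ->
  measurable_fun setT q -> measurable_fun setT (fun x => step (p x) (q x)).
Proof. by move=> mp mq; rewrite /step; apply/measurable_fun_pairP; split; rewrite /comp/=; mfun. Qed.

Lemma preserving_stepl q : preserving lZ (step ^~ q).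
Proof. exact: preserving_spacetime. Qed.

Lemma preserving_stepr p : preserving lZ (step p).
Proof.
apply: (preserving_prod (g := fun x => p.1 + x) (h := fun s : measurableTypeR R => p.2 - s)).
  rewrite (_ : (fun x => _) = fun x => x + p.1); last by apply/funext => x; rewrite addrC.
  exact: preserving_leb.
exact: preserving_reflect.
Qed.

Let measurable_stepr g p : measurable_fun setT g -> measurable_fun setT (fun q => g (step p q)).
Proof. by move=> mg; exact: measurableT_comp mg (preserving_stepr p).1. Qed.

Let measurable_step2 g : measurable_fun setT g ->
  measurable_fun setT (fun pq : Z * Z => g (step pq.1 pq.2)).
Proof.
move=> mg; apply: (measurableT_comp mg); apply: measurable_step; mfun.
Qed.

Lemma measurable_conv k g : measurable_fun setT k -> measurable_fun setT g ->
  measurable_fun setT (stconv k g).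
Proof.
move=> mk mg; have := measurable_step2 mg => mg2.
apply: (measurable_Rint2 lebZ (F := fun pq => k pq.2 * g (step pq.1 pq.2))).
by mfun.
Qed.

Lemma conv_integrable k g C p : lZ.-integrable setT (EFin \o k) ->
  measurable_fun setT g -> (forall q, `|g q| <= C) ->
  lZ.-integrable setT (EFin \o (fun q => k q * g (step p q))).
Proof. by move=> ik mg gC; apply: integrableM_b ik _; [exact: measurable_stepr|]. Qed.

Lemma conv_bound k g C p : lZ.-integrable setT (EFin \o k) ->
  measurable_fun setT g -> (forall q, `|g q| <= C) ->
  `|stconv k g p| <= C * \int[lZ]_q `|k q|.
Proof.
move=> ik mg gC; rewrite -RintegralZl//; last exact: integrable_norm.
apply: le_Rintegral_norm.
- exact: conv_integrable ik mg gC.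
- by apply: integrableZ_R; exact: integrable_norm.
- by move=> q; rewrite normrM mulrC ler_wpM2r.
Qed.

Lemma tonelli_step k (G : Z * Z -> R) : measurable_fun setT k -> (forall q, 0 <= k q) ->
  measurable_fun setT G -> (forall pq, 0 <= G pq) ->
  (\int[lZ]_p \int[lZ]_q (k q * G (p, q))%:E =
   \int[lZ]_q ((k q)%:E * \int[lZ]_p (G (p, q))%:E))%E.
Proof.
move=> mk k0 mG G0.
have := @tonelli _ _ _ _ _ lebZ lebZ (fun pq => k pq.2 * G pq).
move=> H; rewrite [LHS]H; last 2 first.
- by mfun.
- by move=> pq; rewrite mulr_ge0.
by apply: eq_integral => q _; rewrite -integralZl_ge0//; mfun.
Qed.

Lemma nrm1_conv k g : measurable_fun setT k -> measurable_fun setT g ->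
  (nrm1 lZ (stconv k g) <= nrm1 lZ k * nrm1 lZ g)%E.
Proof.
move=> mk mg; have mg2 := measurable_step2 mg.
have mK : measurable_fun setT (fun q => `|k q|) by mfun.
have mG : measurable_fun setT (fun pq : Z * Z => `|g (step pq.1 pq.2)|) by mfun.
apply: (@le_trans _ _ (\int[lZ]_p \int[lZ]_q (`|k q| * `|g (step p q)|)%:E)%E).
  apply: le_integral_ge0.
  - by apply: measurable_normE; exact: measurable_conv.
  - apply: (measurable_int2 lebZ (F := fun pq => `|k pq.2| * `|g (step pq.1 pq.2)|)) => //.
    by mfun.
  - move=> p; rewrite lee_fin normr_ge0/=.
    under [leRHS]eq_integral do rewrite -normrM.
    apply: (normr_Rintegral_le lZ (f := fun q => k q * g (step p q))).
    by apply: measurable_funM; [exact: mk|exact: measurable_stepr].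
rewrite (tonelli_step mK _ mG)//.
rewrite [leRHS]muleC -ge0_integralZl//; last 2 first.
- by mfun.
- exact: nrm1_ge0.
rewrite le_eqVlt; apply/orP; left; apply/eqP; apply: eq_integral => q _.
rewrite muleC; congr (_ * _)%E.
rewrite (preserving_ge0_integral (preserving_stepl q) (f := fun p => `|g p|%:E))//.
exact: measurable_normE.
Qed.

Lemma conv_L1 k g : lZ.-integrable setT (EFin \o k) -> lZ.-integrable setT (EFin \o g) ->
  lZ.-integrable setT (EFin \o stconv k g).
Proof.
move=> ik ig; have mk := integrable_measurable ik; have mg := integrable_measurable ig.
apply/integrable_nrm1; first exact: measurable_conv.
apply: le_lt_trans (nrm1_conv mk mg) _.
by rewrite -(Rintegral_nrm1 ik) -(Rintegral_nrm1 ig) -EFinM ltry.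
Qed.

(** The tangent inequality at the mean value [r], integrated against the probability kernel; the
    linear term averages out. *)
Lemma conv_jensen k g (Phi phi : R -> R) C C' p : lZ.-integrable setT (EFin \o k) ->
  (forall q, 0 <= k q) -> \int[lZ]_q k q = 1 ->
  measurable_fun setT g -> (forall q, `|g q| <= C) ->
  measurable_fun setT (Phi \o g) -> (forall q, `|Phi (g q)| <= C') ->
  (forall a b, phi a * (b - a) <= Phi b - Phi a) ->
  Phi (stconv k g p) <= stconv k (Phi \o g) p.
Proof.
move=> ik k0 k1 mg gC mPg PgC tangent; set r := stconv k g p.
have i1 := conv_integrable p ik mg gC.
have i2 := conv_integrable p ik mPg PgC.
have -> : Phi r = \int[lZ]_q ((Phi r - phi r * r) * k q + phi r * (k q * g (step p q))).
  rewrite RintegralD//; [|exact: integrableZ_R|exact: integrableZ_R].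
  by rewrite !RintegralZl// k1 -/(stconv k g p) -/r; ring.
apply: le_Rintegral => //; first by apply: integrableD_R; exact: integrableZ_R.
move=> q _; have := ler_wpM2l (k0 q) (tangent r (g (step p q))).
by rewrite /=; lra.
Qed.

(** Tonelli puts the shift outside, and only shifts in the support of [k] then count. *)
Lemma conv_modulus k g (D : R) : lZ.-integrable setT (EFin \o k) -> (forall q, 0 <= k q) ->
  measurable_fun setT g ->
  (forall q, k q != 0 -> (nrm1 lZ (fun p => g (step p q) - g p)%R <= D%:E)%E) ->
  (\int[lZ]_p \int[lZ]_q (k q * `|g (step p q) - g p|)%:E <= (D * \int[lZ]_q k q)%:E)%E.
Proof.
move=> ik k0 mg gD; have mk := integrable_measurable ik; have mg2 := measurable_step2 mg.
have mG : measurable_fun setT (fun pq : Z * Z => `|g (step pq.1 pq.2) - g pq.1|) by mfun.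
rewrite (tonelli_step mk k0 mG)//=.
have -> : (D * \int[lZ]_q k q)%:E = (\int[lZ]_q (D * k q)%:E)%E.
  rewrite -RintegralZl// fineK//; apply: integrable_fin_num => //.
  exact: integrableZ_R.
apply: ge0_le_integral => //.
- by move=> q _; rewrite mule_ge0 ?lee_fin//; exact: nrm1_ge0.
- apply: emeasurable_funM; first by mfun.
  exact: (measurable_int1 lebZ (F := fun pq : Z * Z => `|g (step pq.1 pq.2) - g pq.1|)).
- by mfun.
- move=> q _; have [->|kq] := eqVneq (k q) 0; first by rewrite mulr0 mul0e.
  by rewrite mulrC EFinM lee_wpmul2l ?lee_fin//; exact: gD.
Qed.

Section product_kernel.
Variables (rho : X -> R) (K : measurableTypeR R -> R).
Hypothesis irho : (leb N).-integrable setT (EFin \o rho).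
Hypothesis iK : leb1.-integrable setT (EFin \o K).

Definition kern (q : Z) : R := rho q.1 * K q.2.

Let mrho : measurable_fun setT rho. Proof. exact: integrable_measurable irho. Qed.
Let mK : measurable_fun setT K. Proof. exact: integrable_measurable iK. Qed.

Lemma measurable_kern : measurable_fun setT kern.
Proof. by rewrite /kern; mfun. Qed.

Let kern_lty : (\int[leb N]_x \int[leb1]_s `|kern (x, s)|%:E < +oo)%E.
Proof.
have -> : (\int[leb N]_x \int[leb1]_s `|kern (x, s)|%:E =
    \int[leb N]_x (\int[leb1]_s `|K s| * `|rho x|)%:E)%E.
  apply: eq_integral => x _; rewrite /kern mulrC EFinM Rintegral_nrm1// /nrm1.
  rewrite -integralZl_ge0//; last by mfun.
  by apply: eq_integral => s _; rewrite normrM.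
have iZ := integrableZ_R (\int[leb1]_s `|K s|) (integrable_norm irho).
have mZ := integrable_measurable iZ.
apply: le_lt_trans ((integrable_nrm1 (leb N) mZ).1 iZ).
rewrite le_eqVlt; apply/orP; left; apply/eqP; apply: eq_integral => x _.
have K0 : 0 <= \int[leb1]_s `|K s| by exact: Rintegral_ge0.
by rewrite [in RHS]ger0_norm// mulr_ge0//=.
Qed.

Lemma kern_integrable : lZ.-integrable setT (EFin \o kern).
Proof.
have mk := measurable_kern; have mkE : measurable_fun setT (EFin \o kern) by mfun.
exact: (integrable12ltyP (leb N) leb1 mkE).2.
Qed.

Lemma integral_kern : \int[lZ]_q kern q = \int[leb N]_x rho x * \int[leb1]_s K s.
Proof.
rewrite (Rintegral_prod (m1 := leb N) (m2 := leb1) (F := kern)) => [| | |]; last 3 first.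
- exact: measurable_kern.
- by move=> x; exact: (integrableZ_R (rho x) iK).
- by [].
rewrite mulrC -RintegralZl//; apply: eq_Rintegral => x _.
by rewrite /kern/= RintegralZl// mulrC.
Qed.

Lemma conv_kern g C p : measurable_fun setT g -> (forall q, `|g q| <= C) ->
  stconv kern g p = \int[leb1]_s (K s * \int[leb N]_x (rho x * g (p.1 + x, p.2 - s))).
Proof.
move=> mg gC; rewrite /stconv Rintegral_prod_ae2/=; last exact: conv_integrable kern_integrable mg gC.
apply: eq_Rintegral => s _; rewrite -RintegralZl//; last first.
  by apply: (integrableM_b (C := C)) => //; mfun.
by apply: eq_Rintegral => x _; rewrite /kern/= mulrA [_ * K s]mulrC.
Qed.

End product_kernel.

End convolution.

Section ae_exchange.
Context d1 d2 (T1 : measurableType d1) (T2 : measurableType d2) (R : realType).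
Variables (m1 : {sigma_finite_measure set T1 -> \bar R})
  (m2 : {sigma_finite_measure set T2 -> \bar R}).

Lemma ae_sections (F : T1 * T2 -> R) : measurable_fun setT F ->
  (\int[m1 \x m2]_p `|F p|%:E = 0)%E ->
  {ae m2, forall y, {ae m1, forall x, F (x, y) = 0}}.
Proof.
move=> mF H; have mn : measurable_fun setT (fun p => `|F p|) by mfun.
have m1F := measurable_int1 m1 mn (fun p => normr_ge0 _).
have := (ae_eq_integral_abs m2 measurableT m1F).1.
rewrite (_ : (\int[m2]_x _ = 0)%E); last first.
  have E : (\int[m2]_y \int[m1]_x `|F (x, y)|%:E = 0)%E.
    rewrite -H (@fubini_tonelli2 _ _ _ _ _ m1 m2 (fun p => `|F p|%:E))//; mfun.
  rewrite -[RHS]E; apply: eq_integral => y _; rewrite gee0_abs//.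
  by apply: integral_ge0 => x _; rewrite lee_fin.
move=> /(_ erefl); apply: filterS => y /(_ I) /= E.
have mFy : measurable_fun setT (fun x => (F (x, y))%:E) by mfun.
have := (ae_eq_integral_abs m1 measurableT mFy).1 E.
by apply: filterS => x /(_ I) [].
Qed.

(** The exceptional set of [y] may depend on [x]; joint measurability and Tonelli exchange the two
    quantifiers. The equation is tested at a fixed centre in space, whereas the energy estimate
    works at a fixed time. *)
Lemma ae_exchange (F : T1 * T2 -> R) : measurable_fun setT F ->
  (forall x, {ae m2, forall y, F (x, y) = 0}) ->
  {ae m2, forall y, {ae m1, forall x, F (x, y) = 0}}.
Proof.
move=> mF F0; apply: ae_sections => //.
rewrite (@fubini_tonelli1 _ _ _ _ _ m1 m2 (fun p => `|F p|%:E))//; last by mfun.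
apply: integral0_eq => x _.
have mFx : measurable_fun setT (fun y => (F (x, y))%:E) by mfun.
apply: (ae_eq_integral_abs m2 measurableT mFx).2.
by apply: filterS (F0 x) => y /= -> _.
Qed.

End ae_exchange.

Section space_convolution.
Context {R : realType} {N : nat}.
Local Notation X := 'rV[R]_N.
Local Notation Z := (X * measurableTypeR R)%type.
Local Notation leb1 := (@lebesgue_measure R).
Local Notation lZ := (leb N \x leb1)%E.

Implicit Types (r : X -> R) (g : Z -> R).

Definition xconv (r : X -> R) (g : Z -> R) (p : Z) : R :=
  \int[leb N]_x (r x * g (p.1 + x, p.2)).

Let measurable_shift2 (g : Z -> R) : measurable_fun setT g ->
  measurable_fun setT (fun px : Z * X => g (px.1.1 + px.2, px.1.2)).
Proof. by move=> mg; mfun. Qed.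

Lemma measurable_xconv r g : measurable_fun setT r -> measurable_fun setT g ->
  measurable_fun setT (xconv r g).
Proof.
move=> mr mg; have mg2 := measurable_shift2 mg.
by apply: (measurable_Rint2 (leb N) (F := fun px : Z * X => r px.2 * g (px.1.1 + px.2, px.1.2))); mfun.
Qed.

Lemma xconv_integrable r g C p : (leb N).-integrable setT (EFin \o r) ->
  measurable_fun setT g -> (forall q, `|g q| <= C) ->
  (leb N).-integrable setT (EFin \o (fun x => r x * g (p.1 + x, p.2))).
Proof. by move=> ir mg gC; apply: integrableM_b ir _; [mfun|]. Qed.

Lemma xconv_bound r g C p : (leb N).-integrable setT (EFin \o r) ->
  measurable_fun setT g -> (forall q, `|g q| <= C) ->
  `|xconv r g p| <= C * \int[leb N]_x `|r x|.
Proof.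
move=> ir mg gC; rewrite -RintegralZl//; last exact: integrable_norm.
apply: le_Rintegral_norm.
- exact: xconv_integrable ir mg gC.
- by apply: integrableZ_R; exact: integrable_norm.
- by move=> q; rewrite normrM mulrC ler_wpM2r.
Qed.

Lemma nrm1_xconv r g : (leb N).-integrable setT (EFin \o r) ->
  lZ.-integrable setT (EFin \o g) -> (nrm1 lZ (xconv r g) <= nrm1 (leb N) r * nrm1 lZ g)%E.
Proof.
move=> ir ig; have mr := integrable_measurable ir; have mg := integrable_measurable ig.
have mg2 := measurable_shift2 mg.
have mF : measurable_fun setT (fun px : Z * X => `|r px.2 * g (px.1.1 + px.2, px.1.2)|).
  by mfun.
apply: (@le_trans _ _ (\int[lZ]_p \int[leb N]_x `|r x * g (p.1 + x, p.2)%R|%:E)%E).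
  apply: le_integral_ge0.
  - by apply: measurable_normE; exact: measurable_xconv.
  - exact: (measurable_int2 (leb N) mF).
  - move=> p; rewrite lee_fin normr_ge0/=.
    by apply: (normr_Rintegral_le (leb N) (f := fun x => r x * g (p.1 + x, p.2))); mfun.
have := @tonelli _ _ _ _ _ lebZ (leb N) _ mF (fun=> normr_ge0 _).
move=> H; rewrite [leLHS]H {H}.
rewrite [leRHS]muleC -ge0_integralZl//; [|by mfun|exact: nrm1_ge0].
rewrite le_eqVlt; apply/orP; left; apply/eqP; apply: eq_integral => x _.
have mgx : measurable_fun setT (fun p : Z => g (p.1 + x, p.2)) by mfun.
transitivity (\int[lZ]_p (`|r x| * `|g (p.1 + x, p.2)%R|)%:E)%E.
  by apply: eq_integral => p _; rewrite normrM.
rewrite integralZl_ge0//; last by mfun.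
rewrite muleC; congr (_ * _)%E.
rewrite /nrm1 -(preserving_ge0_integral (preserving_spacetime x 0) (f := fun p => `|g p|%:E))//; last first.
  exact: measurable_normE.
by apply: eq_integral => p _; rewrite addr0.
Qed.

Lemma xconv_L1 r g : (leb N).-integrable setT (EFin \o r) ->
  lZ.-integrable setT (EFin \o g) -> lZ.-integrable setT (EFin \o xconv r g).
Proof.
move=> ir ig; have mr := integrable_measurable ir; have mg := integrable_measurable ig.
apply/integrable_nrm1; first exact: measurable_xconv.
apply: le_lt_trans (nrm1_xconv ir ig) _.
by rewrite -(Rintegral_nrm1 ir) -(Rintegral_nrm1 ig) -EFinM ltry.
Qed.

Lemma xconv_modulus r g (D : R) : (leb N).-integrable setT (EFin \o r) -> (forall x, 0 <= r x) ->
  measurable_fun setT g ->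
  (forall x, r x != 0 -> (nrm1 lZ (fun p => g (p.1 + x, p.2) - g p)%R <= D%:E)%E) ->
  (\int[lZ]_p \int[leb N]_x (r x * `|g (p.1 + x, p.2) - g p|)%:E <= (D * \int[leb N]_x r x)%:E)%E.
Proof.
move=> ir r0 mg gD; have mr := integrable_measurable ir; have mg2 := measurable_shift2 mg.
have mG : measurable_fun setT (fun px : Z * X => `|g (px.1.1 + px.2, px.1.2) - g px.1|).
  by mfun.
have mF : measurable_fun setT (fun px : Z * X => r px.2 * `|g (px.1.1 + px.2, px.1.2) - g px.1|).
  by mfun.
have F0 (px : Z * X) : 0 <= r px.2 * `|g (px.1.1 + px.2, px.1.2) - g px.1|.
  by rewrite mulr_ge0.
have H := @tonelli _ _ _ _ _ lebZ (leb N) _ mF F0.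
rewrite [leLHS]H {H} -RintegralZl// /Rintegral fineK; last first.
  by apply: integrable_fin_num => //; exact: integrableZ_R.
apply: le_integral_ge0; first exact: (measurable_int1 lebZ mF F0).
  by mfun.
move=> x; apply/andP; split.
  by apply: integral_ge0 => p _; rewrite lee_fin.
have -> : (\int[lebZ]_p (r (p, x).2 * `|g ((p, x).1.1 + (p, x).2, (p, x).1.2)%R - g (p, x).1|)%:E =
    (r x)%:E * nrm1 lZ (fun p => g (p.1 + x, p.2) - g p)%R)%E.
  have mgx : measurable_fun setT (fun p : Z => g (p.1 + x, p.2)) by mfun.
  rewrite /nrm1 -integralZl_ge0//.
  by apply: measurableT_comp => //; exact: measurable_funB.
have [->|rx] := eqVneq (r x) 0; first by rewrite mulr0 mul0e.
by rewrite mulrC EFinM lee_wpmul2l ?lee_fin//; exact: gD.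
Qed.

Lemma conv_kern_xconv r (K : measurableTypeR R -> R) g C p :
  (leb N).-integrable setT (EFin \o r) -> leb1.-integrable setT (EFin \o K) ->
  measurable_fun setT g -> (forall q, `|g q| <= C) ->
  stconv (kern r K) g p = \int[leb1]_s (K s * xconv r g (p.1, p.2 - s)).
Proof. by move=> ir iK mg gC; rewrite (conv_kern ir iK _ mg gC). Qed.

Lemma kern_conv_translate r (K : measurableTypeR R -> R) g (z : X) p :
  measurable_fun setT r -> measurable_fun setT K -> measurable_fun setT g ->
  stconv (kern r K) g (p.1 + z, p.2) =
  \int[lZ]_q (r (q.1 - z) * K q.2 * g (step p q)).
Proof.
move=> mr mK mg.
have ms : measurable_fun setT (fun q => g (step p q)) by exact: measurableT_comp mg (preserving_stepr p).1.
rewrite -(preserving_Rintegral (preserving_spacetime z 0)); last by mfun.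
apply: eq_Rintegral => q _; rewrite /kern /step/= addr0 addrK.
by rewrite -addrA [z + _]addrC.
Qed.

(** A translation of the convolution in space becomes the opposite translation of the kernel, and
    evenness of the measure turns [- z] back into [z]. The unbounded operator thus acts on the
    smooth [rho] only. *)
Lemma Lop_conv (nu : {finite_measure set X -> \bar R}) r (K : measurableTypeR R -> R) g B C p :
  preserving nu (-%R : X -> X) ->
  (leb N).-integrable setT (EFin \o r) -> (forall x, `|r x| <= B) ->
  leb1.-integrable setT (EFin \o K) ->
  measurable_fun setT g -> (forall q, `|g q| <= C) ->
  Lop nu (fun y => stconv (kern r K) g (y, p.2)) p.1 = stconv (kern (Lop nu r) K) g p.
Proof.
move=> pnu ir rB iK mg gC.
have mr := integrable_measurable ir; have mK := integrable_measurable iK.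
have ms : measurable_fun setT (fun q => g (step p q)) by exact: measurableT_comp mg (preserving_stepr p).1.
pose F (zq : X * Z) := (r (zq.2.1 - zq.1) - r zq.2.1) * (K zq.2.2 * g (step p zq.2)).
have mF : measurable_fun setT F by rewrite /F /step; mfun.
have irz z : (leb N).-integrable setT (EFin \o (fun x => r (x - z) - r x)).
  apply: integrableB_R => //.
  exact: (preserving_integrable (preserving_leb (- z)) ir).
have E1 z q : F (z, q) = kern (fun x => r (x - z) - r x) K q * g (step p q).
  by rewrite /F/= /kern mulrA.
have iF z : lZ.-integrable setT (fun q => (F (z, q))%:E).
  under eq_fun do rewrite E1.
  exact: (conv_integrable p (kern_integrable (irz z) iK) mg gC).
transitivity (\int[nu]_z \int[lZ]_q F (z, q)).
  apply: eq_Rintegral => z _; rewrite (kern_conv_translate z p mr mK mg) /stconv.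
  rewrite -RintegralB//.
  - by apply: eq_Rintegral => q _; rewrite /F /kern/=; ring.
  - have irz' := preserving_integrable (preserving_leb (- z)) ir.
    exact: (conv_integrable p (kern_integrable irz' iK) mg gC).
  - by have := conv_integrable p (kern_integrable ir iK) mg gC; rewrite -surjective_pairing.
have := @Rfubini _ _ _ _ _ nu lebZ F mF.
move=> ->.
- apply: eq_Rintegral => q _; rewrite /F/= RintegralZr//; last first.
    apply: (@finite_integrable _ _ nu _ (B + B)) => [|z]; first by mfun.
    by apply: le_trans (ler_normB _ _) _; rewrite lerD.
  rewrite /kern mulrA; congr (_ * _ * _).
  by rewrite /Lop -(preserving_Rintegral pnu)//; mfun.
- exact: iF.
- move=> q; apply: (@finite_integrable _ _ nu _ ((B + B) * `|K q.2 * g (step p q)|)) => [|z].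
    by mfun.
  rewrite /F/= normrM ler_wpM2r//.
  by apply: le_trans (ler_normB _ _) _; rewrite lerD.
- have C0 : 0 <= C by exact: le_trans (gC p).
  pose D := C * ((\int[leb N]_x `|r x| + \int[leb N]_x `|r x|) * \int[leb1]_s `|K s|).
  apply: (@le_lt_trans _ _ (\int[nu]_z D%:E)%E); last first.
    rewrite integral_cst//.
    by rewrite -[X in (_ * X)%E](fineK (fin_num_measure nu _ measurableT)) -EFinM ltry.
  apply: le_integral_ge0 => //.
    by apply: (measurable_int2 lebZ (F := fun p => `|F p|)) => //; mfun.
  move=> z; rewrite integral_ge0/=; last by move=> q _; rewrite lee_fin.
  have iFn : lZ.-integrable setT (EFin \o (fun q => F (z, q))) by exact: iF.
  rewrite -[leLHS](Rintegral_nrm1 iFn) lee_fin.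
  have ink := integrable_norm (kern_integrable (irz z) iK).
  apply: (@le_trans _ _ (C * \int[lZ]_q `|kern (fun x => r (x - z) - r x) K q|)).
    rewrite -RintegralZl//; apply: le_Rintegral => //.
    + exact: integrable_norm.
    + exact: integrableZ_R.
    + by move=> q _; rewrite E1 normrM mulrC ler_wpM2r.
  rewrite ler_wpM2l//.
  have -> : \int[lZ]_q `|kern (fun x => r (x - z) - r x) K q| =
      \int[lZ]_q kern (fun x => `|r (x - z) - r x|) (fun s => `|K s|) q.
    by apply: eq_Rintegral => q _; rewrite /kern normrM.
  rewrite integral_kern; [|exact: integrable_norm..].
  rewrite ler_wpM2r//; first exact: Rintegral_ge0.
  have E : \int[leb N]_x `|r (x - z)| = \int[leb N]_x `|r x|.
    by apply: (preserving_Rintegral (preserving_leb (- z)) (f := fun x => `|r x|)); mfun.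
  have irz' := preserving_integrable (preserving_leb (- z)) ir.
  rewrite -{1}E -RintegralD//; [|exact: integrable_norm..].
  apply: le_Rintegral => //; first exact: integrable_norm.
    by apply: integrableD_R; exact: integrable_norm.
  by move=> x _; exact: ler_normB.
Qed.

End space_convolution.

(** * The mollified equation as a resolvent identity *)

Section mollified_equation.
Context {R : realType} {N : nat}.
Local Notation X := 'rV[R]_N.
Local Notation Z := (X * measurableTypeR R)%type.
Local Notation leb1 := (@lebesgue_measure R).
Local Notation lZ := (leb N \x leb1)%E.
Variable mu : {measure set X -> \bar R}.
Hypothesis mu_even : even_measure mu.
Hypothesis mu_levy : levy_integrable mu.
Variables (rho : X -> R) (e : R).
Hypothesis grho : gen rho.
Hypothesis rho_supp : forall x, rho x != 0 -> cube e x.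
Hypothesis rho_ge0 : forall x, 0 <= rho x.
Hypothesis rho1 : (\int[leb N]_x (rho x)%:E = 1)%E.

Local Notation nu := (nu mu_levy).
Local Notation Lrho := (levy_op mu rho).

Lemma measurable_rho : measurable_fun setT rho.
Proof. by apply: continuous_measurable_rV; exact: gen_continuous. Qed.

Lemma rho_integrable : (leb N).-integrable setT (EFin \o rho).
Proof.
apply/integrable_nrm1; first exact: measurable_rho.
by rewrite /nrm1; under eq_integral do rewrite ger0_norm//; rewrite rho1 ltry.
Qed.

Lemma integral_rho : \int[leb N]_x rho x = 1.
Proof. by rewrite /Rintegral rho1. Qed.

Let Lrho_cvg x : (fun k => Lop (nu k) rho x) @ \oo --> Lrho x.
Proof.
have [C C0 HC] := levy_truncation mu_even mu_levy grho rho_supp.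
apply/cvgrPdist_le => r r0; near=> k.
apply: le_trans (HC k x) _.
apply: (@le_trans _ _ (`|C * near_mass mu k|)).
  apply: le_trans (ler_norm _) _; rewrite normrM ler_piMr// indicE normr_nat.
  by rewrite lern1 leq_b1.
near: k; have : (fun k => C * near_mass mu k) @ \oo --> 0.
  rewrite -(mulr0 C); apply: cvgM; [exact: cvg_cst|exact: near_mass_cvg].
move=> /cvgrPdist_le /(_ r r0); apply: filterS => k.
by rewrite sub0r normrN.
Unshelve. all: by end_near. Qed.

(** The truncated operators depend measurably on the point, and they converge pointwise. *)
Lemma measurable_Lrho : measurable_fun setT Lrho.
Proof.
apply: (measurable_fun_cvg_lim _ Lrho_cvg) => k.
by apply: measurable_Lop; exact: measurable_rho.
Qed.

(** The distance is taken in L1 because [w] is only bounded: the error made on a convolution with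
    [w] is at most a bound of [w] times this number, uniformly in space and time. *)
Definition truncation_error k : R := \int[leb N]_x `|Lop (nu k) rho x - Lrho x|.

Let trunc_diff : exists2 C : R, 0 <= C & forall k,
  (leb N).-integrable setT (EFin \o (fun x => Lop (nu k) rho x - Lrho x)) /\
  truncation_error k <= C * near_mass mu k.
Proof.
have [C C0 HC] := levy_truncation mu_even mu_levy grho rho_supp.
have mc : measurable (cube (e + 1) : set X) by exact: measurable_cube.
have cfin : leb N (cube (e + 1)) \is a fin_num.
  by rewrite ge0_fin_numE//; exact: leb_box_lty.
have ic : (leb N).-integrable setT (EFin \o (\1_(cube (e + 1)) : X -> R)).
  apply/integrable_nrm1; first exact: measurable_indic.
  rewrite /nrm1; under eq_integral do rewrite ger0_norm//.
  by rewrite integral_indic// setIT -ge0_fin_numE.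
exists (C * fine (leb N (cube (e + 1)))) => [|k]; first by rewrite mulr_ge0// fine_ge0.
have b x : `|Lop (nu k) rho x - Lrho x| <= C * near_mass mu k * \1_(cube (e + 1)) x.
  by rewrite distrC.
have iD : (leb N).-integrable setT (EFin \o (fun x => Lop (nu k) rho x - Lrho x)).
  apply: (integrable_dom _ (integrableZ_R (C * near_mass mu k) ic) b).
  apply: measurable_funB; last exact: measurable_Lrho.
  by apply: measurable_Lop; exact: measurable_rho.
split => //; rewrite /truncation_error.
apply: (@le_trans _ _ (\int[leb N]_x (C * near_mass mu k * \1_(cube (e + 1)) x))).
  apply: le_Rintegral => //; first exact: integrable_norm.
  exact: integrableZ_R.
rewrite RintegralZl// /Rintegral integral_indic// setIT.
by rewrite mulrAC.
Qed.

Lemma truncation_error_cvg : truncation_error @ \oo --> 0.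
Proof.
have [C C0 HC] := trunc_diff.
have H : (fun k => C * near_mass mu k) @ \oo --> 0.
  rewrite -(mulr0 C); apply: cvgM; [exact: cvg_cst|exact: near_mass_cvg].
apply: (squeeze_cvgr _ (cvg_cst 0) H); apply: nearW => k.
by have [_ ->] := HC k; rewrite andbT; exact: Rintegral_ge0.
Qed.

Lemma Lop_Lrho_integrable k :
  (leb N).-integrable setT (EFin \o (fun x => Lop (nu k) rho x - Lrho x)).
Proof. by have [C _ /(_ k)[]] := trunc_diff. Qed.

Lemma Lrho_integrable : (leb N).-integrable setT (EFin \o Lrho).
Proof.
have := integrableB_R (Lop_integrable (nu 0) rho_integrable) (Lop_Lrho_integrable 0).
by under eq_fun do rewrite opprB addrCA subrr addr0.
Qed.

Let rho_bounded : exists B : R, forall x, `|rho x| <= B.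
Proof. exact: gen_supp_bounded grho rho_supp. Qed.

Section evolution.
Variables (ut w : Z -> R) (u0 : X -> R) (C T lam : R).
Hypothesis lam0 : 0 < lam.
Hypothesis T0 : 0 < T.
Hypothesis iut : lZ.-integrable setT (EFin \o ut).
Hypothesis mw : measurable_fun setT w.
Hypothesis utC : forall p, `|ut p| <= C.
Hypothesis wC : forall p, `|w p| <= C.
Hypothesis utT : forall p : Z, ~~ (0 < p.2 < T) -> ut p = 0.
Hypothesis wT : forall p : Z, ~~ (0 < p.2 < T) -> w p = 0.
Hypothesis w_dom : forall d, 0 < d -> exists2 D, 0 <= D & forall p, `|w p| <= d + D * `|ut p|.
Hypothesis iu0 : (leb N).-integrable setT (EFin \o u0).
Hypothesis weak : forall (y : X) tau n, 0 < tau < T ->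
  \int[lZ]_p (ut p * (rho (p.1 - y) * time_test' lam tau n p.2) +
              w p * (Lrho (p.1 - y) * time_test lam tau n p.2)) +
    \int[leb N]_x (u0 x * rho (x - y)) * time_test lam tau n 0 = 0.

Let E : measurableTypeR R -> R := exponential_pdf lam.

Let iE : leb1.-integrable setT (EFin \o E).
Proof. exact: integrable_exponential_pdf. Qed.

Let E_ge0 s : 0 <= E s.
Proof. by apply: exponential_pdf_ge0; exact: ltW. Qed.

Let int_E : \int[leb1]_s E s = 1.
Proof. by rewrite /Rintegral integral_exponential_pdf. Qed.

Let mE : measurable_fun setT E. Proof. exact: integrable_measurable iE. Qed.
Let mut : measurable_fun setT ut. Proof. exact: integrable_measurable iut. Qed.
Let mrho := measurable_rho.
Let mLrho := measurable_Lrho.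
Let irho := rho_integrable.
Let iLrho := Lrho_integrable.

Let C0 : 0 <= C.
Proof. by apply: le_trans (utC (0, 0)). Qed.

(** Makes any continuous time factor integrable, harmlessly so, since the functions it multiplies
    vanish outside (0, T). *)
Let cut (h : R -> R) (s : measurableTypeR R) := h s * \1_(`[0, T]%classic : set (measurableTypeR R)) s.

Let cut_integrable h : continuous h -> leb1.-integrable setT (EFin \o cut h).
Proof.
move=> ch; have : leb1.-integrable `[0, T] (EFin \o h).
  apply: continuous_compact_integrable; first exact: segment_compact.
  exact: continuous_subspaceT.
rewrite integrable_mkcond//.
rewrite restrict_EFin; congr (integrable _ _ (EFin \o _)).
apply/funext => s; rewrite patchE /cut indicE; case: ifP => _; by rewrite ?mulr1 ?mulr0.
Qed.

Let cutE h s : 0 < s < T -> cut h s = h s.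
Proof.
move=> /andP[s0 sT]; rewrite /cut indicE mem_set ?mulr1//=.
by rewrite in_itv/= !ltW.
Qed.

Let continuous_test' tau n : continuous (time_test' lam tau n).
Proof.
have -> : time_test' lam tau n = 'D_1 (time_test lam tau n).
  by apply/funext => s; rewrite -derive1_time_test derive1E.
by apply: gen_continuous; apply: gen_derive; exact: time_test_gen.
Qed.

Let continuous_test tau n : continuous (time_test lam tau n).
Proof. by apply: gen_continuous; exact: time_test_gen. Qed.

(** Against a product of a space factor and a time factor, integrating in space first leaves [xconv]
    on each time slice. The weak form thereby becomes one on the time line for each centre [y]. *)
Let slab (r : X -> R) h (g : Z -> R) y : (leb N).-integrable setT (EFin \o r) ->
  continuous h -> measurable_fun setT g -> (forall p, `|g p| <= C) ->
  (forall p : Z, ~~ (0 < p.2 < T) -> g p = 0) ->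
  [/\ lZ.-integrable setT (EFin \o (fun p => g p * (r (p.1 - y) * h p.2))),
  forall s, (leb N).-integrable setT (EFin \o (fun x => g (x, s) * (r (x - y) * h s))) &
  forall s, \int[leb N]_x (g (x, s) * (r (x - y) * h s)) = h s * xconv r g (y, s)].
Proof.
move=> ir ch mg gC gT; have mr := integrable_measurable ir.
have iry := preserving_integrable (preserving_leb (- y)) ir.
have ik := kern_integrable iry (cut_integrable ch).
split.
  rewrite (_ : (fun p => _) = fun p => kern (r \o +%R^~ (- y)) (cut h) p * g p).
    exact: integrableM_b ik gC.
  apply/funext => p; rewrite [RHS]mulrC; have [pT|/gT ->] := boolP (0 < p.2 < T).
    by rewrite /kern cutE.
  by rewrite !mul0r.
  move=> s; apply: (integrable_bM (C := C)) => //; first by mfun.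
  under eq_fun do rewrite mulrC; exact: integrableZ_R.
move=> s; rewrite /xconv -RintegralZl//; last first.
  exact: (xconv_integrable (y, s) ir mg gC).
rewrite -[LHS](preserving_Rintegral (preserving_leb y)); last by mfun.
apply: eq_Rintegral => x _; rewrite addrK /= [x + y]addrC; ring.
Qed.

Let a0 (y : X) := \int[leb N]_x (rho x * u0 (y + x)).

Let a0E y : \int[leb N]_x (u0 x * rho (x - y)) = a0 y.
Proof.
have mu0 := integrable_measurable iu0.
rewrite -[LHS](preserving_Rintegral (preserving_leb y)); last by mfun.
by apply: eq_Rintegral => x _; rewrite addrK mulrC addrC.
Qed.

Let weak_time y tau n : 0 < tau < T ->
  \int[leb1]_s (time_test' lam tau n s * xconv rho ut (y, s) +
    time_test lam tau n s * xconv Lrho w (y, s)) + a0 y * time_test lam tau n 0 = 0.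
Proof.
move=> tT; apply: etrans (weak y n tT); rewrite a0E; congr (_ + _).
have [i1 j1 F1] := slab y irho (@continuous_test' tau n) mut utC utT.
have [i2 j2 F2] := slab y iLrho (@continuous_test tau n) mw wC wT.
rewrite Rintegral_prod_ae2; last exact: integrableD_R.
apply: eq_Rintegral => s _ /=.
by rewrite -F1 -F2 -RintegralD.
Qed.

Let v := stconv (kern rho E) w.

(** Duhamel's formula at a fixed centre; the null set of excluded times depends on [y]. *)
Let space_time_identity y : {ae leb1, forall t : measurableTypeR R, 0 < t < T ->
  xconv rho ut (y, t) = expR (- lam * t) * a0 y +
    (stconv (kern rho E) ut (y, t) + lam^-1 * stconv (kern Lrho E) w (y, t))}.
Proof.
pose C' := C * \int[leb N]_x `|rho x| + C * \int[leb N]_x `|Lrho x|.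
have := @duhamel R lam T (a0 y) (fun s => xconv rho ut (y, s)) (fun s => xconv Lrho w (y, s)) C' lam0.
have mx1 : measurable_fun setT (fun s : measurableTypeR R => xconv rho ut (y, s)).
  have := measurable_xconv mrho mut => mx; by mfun.
have mx2 : measurable_fun setT (fun s : measurableTypeR R => xconv Lrho w (y, s)).
  have := measurable_xconv mLrho mw => mx; by mfun.
have i1 : 0 <= C * \int[leb N]_x `|rho x| by rewrite mulr_ge0//; exact: Rintegral_ge0.
have i2 : 0 <= C * \int[leb N]_x `|Lrho x| by rewrite mulr_ge0//; exact: Rintegral_ge0.
have b1 s : `|xconv rho ut (y, s)| <= C * \int[leb N]_x `|rho x|.
  exact: xconv_bound irho mut utC.
have b2 s : `|xconv Lrho w (y, s)| <= C * \int[leb N]_x `|Lrho x|.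
  exact: xconv_bound iLrho mw wC.
move=> /(_ mx1 mx2) D.
have {}D := D _ _ _ _ (fun tau n => @weak_time y tau n).
apply: filterS (D _ _ _ _).
- move=> t H tT; rewrite (H tT); congr (_ + _).
  rewrite (conv_kern_xconv _ irho iE mut utC) (conv_kern_xconv _ iLrho iE mw wC)/=.
  have ms1 : measurable_fun setT (fun s : measurableTypeR R => xconv rho ut (y, t - s)).
    by apply: (measurableT_comp mx1); mfun.
  have ms2 : measurable_fun setT (fun s : measurableTypeR R => xconv Lrho w (y, t - s)).
    by apply: (measurableT_comp mx2); mfun.
  have j1 := integrableM_b ms1 iE (fun s => b1 (t - s)).
  have j2 := integrableM_b ms2 iE (fun s => b2 (t - s)).
  rewrite -RintegralZl// -RintegralD//; last exact: integrableZ_R.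
  by apply: eq_Rintegral => s _; rewrite mulrDr [in RHS]mulrCA.
- by move=> s; rewrite (le_trans (b1 s))// lerDl.
- by move=> s; rewrite (le_trans (b2 s))// lerDr.
- move=> s sT; rewrite /xconv; under eq_Rintegral do rewrite utT// mulr0.
  by rewrite Rintegral_cst// mul0r.
- move=> s sT; rewrite /xconv; under eq_Rintegral do rewrite wT// mulr0.
  by rewrite Rintegral_cst// mul0r.
Qed.

Let I01 : set (measurableTypeR R) := `]0, T[%classic.

Let mI : measurable_fun setT (\1_I01 : measurableTypeR R -> R).
Proof. by apply: measurable_indic; exact: measurable_itv. Qed.

Let decay (s : measurableTypeR R) : R := expR (- lam * s) * \1_I01 s.

Let idecay : leb1.-integrable setT (EFin \o decay).
Proof.
have c : continuous (fun s : R => expR (- lam * s)).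
  move=> s; apply: continuous_comp; last exact: continuous_expR.
  by apply: cvgM; [exact: cvg_cst|exact: cvg_id].
apply: (integrable_dom _ (integrable_norm (cut_integrable c))).
  by apply: measurable_funM => //; mfun.
move=> s; rewrite /decay/= [in leRHS]normrM normrM ler_wpM2l// !indicE ler_norml.
have [sI|_] := boolP (s \in I01).
  rewrite mem_set; first by rewrite normr1 lexx (le_trans (lerN10 _)).
  by move: sI; rewrite inE/= !in_itv/= => /andP[/ltW -> /ltW ->].
by rewrite normr_ge0 andbT oppr_le0.
Qed.

(* [U - xconv rho ut] is [-1/lam] times the time average of the (formal)
   operator applied to the mollified [w]. *)
Definition averaged (p : Z) : R := xconv rho (fun q => u0 q.1 * decay q.2) p +
  \1_I01 p.2 * stconv (kern rho (exponential_pdf lam)) ut p.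

Definition potential (p : Z) : R := stconv (kern rho (exponential_pdf lam)) w p.

Definition dissipation (p : Z) : R := lam * (averaged p - xconv rho ut p).

Let ig0 : lZ.-integrable setT (EFin \o (fun q : Z => u0 q.1 * decay q.2)).
Proof. exact: (kern_integrable iu0 idecay). Qed.

Let ikE : lZ.-integrable setT (EFin \o kern rho E).
Proof. exact: kern_integrable irho iE. Qed.

Lemma averaged_integrable : lZ.-integrable setT (EFin \o averaged).
Proof.
apply: integrableD_R; first exact: xconv_L1 irho ig0.
apply: (integrable_bM (C := 1)); [by mfun|exact: conv_L1 ikE iut|].
by move=> p; rewrite indicE normr_nat lern1 leq_b1.
Qed.

Lemma dissipation_integrable : lZ.-integrable setT (EFin \o dissipation).
Proof.
apply: integrableZ_R; apply: integrableB_R; first exact: averaged_integrable.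
exact: xconv_L1 irho iut.
Qed.

Lemma averaged_out p : ~~ (0 < p.2 < T) -> averaged p = 0.
Proof.
move=> pT; have I0 : \1_I01 p.2 = 0 :> R.
  by rewrite indicE memNset//= /I01/= in_itv/=; exact/negP.
rewrite /averaged I0 mul0r addr0 /xconv /decay/=.
under eq_Rintegral do rewrite I0 !mulr0.
by rewrite Rintegral_cst// mul0r.
Qed.

Lemma dissipation_out p : ~~ (0 < p.2 < T) -> dissipation p = 0.
Proof.
move=> pT; rewrite /dissipation averaged_out// /xconv.
under eq_Rintegral do rewrite utT// mulr0.
by rewrite Rintegral_cst// mul0r subr0 mulr0.
Qed.

Lemma measurable_potential : measurable_fun setT potential.
Proof. by apply: measurable_conv => //; exact: measurable_kern. Qed.

Lemma potential_bound p : `|potential p| <= C.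
Proof.
apply: le_trans (conv_bound p ikE mw wC) _.
rewrite (_ : \int[lZ]_q `|kern rho E q| = 1) ?mulr1//.
transitivity (\int[lZ]_q kern rho E q).
  by apply: eq_Rintegral => q _; rewrite ger0_norm// mulr_ge0.
by rewrite integral_kern// integral_rho int_E mulr1.
Qed.

Lemma potential_out p : p.2 <= 0 -> potential p = 0.
Proof.
move=> p0; rewrite /potential /stconv.
rewrite (_ : (fun q => _) = cst 0); first by rewrite Rintegral_cst// mul0r.
apply/funext => q; have [q0|q0] := leP 0 q.2.
  by rewrite wT ?mulr0// /step/= negb_and -leNgt lerBlDr add0r (le_trans p0 q0).
by rewrite /kern lt0_exponential_pdf// mulr0 mul0r.
Qed.

(** The identity of [space_time_identity] multiplied by [lam], with the null sets rearranged by
    [ae_exchange]. On (0, T) the first term of [averaged] is the initial term of Duhamel's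
    formula. *)
Let dissipation_eq : {ae leb1, forall t : measurableTypeR R, 0 < t < T ->
  {ae leb N, forall y, dissipation (y, t) = - stconv (kern Lrho E) w (y, t)}}.
Proof.
pose F (p : X * measurableTypeR R) := \1_I01 p.2 * (dissipation p + stconv (kern Lrho E) w p).
have md := integrable_measurable dissipation_integrable.
have mF : measurable_fun setT F.
  have mk := measurable_kern iLrho iE; have mc := measurable_conv mk mw.
  by rewrite /F; mfun.
have := @ae_exchange _ _ _ _ _ (leb N) leb1 F mF.
have H y : {ae leb1, forall t : measurableTypeR R, F (y, t) = 0}.
  apply: filterS (space_time_identity y) => t H.
  rewrite /F indicE; have [|_] := boolP (t \in I01); last by rewrite mul0r.
  rewrite inE /I01/= in_itv/= => tT; rewrite mul1r /dissipation H// /averaged/=.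
  have -> : xconv rho (fun q : Z => u0 q.1 * decay q.2) (y, t) = expR (- lam * t) * a0 y.
    rewrite /xconv /a0 /decay/= indicE mem_set; last by rewrite /I01/= in_itv.
    have mu0 := integrable_measurable iu0.
    have [B rhoB] := rho_bounded.
    have iuy : (leb N).-integrable setT (EFin \o (fun x => u0 (y + x))).
      have := preserving_integrable (preserving_leb y) iu0.
      by congr (integrable _ _ (EFin \o _)); apply/funext => x /=; rewrite addrC.
    have i1 := integrable_bM mrho iuy rhoB.
    rewrite -(RintegralZl _ measurableT i1); apply: eq_Rintegral => x _.
    by rewrite mulr1; ring.
  rewrite indicE mem_set; last by rewrite /I01/= in_itv.
  by rewrite -/E mul1r; field; rewrite gt_eqF.
move=> /(_ H); apply: filterS => t Ft tT; apply: filterS Ft => y.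
rewrite /F/= indicE mem_set; last by rewrite /I01/= in_itv.
by rewrite mul1r => /eqP; rewrite addr_eq0 => /eqP.
Qed.

Lemma potential_regular : {ae leb1, forall t : measurableTypeR R, t < T ->
  regular nu (fun k => C * truncation_error k)
    (fun x => potential (x, t)) (fun x => dissipation (x, t))}.
Proof.
have mp := measurable_potential.
have iG : lZ.-integrable setT (EFin \o stconv (kern rho E) (fun p => `|ut p|)).
  by apply: conv_L1 => //; exact: integrable_norm.
have iGs := ae_integrable2 iG; have ids := ae_integrable2 dissipation_integrable.
apply: filterS3 iGs ids dissipation_eq => t iGt idt Ht tT.
split.
- by mfun.
- by exists C => x; exact: potential_bound.
(* The bound [w_dom] is averaged by a kernel of mass one: the constant [d] survives, and [|ut|]
   becomes a function that is integrable at almost every time. *)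
- move=> d d0; have [D D0 wD] := w_dom d0.
  exists (fun x => D * stconv (kern rho E) (fun p => `|ut p|) (x, t)).
    by apply: integrableZ_R; exact: iGt.
  move=> x; have mn : measurable_fun setT (fun p => `|ut p|) by mfun.
  have nC p : `| `|ut p| | <= C by rewrite normr_id.
  have i1 := conv_integrable (x, t) ikE mn nC.
  have i2 := conv_integrable (x, t) ikE mw wC.
  have G0 : 0 <= stconv (kern rho E) (fun p => `|ut p|) (x, t).
    by apply: Rintegral_ge0 => q _; rewrite mulr_ge0// mulr_ge0.
  rewrite [X in _ <= _ + X]ger0_norm; last by rewrite mulr_ge0.
  rewrite -[d]mulr1 -[X in d * X](_ : \int[lZ]_q kern rho E q = 1); last first.
    by rewrite integral_kern// integral_rho int_E mulr1.
  rewrite /stconv -!RintegralZl// -RintegralD//; [|exact: integrableZ_R..].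
  apply: le_Rintegral_norm => //.
    by apply: integrableD_R; exact: integrableZ_R.
  move=> q; have k0 : 0 <= kern rho E q by rewrite mulr_ge0.
  rewrite -/E normrM ger0_norm//.
  apply: le_trans (ler_wpM2l k0 (wD _)) _.
  by rewrite mulrDr mulrCA [_ * d]mulrC.
- exact: idt.
move=> k; have [B rhoB] := rho_bounded.
have iL := Lop_integrable (nu k) irho; have iLk := Lop_Lrho_integrable k.
have LE y : Lop (nu k) (fun x => potential (x, t)) y =
    stconv (kern (Lop (nu k) rho) E) w (y, t).
  exact: (Lop_conv (y, t) (nu_even mu_even mu_levy k) irho rhoB iE mw wC).
have main : 0 <= C * truncation_error k by rewrite mulr_ge0//; exact: Rintegral_ge0.
(* Nonpositive times have to be included because the positivity argument compares [t] with [t - h].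
   There both functions vanish. *)
have [t0|t0] := leP t 0.
  apply: nearW => y; rewrite dissipation_out ?addr0; last by rewrite negb_and /= -leNgt t0.
  rewrite /Lop; under eq_Rintegral do rewrite !potential_out// subr0.
  by rewrite Rintegral_cst// mul0r normr0.
apply: filterS (Ht _) => [y ->|]; last by rewrite t0.
rewrite LE /stconv -RintegralB//; last 2 first.
- exact: (conv_integrable _ (kern_integrable iL iE) mw wC).
- exact: (conv_integrable _ (kern_integrable iLrho iE) mw wC).
(* The difference is [w] averaged against the difference of the two kernels, hence at most [C] times
   the L1 norm of that difference; the exponential factor has mass one. *)
have -> : \int[lZ]_q (kern (Lop (nu k) rho) E q * w (step (y, t) q) -
    kern Lrho E q * w (step (y, t) q)) =
    stconv (kern (fun x => Lop (nu k) rho x - Lrho x) E) w (y, t).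
  by apply: eq_Rintegral => q _; rewrite /kern; ring.
apply: le_trans (conv_bound _ (kern_integrable iLk iE) mw wC) _.
rewrite ler_wpM2l// le_eqVlt; apply/orP; left; apply/eqP.
transitivity (\int[lZ]_q kern (fun x => `|Lop (nu k) rho x - Lrho x|) E q).
  by apply: eq_Rintegral => q _; rewrite /kern normrM [`|E _|]ger0_norm.
by rewrite integral_kern ?int_E ?mulr1//; exact: integrable_norm.
Qed.

End evolution.

End mollified_equation.

(** * From the distributional formulation to the resolvent identity *)

Section clamp.
Context {R : realType}.

(** Clamping turns the almost everywhere bounds on the solution and the datum into bounds
    everywhere, and [phi] into a bounded function. *)
Definition clamp (M r : R) : R := Num.min (Num.max r (- M)) M.

Lemma clamp_bound M r : 0 <= M -> `|clamp M r| <= M.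
Proof.
move=> M0; rewrite /clamp ler_norml ge_min lexx orbT andbT le_min.
by rewrite le_max lexx orbT/=; lra.
Qed.

Lemma clamp_le M r : 0 <= M -> `|clamp M r| <= `|r|.
Proof.
move=> M0; rewrite /clamp; have [r1|r1] := leP r (- M).
  rewrite min_l; last by lra.
  by rewrite !ler0_norm; lra.
have [r2|r2] := leP r M; first by [].
by rewrite !ger0_norm; lra.
Qed.

Lemma clampE M r : `|r| <= M -> clamp M r = r.
Proof.
by rewrite ler_norml => /andP[r1 r2]; rewrite /clamp max_l// min_l.
Qed.

Lemma measurable_clamp M : measurable_fun setT (clamp M).
Proof.
apply: measurable_minr; last exact: measurable_cst.
by apply: measurable_maxr => //; exact: measurable_cst.
Qed.

End clamp.

Section levy_operator.
Context {R : realType} {N : nat}.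
Local Notation X := 'rV[R]_N.
Variable mu : {measure set X -> \bar R}.
Hypothesis mu_levy : levy_integrable mu.
Variables (rho : X -> R) (e : R).
Hypothesis grho : gen rho.
Hypothesis rho_supp : forall x, rho x != 0 -> cube e x.

Let gradient_translate_scale (y x : X) (k : R) :
  gradient (fun x => rho (x - y) * k) x = k *: gradient rho (x - y).
Proof.
apply/rowP => i; rewrite !mxE.
rewrite (derive_translate (fun x => rho x * k) x y (delta_mx 0 i)).
rewrite (_ : (fun x => rho x * k) = k *: rho); last by apply/funext => z; exact: mulrC.
by rewrite deriveZ//; apply/diff_derivable/gen_differentiable.
Qed.

(** The scalar [k] stands for the time factor of a product test function, frozen at one instant. *)
Lemma levy_op_translate_scale (y x : X) (k : R) :
  levy_op mu (fun x => rho (x - y) * k) x = levy_op mu rho (x - y) * k.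
Proof.
have mP := @measurable_punctured R N.
have iG : mu.-integrable [set~ 0] (EFin \o levy_integrand rho (x - y)).
  by apply: integrableS (levy_integrand_integrable mu_levy grho rho_supp (x - y)).
transitivity (\int[mu]_(z in [set~ 0]) (k * levy_integrand rho (x - y) z)).
  apply: eq_Rintegral => z _; rewrite /levy_integrand gradient_translate_scale.
  have -> : dotprod z (k *: gradient rho (x - y)) = k * dotprod z (gradient rho (x - y)).
    by rewrite /dotprod mulr_sumr; apply: eq_bigr => i _; rewrite mxE mulrCA.
  rewrite [x + z - y]addrAC.
  move: (dotprod _ _) (rho _) (rho _) (\1_ _ _) => a b c d; ring.
by rewrite (RintegralZl k mP iG); exact: mulrC.
Qed.

End levy_operator.

Section weak_formulation.
Context {R : realType} {N : nat}.
Local Notation X := 'rV[R]_N.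
Local Notation Z := (X * measurableTypeR R)%type.
Local Notation leb1 := (@lebesgue_measure R).
Local Notation lZ := (leb N \x leb1)%E.
Variables (T M : R) (phi : R -> R) (mu : {measure set X -> \bar R}).
Variables (u0 : X -> R) (u : Z -> R).
Hypothesis mu_even : even_measure mu.
Hypothesis mu_levy : levy_integrable mu.
Hypothesis phi_cont : continuous phi.
Hypothesis phi0 : phi 0 = 0.
Hypothesis M0 : 0 <= M.
Hypothesis u_L1 : lZ.-integrable (QT T) (EFin \o u).
Hypothesis uM : {ae lZ, forall p : Z, QT T p -> `|u p| <= M}.
Hypothesis iu0 : (leb N).-integrable setT (EFin \o u0).
Hypothesis u_sol : distributional_solution T phi mu u0 u.

Definition cutoff (p : Z) : R := if 0 < p.2 < T then clamp M (u p) else 0.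

Lemma measurable_QT : measurable (QT T : set Z).
Proof.
rewrite (_ : QT T = setT `*` `]0, T[%classic); first exact: measurableX.
by apply/seteqP; split => [p /= pT|p [_]]; rewrite /QT/= in_itv.
Qed.

Let mQT := measurable_QT.

Let cutoffE : cutoff = (clamp M \o u) \_ (QT T).
Proof.
apply/funext => p; rewrite patchE /cutoff; case: ifPn => pT.
  by rewrite mem_set.
by rewrite memNset//; exact/negP.
Qed.

Lemma cutoff_bound p : `|cutoff p| <= M.
Proof. by rewrite /cutoff; case: ifP => _; [exact: clamp_bound|rewrite normr0]. Qed.

Lemma cutoff_out p : ~~ (0 < p.2 < T) -> cutoff p = 0.
Proof. by rewrite /cutoff => /negbTE ->. Qed.

Let mu_ : measurable_fun (QT T) u.
Proof. by case/integrableP : u_L1 => /measurable_EFinP. Qed.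

Lemma measurable_cutoff : measurable_fun setT cutoff.
Proof.
rewrite cutoffE; apply/(measurable_restrictT _ mQT).
exact: measurableT_comp (@measurable_clamp R M) mu_.
Qed.

Lemma cutoff_integrable : lZ.-integrable setT (EFin \o cutoff).
Proof.
have : lZ.-integrable setT (EFin \o (u \_ (QT T))).
  by rewrite -restrict_EFin -integrable_mkcond.
move=> /integrable_norm => i1; apply: (integrable_dom measurable_cutoff i1).
move=> p; rewrite cutoffE /= !patchE; case: ifP => _; last by rewrite normr0.
exact: clamp_le.
Qed.

Lemma cutoff_ae : {ae lZ, forall p : Z, QT T p -> u p = cutoff p}.
Proof.
apply: filterS uM => p H pT; rewrite /cutoff (_ : 0 < p.2 < T = true)//.
by rewrite clampE// H.
Qed.

Lemma measurable_phi : measurable_fun setT phi.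
Proof. exact: continuous_measurable_fun. Qed.

Lemma weak_product (rho : X -> R) (e lam : R) : gen rho ->
  (forall x, rho x != 0 -> cube e x) -> measurable_fun setT (levy_op mu rho) ->
  forall (y : X) tau n, 0 < tau < T ->
  \int[lZ]_p (cutoff p * (rho (p.1 - y) * time_test' lam tau n p.2) +
      phi (cutoff p) * (levy_op mu rho (p.1 - y) * time_test lam tau n p.2)) +
    \int[leb N]_x (u0 x * rho (x - y)) * time_test lam tau n 0 = 0.
Proof.
move=> grho rho_supp mL y tau n tT.
have mr : measurable_fun setT rho.
  by apply: continuous_measurable_rV; exact: gen_continuous.
have mt : measurable_fun setT (time_test lam tau n : measurableTypeR R -> R).
  exact: measurable_time_test.
have mt' : measurable_fun setT (time_test' lam tau n : measurableTypeR R -> R).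
  have me0 : measurable_fun setT (@e0 R) by exact: measurable_flat.
  have me0' : measurable_fun setT (@e0' R) by exact: measurable_flat.
  by rewrite /time_test'; mfun.
pose A (p : Z) := rho (p.1 - y) * time_test' lam tau n p.2.
pose B (p : Z) := levy_op mu rho (p.1 - y) * time_test lam tau n p.2.
have mA : measurable_fun setT A by rewrite /A; mfun.
have mB : measurable_fun setT B.
  apply: measurable_funM; first by apply: (measurableT_comp mL); mfun.
  by apply: (measurableT_comp mt); mfun.
have mphi := measurable_phi; have mc := measurable_cutoff.
(* Inside the slab [u] and its cutoff agree almost everywhere; outside, the new integrand vanishes
   because [phi 0 = 0]. *)
have E1 : \int[lZ]_(p in QT T) (u p * A p + phi (u p) * B p) =
    \int[lZ]_p (cutoff p * A p + phi (cutoff p) * B p).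
  transitivity (\int[lZ]_(p in QT T) (cutoff p * A p + phi (cutoff p) * B p)).
    congr fine; apply: ae_eq_integral => //.
    - apply/measurable_EFinP; apply: measurable_funD.
        by apply: measurable_funM => //; exact: measurable_funS mA.
      apply: measurable_funM; last by exact: measurable_funS mB.
      exact: measurableT_comp mphi mu_.
    - by apply: (@measurable_funS _ _ _ _ setT) => //; mfun.
    - by apply: filterS cutoff_ae => p H pT; rewrite (H pT).
  rewrite Rintegral_mkcond; apply: eq_Rintegral => p _; rewrite patchE.
  case: ifPn => //; rewrite notin_setE => pT.
  by rewrite cutoff_out ?phi0 ?mul0r ?addr0//; exact/negP.
rewrite -/A -/B in E1 *.
have E2 : \int[leb N]_x (u0 x * (rho (x - y) * time_test lam tau n 0)) =
    \int[leb N]_x (u0 x * rho (x - y)) * time_test lam tau n 0.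
  have mry : measurable_fun setT (fun x : X => rho (x - y)) by mfun.
  have [D rhoD] := gen_supp_bounded grho rho_supp.
  have i1 := integrableM_b mry iu0 (fun x => rhoD (x - y)).
  rewrite mulrC -(RintegralZl (time_test lam tau n 0) measurableT i1).
  by apply: eq_Rintegral => x _; ring.
have [_ /(_ _ (product_test_function lam n y grho rho_supp tT)) W] := u_sol.
rewrite -E1 -E2 -[RHS]W; congr (_ + _).
apply: eq_Rintegral => p _ /=; congr (_ * _ + _ * _).
  rewrite derive1Ml ?derive1_time_test//.
  exact/derivable1_diffP/gen_differentiable/time_test_gen.
exact: esym (levy_op_translate_scale mu_levy grho rho_supp y p.1 (time_test lam tau n p.2)).
Qed.

End weak_formulation.

(** * Convexity *)

Section primitive.
Context {R : realType}.
Local Notation leb1 := (@lebesgue_measure R).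
Variables (phi : R -> R) (C : R).
Hypothesis mphi : measurable_fun setT phi.
Hypothesis phi_nd : {homo phi : a b / a <= b}.
Hypothesis phi0 : phi 0 = 0.
Hypothesis phiC : forall r, `|phi r| <= C.

(** The indicator of the interval between [a] and [b], with the sign of [b - a]. It makes oriented
    integrals additive without any case distinction on the order of the endpoints. *)
Let between (a b : R) (s : measurableTypeR R) : R := ind (s <= b) - ind (s <= a).

Let between_spec a b : leb1.-integrable setT (EFin \o between a b) /\
  \int[leb1]_s between a b s = b - a.
Proof.
wlog ab : a b / a <= b.
  move=> H; have [/H//|/ltW /H[i1 i2]] := leP a b.
  have E : between a b = fun s => -1 * between b a s.
    by apply/funext => s; rewrite /between mulN1r opprB.
  rewrite E; split; first exact: integrableZ_R.
  by rewrite RintegralZl// i2; ring.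
have mI : measurable (`]a, b]%classic : set (measurableTypeR R)) by exact: measurable_itv.
have E : between a b = \1_(`]a, b]%classic : set (measurableTypeR R)).
  apply/funext => s; rewrite /between indicE.
  have [sb|sb] := leP s b; have [sa|sa] := leP s a.
  - by rewrite memNset ?subrr//= in_itv/= ltNge sa.
  - by rewrite mem_set ?subr0//= in_itv/= sa sb.
  - by have := lt_le_trans sb (le_trans sa ab); rewrite ltxx.
  - by rewrite memNset ?subrr//= in_itv/= leNgt sb andbF.
have L : leb1 (`]a, b]%classic) = (b - a)%:E.
  rewrite lebesgue_measure_itv/= lte_fin; case: ltP => [_|ba]; first by rewrite EFinB.
  by rewrite (le_anti (introT andP (conj ab ba))) subrr.
have Loo : (leb1 (`]a, b]%classic) < +oo)%E by rewrite L ltry.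
rewrite E; split; last by rewrite /Rintegral integral_indic// setIT; exact: (congr1 fine L).
apply/integrable_nrm1; first exact: measurable_indic.
rewrite /nrm1; under eq_integral do rewrite ger0_norm//.
by rewrite integral_indic// setIT.
Qed.

Definition primitive (x : R) : R :=
  \int[leb1]_s (phi s * (ind (s <= x) - ind (s <= 0))).

Let phi_between_integrable a b :
  leb1.-integrable setT (EFin \o (fun s => phi s * between a b s)).
Proof. by have [i1 _] := between_spec a b; exact: integrable_bM i1 phiC. Qed.

(** Where the signed indicator is nonzero, it has the sign of [s - a], and by monotonicity
    [phi s - phi a] has a compatible sign. *)
Lemma primitive_tangent a b : phi a * (b - a) <= primitive b - primitive a.
Proof.
have [i1 <-] := between_spec a b.
rewrite -(RintegralZl (phi a) measurableT i1).
have -> : primitive b - primitive a = \int[leb1]_s (phi s * between a b s).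
  have := RintegralB measurableT (phi_between_integrable 0 b) (phi_between_integrable 0 a).
  move=> E; rewrite -[LHS]E; apply: eq_Rintegral => s _ /=.
  by rewrite /between; ring.
apply: le_Rintegral => //; first exact: integrableZ_R.
move=> s _; rewrite /between.
have [sb|sb] := leP s b; have [sa|sa] := leP s a; rewrite ?subrr ?mulr0//.
  by rewrite subr0 !mulr1 phi_nd// ltW.
by rewrite sub0r !mulrN1 lerN2 phi_nd.
Qed.

Lemma measurable_primitive : measurable_fun setT primitive.
Proof.
have := @measurable_Rint2 _ _ _ _ _ leb1 (fun p : measurableTypeR R * measurableTypeR R =>
  phi p.2 * (ind (p.2 <= p.1) - ind (p.2 <= 0))).
apply; apply: measurable_funM; first by mfun.
by apply: measurable_funB; apply: measurable_le; mfun.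
Qed.

Lemma primitive0 : primitive 0 = 0.
Proof.
rewrite /primitive; under eq_Rintegral do rewrite subrr mulr0.
by rewrite Rintegral_cst// mul0r.
Qed.

Lemma primitive_ge0 b : 0 <= primitive b.
Proof. by have := primitive_tangent 0 b; rewrite phi0 mul0r primitive0 subr0. Qed.

Lemma primitive_le_mul b : primitive b <= phi b * b.
Proof.
have := primitive_tangent b 0; rewrite primitive0 !sub0r mulrN.
by rewrite lerN2.
Qed.

Lemma primitive_le b : `|primitive b| <= C * `|b|.
Proof.
rewrite ger0_norm ?primitive_ge0//; apply: le_trans (primitive_le_mul b) _.
by apply: le_trans (ler_norm _) _; rewrite normrM ler_wpM2r.
Qed.

Lemma primitive_lip a b : primitive b - primitive a <= C * `|b - a|.
Proof.
have := primitive_tangent b a; rewrite -lerN2 opprB => /le_trans; apply.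
rewrite -mulrN opprB; apply: le_trans (ler_norm _) _.
by rewrite normrM ler_wpM2r.
Qed.

(** Split [U - a] at [u']. The tangent inequality handles [U - u'], at the cost of [C |u' - u|] for
    replacing [Phi(u')] by [Phi(u)]; the rest is at most [C |u' - a|], which contributes the second
    [C |u' - u|] and [C |u - a|]. *)
Lemma primitive_flux U u u' a :
  phi u' * (U - a) <= primitive U - primitive u + 2 * C * `|u' - u| + C * `|u - a|.
Proof.
have := primitive_tangent u' U; have := primitive_lip u' u.
have : phi u' * (u' - a) <= C * `|u' - a|.
  by apply: le_trans (ler_norm _) _; rewrite normrM ler_wpM2r.
have C0 : 0 <= C by exact: le_trans (phiC 0).
have : C * `|u' - a| <= C * `|u' - u| + C * `|u - a|.
  by rewrite -mulrDr ler_wpM2l// (le_trans _ (ler_normD _ _))// addrA subrK.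
rewrite [`|u - u'|]distrC !mulrBr.
by lra.
Qed.

End primitive.

(** * The exponential density and its restriction to a short window *)

Section exponential_kernel.
Context {R : realType}.
Local Notation leb1 := (@lebesgue_measure R).
Variable lam : R.
Hypothesis lam0 : 0 < lam.
Local Notation E := (exponential_pdf lam).

(** Memorylessness of the exponential law, as an identity of densities. *)
Lemma exponential_shift (t s : R) : 0 <= t ->
  E s * ind (t <= s) = expR (- lam * t) * E (s - t).
Proof.
move=> t0; have [ts|st] := leP t s; last first.
  by rewrite mulr0 lt0_exponential_pdf ?mulr0// subr_lt0.
rewrite mulr1 !exponential_pdfE ?subr_ge0 ?(le_trans t0)// mulrCA -expRD.
by congr (_ * expR _); ring.
Qed.

Lemma integral_E : \int[leb1]_s E s = 1.
Proof. by rewrite /Rintegral integral_exponential_pdf. Qed.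

Lemma integral_exponential_tail t : 0 <= t ->
  leb1.-integrable setT (EFin \o (fun s : measurableTypeR R => E s * ind (t <= s))) /\
  \int[leb1]_s (E s * ind (t <= s)) = expR (- lam * t).
Proof.
move=> t0; have iE : leb1.-integrable setT (EFin \o E) by exact: integrable_exponential_pdf.
have iEt := preserving_integrable (preserving_shift (- t)) iE.
rewrite (_ : (fun s : measurableTypeR R => _) = fun s => expR (- lam * t) * E (s - t)); last first.
  by apply/funext => s; exact: exponential_shift.
split; first exact: integrableZ_R.
rewrite (RintegralZl _ measurableT iEt).
by rewrite (preserving_Rintegral (preserving_shift (- t)) (integrable_measurable iE)) integral_E mulr1.
Qed.

(* The exponential density is reproduced, up to the factor [exp(-lam h)], by a
   shift of length [h]; the difference lives on [0, h). *)
Definition short (h s : R) : R := E s - expR (- lam * h) * E (s - h).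

Lemma shortE h s : 0 <= h -> short h s = E s * ind (s < h).
Proof.
move=> h0; rewrite /short -exponential_shift//.
by case: leP => _; rewrite ?mulr1 ?mulr0 ?subrr ?subr0.
Qed.

Lemma short_ge0 h s : 0 <= h -> 0 <= short h s.
Proof. by move=> h0; rewrite shortE// mulr_ge0// exponential_pdf_ge0// ltW. Qed.

Lemma short_supp h s : 0 <= h -> short h s != 0 -> 0 <= s < h.
Proof.
move=> h0; rewrite shortE//; have [sh|_] := ltP s h; last by rewrite mulr0 eqxx.
have [//|s0] := leP 0 s; by rewrite lt0_exponential_pdf// mul0r eqxx.
Qed.

Lemma short_integral h : leb1.-integrable setT (EFin \o (short h : measurableTypeR R -> R)) /\
  \int[leb1]_s short h s = 1 - expR (- lam * h).
Proof.
have iE : leb1.-integrable setT (EFin \o E) by exact: integrable_exponential_pdf.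
have iEt := preserving_integrable (preserving_shift (- h)) iE.
have iZ := integrableZ_R (expR (- lam * h)) iEt.
split; first exact: integrableB_R.
rewrite [LHS](RintegralB measurableT iE iZ) integral_E; congr (_ - _).
rewrite [LHS](RintegralZl _ measurableT iEt).
by rewrite (preserving_Rintegral (preserving_shift (- h)) (integrable_measurable iE)) integral_E mulr1.
Qed.

End exponential_kernel.

Lemma le_Rintegral_bound d (T : measurableType d) (R : realType)
    (m : {measure set T -> \bar R}) (F : T -> R) (B : R) :
  measurable_fun setT F -> (forall x, 0 <= F x) -> (\int[m]_x (F x)%:E <= B%:E)%E ->
  m.-integrable setT (EFin \o F) /\ \int[m]_x F x <= B.
Proof.
move=> mF F0 FB; have Foo := le_lt_trans FB (ltry _).
split; last by rewrite -lee_fin Rintegral_ge0_fin.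
apply/integrable_nrm1 => //; rewrite /nrm1.
by under eq_integral do rewrite ger0_norm//.
Qed.

(** * Jensen's inequality for the time average *)

Section averaging.
Context {R : realType} {N : nat}.
Local Notation X := 'rV[R]_N.
Local Notation Z := (X * measurableTypeR R)%type.
Local Notation leb1 := (@lebesgue_measure R).
Local Notation lZ := (leb N \x leb1)%E.
Variables (rho : X -> R) (T lam : R).
Hypothesis grho : gen rho.
Hypothesis rho_ge0 : forall x, 0 <= rho x.
Hypothesis rho1 : (\int[leb N]_x (rho x)%:E = 1)%E.
Hypothesis lam0 : 0 < lam.
Local Notation E := (exponential_pdf lam : measurableTypeR R -> R).

Let irho : (leb N).-integrable setT (EFin \o rho).
Proof. exact: rho_integrable. Qed.

Let iE : leb1.-integrable setT (EFin \o E).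
Proof. exact: integrable_exponential_pdf. Qed.

Let mE : measurable_fun setT E. Proof. exact: integrable_measurable iE. Qed.
Let mrho : measurable_fun setT rho. Proof. exact: measurable_rho. Qed.

Let E_ge0 s : 0 <= E s.
Proof. by apply: exponential_pdf_ge0; exact: ltW. Qed.

Let ikE : lZ.-integrable setT (EFin \o kern rho E).
Proof. exact: kern_integrable. Qed.

Let kE_ge0 q : 0 <= kern rho E q.
Proof. by rewrite mulr_ge0. Qed.

Let int_kE : \int[lZ]_q kern rho E q = 1.
Proof. by rewrite integral_kern// integral_rho// integral_E// mulr1. Qed.

(* The initial datum prescribed at all negative times. *)
Definition extension (ut : Z -> R) (u0 : X -> R) (q : Z) : R := if 0 < q.2 then ut q else u0 q.1.

Lemma measurable_extension (ut : Z -> R) (u0 : X -> R) : measurable_fun setT ut -> measurable_fun setT u0 ->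
  measurable_fun setT (extension ut u0).
Proof.
move=> mut mu0; apply: measurable_fun_ifT => //; last by mfun.
by apply: measurable_fun_ltr; [exact: measurable_cst|exact: measurable_snd].
Qed.

Lemma extension_bound (ut : Z -> R) (u0 : X -> R) C : (forall p, `|ut p| <= C) -> (forall x, `|u0 x| <= C) ->
  forall q, `|extension ut u0 q| <= C.
Proof. by move=> utC u0C q; rewrite /extension; case: ifP. Qed.

(** At time [t] the kernel puts mass [exp(- lam t)] on elapsed times [s >= t], where the extension
    equals the initial datum; this accounts for the first term of [averaged]. As a genuine average,
    it is open to Jensen's inequality. *)
Lemma averaged_extension (ut : Z -> R) (u0 : X -> R) C p : measurable_fun setT ut -> (forall p, `|ut p| <= C) ->
  (forall p : Z, p.2 <= 0 -> ut p = 0) ->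
  measurable_fun setT u0 -> (forall x, `|u0 x| <= C) -> 0 < p.2 < T ->
  averaged rho ut u0 T lam p = stconv (kern rho E) (extension ut u0) p.
Proof.
move=> mut utC ut0 mu0 u0C pT; have /andP[p0 _] := pT.
have pI : p.2 \in (`]0, T[%classic : set (measurableTypeR R)) by rewrite inE/= in_itv.
have mx := measurable_extension mut mu0; have xC := extension_bound utC u0C.
rewrite (conv_kern_xconv p irho iE mx xC) /averaged (conv_kern_xconv p irho iE mut utC).
rewrite indicE pI mul1r.
pose a0 := \int[leb N]_x (rho x * u0 (p.1 + x)).
have -> : xconv rho (fun q : Z => u0 q.1 * (expR (- lam * q.2) *
    \1_(`]0, T[%classic : set (measurableTypeR R)) q.2)) p = a0 * expR (- lam * p.2).
  have i1 : (leb N).-integrable setT (EFin \o (fun x => rho x * u0 (p.1 + x))).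
    by apply: (integrableM_b (C := C)) => //; mfun.
  rewrite mulrC -(RintegralZl _ measurableT i1); apply: eq_Rintegral => x _ /=.
  by rewrite indicE pI mulr1; ring.
have [i2 <-] := integral_exponential_tail lam0 (ltW p0).
rewrite -(RintegralZl _ measurableT i2).
have mxc : measurable_fun setT (fun s : measurableTypeR R => xconv rho ut (p.1, p.2 - s)).
  by have := measurable_xconv mrho mut => mxv; mfun.
have i3 : leb1.-integrable setT (EFin \o (fun s : measurableTypeR R => E s * xconv rho ut (p.1, p.2 - s))).
  apply: integrableM_b iE _ => // s.
  exact: xconv_bound irho mut utC.
rewrite -RintegralD//; last exact: integrableZ_R.
apply: eq_Rintegral => s _; rewrite mulrCA -mulrDr; congr (_ * _).
rewrite /xconv /extension/=; have [ps|ps] := leP p.2 s.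
  rewrite ltNge subr_le0 ps mulr1.
  under [X in _ + X]eq_Rintegral do rewrite ut0 ?mulr0 ?subr_le0//.
  by rewrite Rintegral_cst// mul0r addr0.
by rewrite subr_gt0 ps mulr0 add0r.
Qed.

(** Extending by the datum commutes with [Phi], so [conv_jensen] applies within (0, T). At other
    times both sides are 0, since [Phi 0 = 0]. *)
Lemma averaged_jensen (Phi phi : R -> R) (ut : Z -> R) (u0 : X -> R) C C' p :
  measurable_fun setT ut -> (forall p, `|ut p| <= C) ->
  (forall p : Z, ~~ (0 < p.2 < T) -> ut p = 0) ->
  measurable_fun setT u0 -> (forall x, `|u0 x| <= C) ->
  measurable_fun setT Phi -> Phi 0 = 0 ->
  (forall p, `|Phi (ut p)| <= C') -> (forall x, `|Phi (u0 x)| <= C') ->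
  (forall a b, phi a * (b - a) <= Phi b - Phi a) ->
  Phi (averaged rho ut u0 T lam p) <= averaged rho (Phi \o ut) (Phi \o u0) T lam p.
Proof.
move=> mut utC utT mu0 u0C mP P0 PutC Pu0C tangent.
have [pT|pT] := boolP (0 < p.2 < T); last by rewrite !averaged_out// P0.
have ut0 (q : Z) : q.2 <= 0 -> ut q = 0 by move=> q0; rewrite utT// negb_and -leNgt q0.
rewrite (averaged_extension mut utC ut0 mu0 u0C pT).
have mPut : measurable_fun setT (Phi \o ut) by exact: measurableT_comp.
have mPu0 : measurable_fun setT (Phi \o u0) by exact: measurableT_comp.
rewrite (averaged_extension (C := C') mPut PutC _ mPu0 Pu0C pT); last first.
  by move=> q q0; rewrite /= ut0.
have -> : extension (Phi \o ut) (Phi \o u0) = Phi \o extension ut u0.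
  by apply/funext => q; rewrite /extension /=; case: ifP.
have mx := measurable_extension mut mu0; have xC := extension_bound utC u0C.
apply: (conv_jensen (phi := phi) (C := C) (C' := C') p ikE) => //.
  exact: measurableT_comp.
by move=> q; rewrite /extension/=; case: ifP.
Qed.

(** The kernels have mass one, and the weight [exp(- lam s)] of the datum integrates to at most
    [lam^-1]. Since the dissipation carries a factor [lam], the datum will enter the energy bound
    with coefficient exactly one. *)
Lemma integral_averaged (ut : Z -> R) (u0 : X -> R) :
  lZ.-integrable setT (EFin \o ut) -> (leb N).-integrable setT (EFin \o u0) ->
  \int[lZ]_p averaged rho ut u0 T lam p <=
    \int[lZ]_p `|ut p| + lam^-1 * \int[leb N]_x `|u0 x|.
Proof.
move=> iut iu0; have mut := integrable_measurable iut; have mu0 := integrable_measurable iu0.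
pose I01 : set (measurableTypeR R) := `]0, T[%classic.
pose decay (s : measurableTypeR R) : R := expR (- lam * s) * \1_I01 s.
have mI : measurable_fun setT (\1_I01 : measurableTypeR R -> R).
  by apply: measurable_indic; exact: measurable_itv.
have mdecay : measurable_fun setT decay.
  by apply: measurable_funM => //; mfun.
have decay0 s : 0 <= decay s by rewrite mulr_ge0 ?expR_ge0.
have decayE s : decay s <= lam^-1 * E s.
  rewrite /decay indicE; have [|_] := boolP (s \in I01); last first.
    by rewrite mulr0 mulr_ge0// invr_ge0 ltW.
  rewrite inE /I01/= in_itv/= => /andP[s0 _].
  by rewrite mulr1 (exponential_pdfE _ (ltW s0)) mulKf ?gt_eqF.
have idecay : leb1.-integrable setT (EFin \o decay).
  apply: (integrable_dom mdecay (integrableZ_R lam^-1 iE)) => s.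
  by rewrite ger0_norm.
have id_le : \int[leb1]_s decay s <= lam^-1.
  rewrite -[leRHS]mulr1 -(integral_E lam0) -RintegralZl//.
  by apply: le_Rintegral => //; exact: integrableZ_R.
have ig0 : lZ.-integrable setT (EFin \o (fun q : Z => u0 q.1 * decay q.2)).
  exact: (kern_integrable iu0 idecay).
have ia : lZ.-integrable setT (EFin \o averaged rho ut u0 T lam).
  exact: averaged_integrable.
apply: (@le_trans _ _ (\int[lZ]_p `|averaged rho ut u0 T lam p|)).
  apply: le_Rintegral => //; first exact: integrable_norm.
  by move=> p _; exact: ler_norm.
rewrite -lee_fin (Rintegral_nrm1 ia).
have is1 := conv_L1 ikE iut; have ix := xconv_L1 irho ig0.
have mis : measurable_fun setT (fun p : Z => \1_I01 p.2 * stconv (kern rho E) ut p).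
  have := integrable_measurable is1 => ms1; mfun.
apply: le_trans (nrm1D lZ (integrable_measurable ix) mis) _.
rewrite EFinD [leRHS]addeC; apply: leeD.
  apply: le_trans (nrm1_xconv irho ig0) _.
  have -> : nrm1 (leb N) rho = 1%E.
    by rewrite -rho1; apply: eq_integral => x _; rewrite ger0_norm.
  rewrite mul1e -(Rintegral_nrm1 ig0) lee_fin.
  have -> : \int[lZ]_p `|u0 p.1 * decay p.2| = \int[lZ]_p kern (fun x => `|u0 x|) decay p.
    by apply: eq_Rintegral => p _; rewrite /kern normrM [`|decay _|]ger0_norm.
  rewrite integral_kern//; last exact: integrable_norm.
  by rewrite mulrC ler_wpM2r//; exact: Rintegral_ge0.
apply: (@le_trans _ _ (nrm1 lZ (stconv (kern rho E) ut))).
  apply: le_nrm1 => //; first exact: integrable_measurable is1.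
  by move=> p; rewrite normrM ler_piMl// indicE normr_nat lern1 leq_b1.
apply: le_trans (nrm1_conv (integrable_measurable ikE) mut) _.
have -> : nrm1 lZ (kern rho E) = 1%E.
  rewrite -(Rintegral_nrm1 ikE) -[in RHS]int_kE; congr (_%:E).
  by apply: eq_Rintegral => q _; rewrite ger0_norm.
by rewrite mul1e Rintegral_nrm1.
Qed.

End averaging.

(** * The energy inequality *)

Lemma balance (R : realType) (lam C D k x1 x2 x3 x4 x5 : R) : 0 < lam -> 0 <= C -> 0 < k ->
  x1 <= x2 + lam^-1 * x5 -> x3 <= D * k -> x4 <= D ->
  lam * (k * (x1 - x2) + 2 * C * x3 + k * C * x4) <= k * (x5 + 3 * C * lam * D).
Proof.
move=> lam0 C0 k0 H1 H2 H3.
have {}H1 : k * (lam * (x1 - x2)) <= k * x5.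
  rewrite ler_wpM2l ?(ltW k0)// mulrC -ler_pdivlMr//.
  by rewrite lerBlDl mulrC.
have {}H2 : lam * (C * x3) <= lam * (C * (D * k)).
  by rewrite ler_wpM2l ?(ltW lam0)// ler_wpM2l.
have {}H3 : lam * (k * (C * x4)) <= lam * (k * (C * D)).
  by rewrite ler_wpM2l ?(ltW lam0)// ler_wpM2l ?(ltW k0)// ler_wpM2l.
move: H1 H2 H3; clear; lra.
Qed.

Lemma flux_balance (R : realType) (k C x y z t : R) : k * (C * y) <= k * (C * z) ->
  k * (x + C * y) + t <= k * x + t + k * C * z.
Proof. lra. Qed.

Section energy_inequality.
Context {R : realType} {N : nat}.
Local Notation X := 'rV[R]_N.
Local Notation Z := (X * measurableTypeR R)%type.
Local Notation leb1 := (@lebesgue_measure R).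
Local Notation lZ := (leb N \x leb1)%E.
Variable mu : {measure set X -> \bar R}.
Hypothesis mu_even : even_measure mu.
Hypothesis mu_levy : levy_integrable mu.
Variables (rho : X -> R) (e : R).
Hypothesis grho : gen rho.
Hypothesis rho_supp : forall x, rho x != 0 -> cube e x.
Hypothesis rho_ge0 : forall x, 0 <= rho x.
Hypothesis rho1 : (\int[leb N]_x (rho x)%:E = 1)%E.
Variables (phi : R -> R) (ut : Z -> R) (u0 : X -> R) (C T lam h D : R).
Hypothesis phi_cont : continuous phi.
Hypothesis phi_nd : {homo phi : a b / a <= b}.
Hypothesis phi0 : phi 0 = 0.
Hypothesis phiC : forall r, `|phi r| <= C.
Hypothesis lam0 : 0 < lam.
Hypothesis h0 : 0 < h.
Hypothesis iut : lZ.-integrable setT (EFin \o ut).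
Hypothesis utC : forall p, `|ut p| <= C.
Hypothesis utT : forall p : Z, ~~ (0 < p.2 < T) -> ut p = 0.
Hypothesis iu0 : (leb N).-integrable setT (EFin \o u0).
Hypothesis u0C : forall x, `|u0 x| <= C.
Hypothesis weak : forall (y : X) tau n, 0 < tau < T ->
  \int[lZ]_p (ut p * (rho (p.1 - y) * time_test' lam tau n p.2) +
              phi (ut p) * (levy_op mu rho (p.1 - y) * time_test lam tau n p.2)) +
    \int[leb N]_x (u0 x * rho (x - y)) * time_test lam tau n 0 = 0.
Hypothesis modulus : forall (x : X) s, cube e x -> 0 <= s <= h ->
  (nrm1 lZ (fun p : Z => ut (p.1 + x, p.2 - s) - ut p)%R <= D%:E)%E.

Let C0 : 0 <= C. Proof. exact: le_trans (phiC 0). Qed.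

Let mphi : measurable_fun setT phi. Proof. exact: continuous_measurable_fun. Qed.
Let mut : measurable_fun setT ut. Proof. exact: integrable_measurable iut. Qed.
Let mu0 : measurable_fun setT u0. Proof. exact: integrable_measurable iu0. Qed.
Let irho := rho_integrable grho rho_ge0 rho1.
Let mrho := measurable_rho grho.

Let w (p : Z) := phi (ut p).
Let mw : measurable_fun setT w. Proof. exact: measurableT_comp mphi mut. Qed.
Let wC p : `|w p| <= C. Proof. exact: phiC. Qed.
Let wT (p : Z) : ~~ (0 < p.2 < T) -> w p = 0.
Proof. by move=> pT; rewrite /w utT. Qed.

(** Small values of [ut] are handled by continuity of [phi] at 0; where [|ut| >= r], the bound [C]
    is at most [C / r * |ut|]. *)
Let w_dom d : 0 < d -> exists2 D', 0 <= D' & forall p, `|w p| <= d + D' * `|ut p|.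
Proof.
move=> d0; have /cvgrPdist_lt /(_ _ d0) := @phi_cont 0.
rewrite phi0 => /nbhs_ballP[r /= r0 Hr].
exists (C / r) => [|p]; first by rewrite divr_ge0// ltW.
rewrite /w; have [ur|ur] := ltP `|ut p| r.
  apply: (@le_trans _ _ d); last by rewrite lerDl mulr_ge0// divr_ge0// ltW.
  have := Hr (ut p); rewrite sub0r normrN => H; apply/ltW/H.
  by rewrite /ball/= sub0r normrN.
apply: le_trans (phiC _) _; apply: (@le_trans _ _ (C / r * `|ut p|)); last first.
  by rewrite lerDr ltW.
by rewrite -mulrA ler_peMr// mulrC ler_pdivlMr// mul1r.
Qed.

Local Notation v := (potential rho w lam).
Local Notation f := (dissipation rho ut u0 T lam).
Local Notation U := (averaged rho ut u0 T lam).
Local Notation E := (exponential_pdf lam : measurableTypeR R -> R).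
Local Notation Phi := (primitive phi).
Local Notation nu := (nu mu_levy).
Let q := expR (- lam * h).

Let iE : leb1.-integrable setT (EFin \o E).
Proof. exact: integrable_exponential_pdf. Qed.

Let S : measurableTypeR R -> R := short lam h.

Let iS : leb1.-integrable setT (EFin \o S).
Proof. exact: (short_integral lam0 h).1. Qed.

Let k := kern rho S.

Let ik : lZ.-integrable setT (EFin \o k).
Proof. exact: kern_integrable irho iS. Qed.

Let k_ge0 p : 0 <= k p.
Proof. by rewrite mulr_ge0//; apply: short_ge0 => //; exact: ltW. Qed.

Let int_k : \int[lZ]_p k p = 1 - q.
Proof. by rewrite integral_kern// integral_rho// mul1r (short_integral lam0 h).2. Qed.

(** The time shift of [v] is transferred to the kernel, where subtraction leaves the exponential
    density restricted to elapsed times below [h]. *)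
Let potential_short p : v p - q * v (p.1, p.2 - h) = stconv k w p.
Proof.
have mE := integrable_measurable iE.
have ikE : lZ.-integrable setT (EFin \o kern rho E) by exact: kern_integrable.
have iEh := preserving_integrable (preserving_shift (- h)) iE.
have ikEh := kern_integrable irho iEh.
have -> : v (p.1, p.2 - h) = stconv (kern rho (fun s => E (s - h))) w p.
  rewrite /potential /stconv.
  have ms : measurable_fun setT (fun p0 : Z => w (step (p.1, p.2 - h) p0)).
    exact: measurableT_comp mw (preserving_stepr _).1.
  rewrite -[LHS](preserving_Rintegral (preserving_spacetime 0 (- h))); last first.
    by apply: measurable_funM => //; exact: integrable_measurable ikE.
  apply: eq_Rintegral => r _; rewrite /kern /step/= addr0; congr (_ * w (_, _)).
  by ring.
rewrite /stconv -RintegralZl//; last exact: (conv_integrable p ikEh mw wC).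
rewrite -RintegralB//.
- by apply: eq_Rintegral => r _; rewrite /k /kern /S /short -/q; ring.
- exact: (conv_integrable p ikE mw wC).
- by apply: integrableZ_R; exact: (conv_integrable p ikEh mw wC).
Qed.

Let osc (p : Z) := \int[lZ]_r (k r * `|ut (step p r) - ut p|).
Let xosc (p : Z) := \int[leb N]_x (rho x * `|ut (p.1 + x, p.2) - ut p|).

Let ut_diff r p : `|ut r - ut p| <= C + C.
Proof. by apply: le_trans (ler_normB _ _) _; rewrite lerD. Qed.

Let osc_bound : lZ.-integrable setT (EFin \o osc) /\ \int[lZ]_p osc p <= D * (1 - q).
Proof.
have mstep : measurable_fun setT (fun pq : Z * Z => ut (step pq.1 pq.2)).
  by apply: (measurableT_comp mut); apply: measurable_step; mfun.
have mk := integrable_measurable ik.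
have mF : measurable_fun setT (fun pq : Z * Z => k pq.2 * `|ut (step pq.1 pq.2) - ut pq.1|).
  by mfun.
have mosc : measurable_fun setT osc by exact: (measurable_Rint2 lebZ mF).
apply: le_Rintegral_bound => //.
  by move=> p; apply: Rintegral_ge0 => r _; rewrite mulr_ge0.
rewrite -int_k; apply: le_trans (conv_modulus (D := D) ik k_ge0 mut _); last first.
  move=> r kr; apply: modulus.
    by apply: rho_supp; apply: contraNneq kr => r0; rewrite /k /kern r0 mul0r.
  have : S r.2 != 0 by apply: contraNneq kr => r0; rewrite /k /kern r0 mulr0.
  by move=> /(short_supp (ltW h0)) /andP[-> /ltW ->].
rewrite le_eqVlt; apply/orP; left; apply/eqP; apply: eq_integral => p _.
have ms : measurable_fun setT (fun r => `|ut (step p r) - ut p|).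
  have := measurableT_comp mut (preserving_stepr p).1 => m1.
  apply: measurableT_comp => //; apply: measurable_funB; [exact: m1|exact: measurable_cst].
rewrite Rintegral_ge0_fin// => [r|]; first by rewrite mulr_ge0.
have i1 : lZ.-integrable setT (EFin \o (fun r => k r * `|ut (step p r) - ut p|)).
  by apply: (integrableM_b (C := C + C)) => // r; rewrite normr_id.
apply: le_lt_trans ((integrable_nrm1 lZ (integrable_measurable i1)).1 i1).
rewrite /nrm1 le_eqVlt; apply/orP; left; apply/eqP; apply: eq_integral => r _.
by apply: congr1; apply/esym/ger0_norm; rewrite mulr_ge0.
Qed.

Let xosc_bound : lZ.-integrable setT (EFin \o xosc) /\ \int[lZ]_p xosc p <= D.
Proof.
have mF : measurable_fun setT (fun px : Z * X => rho px.2 * `|ut (px.1.1 + px.2, px.1.2) - ut px.1|).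
  have : measurable_fun setT (fun px : Z * X => ut (px.1.1 + px.2, px.1.2)) by mfun.
  by move=> m1; mfun.
have mxosc : measurable_fun setT xosc by exact: (measurable_Rint2 (leb N) mF).
apply: le_Rintegral_bound => //.
  by move=> p; apply: Rintegral_ge0 => x _; rewrite mulr_ge0.
rewrite -[D]mulr1 -(integral_rho rho1).
apply: le_trans (xconv_modulus (D := D) irho rho_ge0 mut _); last first.
  move=> x rx; have := modulus (rho_supp rx) (s := 0); rewrite lexx (ltW h0) => /(_ isT).
  by under [X in nrm1 _ X]eq_fun do rewrite subr0.
rewrite le_eqVlt; apply/orP; left; apply/eqP; apply: eq_integral => p _.
have ms : measurable_fun setT (fun x : X => `|ut (p.1 + x, p.2) - ut p|).
  have m1 : measurable_fun setT (fun x : X => ut (p.1 + x, p.2)) by mfun.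
  by apply: measurableT_comp => //; apply: measurable_funB => //; exact: measurable_cst.
rewrite Rintegral_ge0_fin// => [x|]; first by rewrite mulr_ge0.
have i1 : (leb N).-integrable setT (EFin \o (fun x => rho x * `|ut (p.1 + x, p.2) - ut p|)).
  by apply: (integrableM_b (C := C + C)) => // x; rewrite normr_id.
apply: le_lt_trans ((integrable_nrm1 _ (integrable_measurable i1)).1 i1).
rewrite /nrm1 le_eqVlt; apply/orP; left; apply/eqP; apply: eq_integral => x _.
by apply: congr1; apply/esym/ger0_norm; rewrite mulr_ge0.
Qed.

(** [primitive_flux] with [u'] running through the values of [ut] in the window and [a] the space
    mollification of [ut], integrated against the kernel of mass [1 - q]. Replacing [|ut - a|] by
    [xosc] makes the last error integrable. *)
Let flux_pointwise p : f p * stconv k w p <=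
  lam * ((1 - q) * (Phi (U p) - Phi (ut p)) + 2 * C * osc p + (1 - q) * C * xosc p).
Proof.
have a_dist : `|ut p - xconv rho ut p| <= xosc p.
  have i1 := xconv_integrable p irho mut utC.
  have E1 : ut p = \int[leb N]_x (ut p * rho x).
    by rewrite RintegralZl// integral_rho// mulr1.
  rewrite [X in X - _]E1 /xconv -RintegralB//; last exact: integrableZ_R.
  apply: le_Rintegral_norm.
  - by apply: integrableB_R => //; exact: integrableZ_R.
  - have ms : measurable_fun setT (fun x : X => `|ut (p.1 + x, p.2) - ut p|).
      have m1 : measurable_fun setT (fun x : X => ut (p.1 + x, p.2)) by mfun.
      by apply: measurableT_comp => //; apply: measurable_funB => //; exact: measurable_cst.
    by apply: (integrableM_b (C := C + C)) => // x; rewrite normr_id.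
  - by move=> x; rewrite mulrC -mulrBr normrM ger0_norm// distrC.
have q1 : 0 <= 1 - q by rewrite -int_k; exact: Rintegral_ge0.
rewrite /dissipation -mulrA ler_wpM2l ?(ltW lam0)//.
set a := xconv rho ut p.
have i2 := conv_integrable p ik mw wC.
have ms : measurable_fun setT (fun r => `|ut (step p r) - ut p|).
  have m1 := measurableT_comp mut (preserving_stepr p).1.
  by apply: measurableT_comp => //; apply: measurable_funB; [exact: m1|exact: measurable_cst].
have i3 : lZ.-integrable setT (EFin \o (fun r => k r * `|ut (step p r) - ut p|)).
  by apply: (integrableM_b (C := C + C)) => // r; rewrite normr_id.
apply: (@le_trans _ _ ((1 - q) * (Phi (U p) - Phi (ut p) + C * `|ut p - a|) + 2 * C * osc p)); last first.
  have H : (1 - q) * (C * `|ut p - a|) <= (1 - q) * (C * xosc p).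
    by apply: ler_wpM2l => //; exact: ler_wpM2l.
  exact: flux_balance H.
rewrite -int_k /stconv -(RintegralZl _ measurableT i2) /osc -(RintegralZl _ measurableT i3).
rewrite [_ * (_ + C * _)]mulrC -(RintegralZl _ measurableT ik) -RintegralD//; [|exact: integrableZ_R..].
apply: le_Rintegral => //; first exact: integrableZ_R.
  by apply: integrableD_R; exact: integrableZ_R.
move=> r _; have := primitive_flux mphi phi_nd phiC (U p) (ut p) (ut (step p r)) a.
move=> /(ler_wpM2l (k_ge0 r)); rewrite /w.
move: (Phi _) (Phi _) `|ut (step p r) - ut p| `|ut p - a| (phi _) (k r) => x1 x2 x3 x4 x5 x6.
by lra.
Qed.

Lemma energy_potential n :
  (\int[leb1]_(t in `]0%R, T[) trunc_energy (nu n) (fun x => v (x, t)) <=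
   (\int[leb N]_x Phi (u0 x) + 3 * C * lam * D)%:E)%E.
Proof.
have c0 : (fun j => C * truncation_error mu_levy rho j) @ \oo --> 0.
  rewrite -(mulr0 C); apply: cvgM; first exact: cvg_cst.
  apply: (@truncation_error_cvg R N mu mu_even mu_levy rho e grho rho_supp).
have reg := potential_regular mu_even mu_levy grho rho_supp rho_ge0 rho1 lam0 iut mw utC wC
  utT wT w_dom iu0 weak.
have mv := measurable_potential grho rho_ge0 rho1 lam0 mw.
have vC := potential_bound grho rho_ge0 rho1 lam0 mw wC.
have jf := dissipation_integrable grho rho_ge0 rho1 T lam0 iut iu0.
have fT (p : Z) : T <= p.2 -> f p = 0.
  by move=> pT; apply: dissipation_out => //; rewrite negb_and -!leNgt pT orbT.
have nuE := nu_even mu_even mu_levy.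
have nuM j l : (j <= l)%N -> forall A, measurable A -> (nu j A <= nu l A)%E.
  move=> jl A mA; rewrite /= /mfrestr /mrestr.
  rewrite le_measure ?inE//; [by apply: measurableI => //; exact: measurable_far..|].
  by apply: setIS; exact: far_sub.
apply: le_trans (time_energy nuE nuM c0 mv vC jf fT reg n) _.
rewrite lee_fin; set B := \int[lZ]_p (f p * v p).
have q1 : 0 < 1 - q.
  by rewrite subr_gt0 /q expR_lt1 mulNr oppr_lt0 mulr_gt0.
(* Dividing by [1 - q] loses nothing as [h] decreases: the short kernel has this mass, and the
   oscillation of [ut] against it is at most [D (1 - q)]. *)
rewrite -(ler_pM2l q1).
apply: le_trans (time_positivity nuE nuM c0 mv vC jf fT reg h0 (expR_ge0 _)) _.
have [io ob] := osc_bound; have [ix xb] := xosc_bound.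
have mPhi := measurable_primitive mphi.
have Phi_ge0 := primitive_ge0 mphi phi_nd phi0 phiC.
have PhiL d (Y : measurableType d) (m : {measure set Y -> \bar R}) (g : Y -> R) :
    m.-integrable setT (EFin \o g) -> m.-integrable setT (EFin \o (Phi \o g)).
  move=> ig; have mg := integrable_measurable ig.
  apply: (integrable_dom _ (integrableZ_R C (integrable_norm ig))).
    exact: measurableT_comp mPhi mg.
  by move=> y; exact: (primitive_le mphi phi_nd phi0 phiC).
have iU : lZ.-integrable setT (EFin \o U) by exact: averaged_integrable.
have iPU := PhiL _ _ _ _ iU; have iPut := PhiL _ _ _ _ iut; have iPu0 := PhiL _ _ _ _ iu0.
have iR1 : lZ.-integrable setT (EFin \o (fun p => Phi (U p) - Phi (ut p))) by exact: integrableB_R.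
have iR2 : lZ.-integrable setT (EFin \o (fun p => (1 - q) * (Phi (U p) - Phi (ut p)) + 2 * C * osc p)).
  by apply: integrableD_R; exact: integrableZ_R.
have iR3 : lZ.-integrable setT (EFin \o (fun p => (1 - q) * (Phi (U p) - Phi (ut p)) + 2 * C * osc p + (1 - q) * C * xosc p)).
  by apply: integrableD_R => //; exact: integrableZ_R.
have ile : \int[lZ]_p (f p * (v p - q * v (p.1, p.2 - h))) <=
    \int[lZ]_p (lam * ((1 - q) * (Phi (U p) - Phi (ut p)) + 2 * C * osc p + (1 - q) * C * xosc p)).
  apply: le_Rintegral => //; last first.
  - by move=> p _; rewrite potential_short; exact: flux_pointwise.
  - exact: integrableZ_R.
  - under eq_fun do rewrite potential_short.
    have mk := integrable_measurable ik.
    by apply: (integrableM_b _ jf (fun p => conv_bound p ik mw wC)); exact: measurable_conv.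
apply: le_trans ile _.
rewrite RintegralZl// RintegralD//; last exact: integrableZ_R.
rewrite RintegralD//; [|exact: integrableZ_R..].
rewrite !RintegralZl// RintegralB//.
have P0 := primitive0 phi.
(* After Jensen the integral of [Phi(ut)] cancels in the difference, leaving [lam^-1] times the
   integral of [Phi(u0)]. *)
have J : \int[lZ]_p Phi (U p) <= \int[lZ]_p `|Phi (ut p)| + lam^-1 * \int[leb N]_x `|Phi (u0 x)|.
  apply: le_trans (integral_averaged T grho rho_ge0 rho1 lam0 iPut iPu0).
  apply: le_Rintegral => //; first exact: averaged_integrable.
  move=> p _; have PC r : `|r| <= C -> `|Phi r| <= C * C.
    by move=> rC; apply: le_trans (primitive_le mphi phi_nd phi0 phiC r) _; rewrite ler_wpM2l.
  apply: (averaged_jensen grho rho_ge0 rho1 lam0 p mut utC utT mu0 u0C mPhi P0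
    (fun p' => PC _ (utC p')) (fun x => PC _ (u0C x))).
  exact: primitive_tangent mphi phi_nd phiC.
have E1 : \int[lZ]_p `|Phi (ut p)| = \int[lZ]_p Phi (ut p).
  by apply: eq_Rintegral => p _; rewrite ger0_norm.
have E2 : \int[leb N]_x `|Phi (u0 x)| = \int[leb N]_x Phi (u0 x).
  by apply: eq_Rintegral => x _; rewrite ger0_norm.
rewrite E1 E2 in J.
move: J ob xb q1; move: (\int[lZ]_p Phi (U p)) (\int[lZ]_p Phi (ut p)) (\int[lZ]_p osc p)
  (\int[lZ]_p xosc p) (\int[leb N]_x Phi (u0 x)) => x1 x2 x3 x4 x5 J ob xb q1.
by apply: balance.
Qed.

End energy_inequality.

(** * Passage to the limit *)

Section oscillation.
Context {R : realType} {N : nat}.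
Local Notation X := 'rV[R]_N.
Local Notation Z := (X * measurableTypeR R)%type.
Local Notation leb1 := (@lebesgue_measure R).
Local Notation lZ := (leb N \x leb1)%E.
Variables (rho : X -> R) (e lam : R).
Hypothesis irho : (leb N).-integrable setT (EFin \o rho).
Hypothesis rho_supp : forall x, rho x != 0 -> cube e x.
Hypothesis rho_ge0 : forall x, 0 <= rho x.
Hypothesis rho1 : \int[leb N]_x rho x = 1.
Hypothesis lam0 : 0 < lam.
Local Notation E := (exponential_pdf lam : measurableTypeR R -> R).
Variable g : Z -> R.
Hypothesis ig : lZ.-integrable setT (EFin \o g).

Definition oscillation (p : Z) : \bar R :=
  (\int[lZ]_q (kern rho E q * `|g (step p q) - g p|)%:E)%E.

Let mg : measurable_fun setT g. Proof. exact: integrable_measurable ig. Qed.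

Let iE : leb1.-integrable setT (EFin \o E).
Proof. exact: integrable_exponential_pdf. Qed.

Let mG (k : Z -> R) : measurable_fun setT k ->
  measurable_fun setT (fun pq : Z * Z => k pq.2 * `|g (step pq.1 pq.2) - g pq.1|).
Proof.
move=> mk; have mst : measurable_fun setT (fun pq : Z * Z => g (step pq.1 pq.2)).
  by apply: (measurableT_comp mg); apply: measurable_step; mfun.
by mfun.
Qed.

Let kern_ge0 K q : (forall s, 0 <= K s) -> 0 <= kern rho K q.
Proof. by move=> K0; rewrite mulr_ge0. Qed.

Let E_ge0 s : 0 <= E s. Proof. by rewrite exponential_pdf_ge0// ltW. Qed.

Lemma measurable_oscillation : measurable_fun setT oscillation.
Proof.
apply: (measurable_int2 lebZ (F := fun pq : Z * Z => kern rho E pq.2 * `|g (step pq.1 pq.2) - g pq.1|)).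
  by apply: mG; exact: measurable_kern.
by move=> p; rewrite mulr_ge0// kern_ge0.
Qed.

Lemma oscillation_ge0 p : (0 <= oscillation p)%E.
Proof. by apply: integral_ge0 => q _; rewrite lee_fin mulr_ge0// kern_ge0. Qed.

(** Elapsed times are split at [r]. Below [r] the modulus of continuity applies; the remaining mass
    [exp(- lam r)] is paid with twice the norm of [g]. *)
Lemma integral_oscillation (r D : R) : 0 <= r -> 0 <= D ->
  (forall x s, cube e x -> 0 <= s <= r ->
    (nrm1 lZ (fun p : Z => g (p.1 + x, p.2 - s) - g p)%R <= D%:E)%E) ->
  (\int[lZ]_p oscillation p <=
    (D + 2 * (\int[lZ]_p `|g p|) * expR (- lam * r))%:E)%E.
Proof.
move=> r0 D0 gD; set B := \int[lZ]_p `|g p|.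
have [iS intS] := short_integral lam0 r.
have [iL intL] := integral_exponential_tail lam0 r0.
pose S : measurableTypeR R -> R := short lam r.
pose L : measurableTypeR R -> R := fun s => E s * ind (r <= s).
have S_ge0 s : 0 <= S s by exact: short_ge0.
have L_ge0 s : 0 <= L s by rewrite mulr_ge0.
have ikS := kern_integrable irho iS; have ikL := kern_integrable irho iL.
have mkS := integrable_measurable ikS; have mkL := integrable_measurable ikL.
have kE q : kern rho E q = kern rho S q + kern rho L q.
  by rewrite /kern /S /L /short exponential_shift//; ring.
have mo (k : Z -> R) : measurable_fun setT k -> (forall q, 0 <= k q) -> measurable_fun setT
    (fun p : Z => \int[lZ]_q (k q * `|g (step p q) - g p|)%:E)%E.
  move=> mk k0; apply: (measurable_int2 lebZ (mG mk)) => p.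
  by rewrite mulr_ge0.
have ms p : measurable_fun setT (fun q => g (step p q)).
  exact: measurableT_comp mg (preserving_stepr p).1.
have mi (k : Z -> R) p : measurable_fun setT k ->
    measurable_fun setT (fun q => (k q * `|g (step p q) - g p|)%:E).
  move=> mk; apply/measurable_EFinP; apply: measurable_funM => //.
  by apply: measurableT_comp => //; apply: measurable_funB => //; exact: ms.
rewrite (_ : (\int[lZ]_p oscillation p = \int[lZ]_p (\int[lZ]_q (kern rho S q * `|g (step p q) - g p|)%:E +
    \int[lZ]_q (kern rho L q * `|g (step p q) - g p|)%:E))%E); last first.
  apply: eq_integral => p _; rewrite -ge0_integralD//.
  - by apply: eq_integral => q _; rewrite kE mulrDl.
  - by move=> q _; rewrite lee_fin mulr_ge0// kern_ge0.
  - exact: mi.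
  - by move=> q _; rewrite lee_fin mulr_ge0// kern_ge0.
  - exact: mi.
rewrite ge0_integralD//; last 4 first.
- by move=> p _; apply: integral_ge0 => q _; rewrite lee_fin mulr_ge0// kern_ge0.
- by apply: mo => // q; exact: kern_ge0.
- by move=> p _; apply: integral_ge0 => q _; rewrite lee_fin mulr_ge0// kern_ge0.
- by apply: mo => // q; exact: kern_ge0.
have h1 : (\int[lZ]_p \int[lZ]_q (kern rho S q * `|g (step p q) - g p|)%:E <= D%:E)%E.
  apply: le_trans (conv_modulus (D := D) ikS _ mg _) _ => //.
  - by move=> q; exact: kern_ge0.
  - move=> q; rewrite /kern mulf_eq0 negb_or => /andP[/rho_supp c1 /(short_supp r0)/andP[s0 sr]].
    by apply: gD; rewrite ?s0 ?ltW.
  - rewrite lee_fin integral_kern// rho1 mul1r intS ler_piMr// gerBl expR_ge0.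
have h2 : (\int[lZ]_p \int[lZ]_q (kern rho L q * `|g (step p q) - g p|)%:E <=
    (2 * B * expR (- lam * r))%:E)%E.
  apply: le_trans (conv_modulus (D := 2 * B) ikL _ mg _) _ => //.
  - by move=> q; exact: kern_ge0.
  - move=> q _; have ml : measurable_fun setT (fun p => g (step p q)).
      exact: measurableT_comp mg (preserving_stepl q).1.
    apply: le_trans (nrm1D lZ (g := fun p => - g p) ml _) _; first by mfun.
    rewrite mulr_natl mulr2n EFinD leeD//.
      rewrite Rintegral_nrm1// le_eqVlt; apply/orP; left; apply/eqP.
      by rewrite /nrm1 (preserving_ge0_integral (preserving_stepl q) (f := fun p => `|g p|%:E))//; exact: measurable_normE.
    rewrite Rintegral_nrm1// le_eqVlt; apply/orP; left; apply/eqP.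
    by apply: eq_integral => p _; rewrite normrN.
  - by rewrite lee_fin integral_kern// rho1 mul1r intL.
by rewrite EFinD; exact: leeD.
Qed.

End oscillation.

Lemma le_square_diff (R : realType) (C w1 w2 v1 v2 d1 d2 : R) :
  `|w1| <= C -> `|w2| <= C -> `|v1| <= C -> `|v2| <= C ->
  `|w1 - v1| <= d1 -> `|w2 - v2| <= d2 ->
  2^-1 * `|w1 - w2| ^+ 2 <= 2^-1 * `|v1 - v2| ^+ 2 + 2 * C * (d1 + d2).
Proof.
move=> w1C w2C v1C v2C d1C d2C; rewrite !real_normK ?num_real//.
have H : (w1 - w2) ^+ 2 - (v1 - v2) ^+ 2 <= 4 * C * (d1 + d2).
  rewrite subr_sqr; apply: le_trans (ler_norm _) _; rewrite normrM [leRHS]mulrC.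
  apply: ler_pM => //.
  - rewrite (_ : _ - _ = (w1 - v1) - (w2 - v2)); last by ring.
    by apply: le_trans (ler_normB _ _) _; exact: lerD.
  - apply: le_trans (ler_normD _ _) _; rewrite (_ : 4 * C = (C + C) + (C + C)); last by ring.
    by apply: lerD; apply: le_trans (ler_normB _ _) _; exact: lerD.
move: H; set a := (w1 - w2) ^+ 2; set b := (v1 - v2) ^+ 2.
move: a b (d1 + d2) => a b d; clear; move: C => c.
rewrite -(mulrA 4) -(mulrA 2); move: (c * d) => cd; lra.
Qed.

(** * Energies localized in cubes *)

Section local_energy.
Context {R : realType} {N : nat}.
Local Notation X := 'rV[R]_N.
Local Notation Z := (X * measurableTypeR R)%type.
Local Notation leb1 := (@lebesgue_measure R).
Local Notation lZ := (leb N \x leb1)%E.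
Variable nu : {finite_measure set X -> \bar R}.
Implicit Types a b : X -> R.

(** The jump [z] is confined as well as [x], so that both endpoints [x] and [x + z] lie in the cube
    of doubled radius, where the distance between [v] and [w] is under control. *)
Definition window (n : nat) (p : X * X) : R := \1_(cube n%:R) p.1 * \1_(cube n%:R) p.2.

Lemma measurable_window n : measurable_fun setT (window n).
Proof.
have mc : measurable_fun setT (\1_(cube n%:R : set X) : X -> R).
  by apply: measurable_indic; exact: measurable_cube.
by apply: measurable_funM; [exact: measurableT_comp mc measurable_fst|exact: measurableT_comp mc measurable_snd].
Qed.

Lemma window_ge0 n p : 0 <= window n p.
Proof. by rewrite mulr_ge0. Qed.

Definition local_energy n a : \bar R :=
  (\int[leb N]_x \int[nu]_z (window n (x, z) * square_diff a (x, z))%:E)%E.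

(** By [le_square_diff] each endpoint costs [2 C] times its deviation. Integrated against the jump
    measure, each gives the mass of [nu] times the integral of [o], for [x + z] by translation
    invariance; together this is [4 C]. *)
Lemma local_energy_le n a b (o : X -> \bar R) C : 0 <= C ->
  measurable_fun setT a -> measurable_fun setT b ->
  measurable_fun setT o -> (forall x, 0 <= o x)%E ->
  (forall x, `|a x| <= C) -> (forall x, `|b x| <= C) ->
  (forall x, cube (n%:R + n%:R) x -> `|a x - b x|%:E <= o x)%E ->
  (local_energy n a <= trunc_energy nu b + (4 * C * fine (nu setT))%:E * \int[leb N]_x o x)%E.
Proof.
move=> C0 ma mb mo o0 aC bC abo.
have mw := measurable_window n; have msa := measurable_square_diff ma.
have msb := measurable_square_diff mb.
have mo1 : measurable_fun setT (fun p : X * X => o p.1) by exact: measurableT_comp mo measurable_fst.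
have mo2 : measurable_fun setT (fun p : X * X => o (p.1 + p.2)) by apply: (measurableT_comp mo); mfun.
have mZ (f : X * X -> \bar R) k : measurable_fun setT f -> measurable_fun setT (fun p => k%:E * f p)%E.
  by move=> mf; exact: measurable_funeM.
have nuE : ((fine (nu setT))%:E = nu setT)%E by rewrite fineK// fin_num_measure.
rewrite /local_energy -(@fubini_tonelli1 _ _ _ _ _ (leb N) nu
   (fun p : X * X => (window n p * square_diff a p)%:E)); last 2 first.
- by apply/measurable_EFinP; exact: measurable_funM.
- by move=> p; rewrite lee_fin mulr_ge0// ?window_ge0// square_diff_ge0.
have -> : ((4 * C * fine (nu setT))%:E * \int[leb N]_x o x =
    \int[leb N \x nu]_p ((2 * C)%:E * o (p.1 + p.2)%R) + \int[leb N \x nu]_p ((2 * C)%:E * o p.1))%E.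
  have I1 : (\int[leb N \x nu]_p o p.1 = (fine (nu setT))%:E * \int[leb N]_x o x)%E.
    rewrite (@fubini_tonelli1 _ _ _ _ _ (leb N) nu (fun p : X * X => o p.1))//.
    rewrite /fubini_F /= -ge0_integralZl//; last by rewrite lee_fin fine_ge0.
    by apply: eq_integral => x _; rewrite integral_cst// nuE muleC.
  have I2 : (\int[leb N \x nu]_p o (p.1 + p.2)%R = (fine (nu setT))%:E * \int[leb N]_x o x)%E.
    rewrite (@fubini_tonelli2 _ _ _ _ _ (leb N) nu (fun p : X * X => o (p.1 + p.2)))//.
    rewrite /fubini_G /=; under eq_integral do rewrite (preserving_ge0_integral (preserving_leb _) mo o0).
    by rewrite integral_cst// nuE muleC.
  have C20 : 0 <= 2 * C by rewrite mulr_ge0.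
  rewrite !ge0_integralZl// I1 I2 !muleA -ge0_muleDl ?mule_ge0 ?lee_fin ?mulr_ge0 ?fine_ge0//.
  by rewrite -!EFinM -EFinD; congr (_%:E * _)%E; ring.
have C2 : forall y : \bar R, (0 <= y -> 0 <= (2 * C)%:E * y)%E.
  by move=> y y0; rewrite mule_ge0// lee_fin mulr_ge0.
rewrite trunc_energy_prod// -ge0_integralD//; [|by move=> p _; exact: C2|exact: mZ|by move=> p _; exact: C2|exact: mZ].
rewrite -ge0_integralD//; last 4 first.
- by move=> p _; rewrite lee_fin square_diff_ge0.
- exact/measurable_EFinP.
- by move=> p _; rewrite adde_ge0// C2.
- by apply: emeasurable_funD; exact: mZ.
apply: le_integral_ge0.
- by apply/measurable_EFinP; exact: measurable_funM.
- apply: emeasurable_funD; first exact/measurable_EFinP.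
  by apply: emeasurable_funD; exact: mZ.
move=> [x z]; rewrite lee_fin mulr_ge0 ?window_ge0 ?square_diff_ge0//=.
rewrite /window /= !indicE.
have [xn|_] := boolP (x \in cube n%:R); last first.
  by rewrite mul0r mul0r !adde_ge0 ?C2// lee_fin square_diff_ge0.
have [zn|_] := boolP (z \in cube n%:R); last first.
  by rewrite mulr0 mul0r !adde_ge0 ?C2// lee_fin square_diff_ge0.
rewrite !mul1r; move: xn zn; rewrite !inE => xn zn.
have c1 : cube (n%:R + n%:R) (x + z).
  by move=> i; rewrite mxE (le_trans (ler_normD _ _))// lerD.
have c2 : cube (n%:R + n%:R) x.
  by move=> i; rewrite (le_trans (xn i))// lerDl.
have := abo _ c1; have := abo _ c2; have := o0 x; have := o0 (x + z).
(* [o] may take the value [+oo]. If [C] is zero the product with it would be 0 instead of infinite,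
   but then [a] vanishes identically. *)
have CC : C = 0 \/ 0 < C.
  by move: C0; rewrite le_eqVlt => /predU1P[]; [left|right].
case: CC => [CE|CP].
  have a0 y : a y = 0 by apply/eqP; rewrite -normr_le0 -CE.
  move=> _ _ _ _; rewrite /square_diff /= !a0 subrr normr0 expr0n/= mulr0.
  by rewrite !adde_ge0 ?C2// lee_fin square_diff_ge0.
have C2P : 0 < 2 * C by rewrite mulr_gt0.
case: (o (x + z)) => [d1| |]// _ ox0; last first.
  rewrite (gt0_muley (_ : 0 < (2 * C)%:E)%E) ?lte_fin// addye ?addey ?leey//.
  by rewrite -ltNye (lt_le_trans ltNy0)// C2.
move: ox0; case: (o x) => [d2| |]// _; last first.
  by rewrite (gt0_muley (_ : 0 < (2 * C)%:E)%E) ?lte_fin// !addey ?leey.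
rewrite !lee_fin => h2 h1; rewrite -mulrDr; exact: le_square_diff.
Qed.

End local_energy.

Lemma kernel_deviation (R : realType) (N : nat) (k g : 'rV[R]_N * measurableTypeR R -> R) C p :
  (leb N \x @lebesgue_measure R)%E.-integrable setT (EFin \o k) -> (forall q, 0 <= k q) ->
  \int[(leb N \x @lebesgue_measure R)%E]_q k q = 1 ->
  measurable_fun setT g -> (forall q, `|g q| <= C) ->
  (`|stconv k g p - g p|%:E <=
     \int[(leb N \x @lebesgue_measure R)%E]_q (k q * `|g (step p q) - g p|)%:E)%E.
Proof.
move=> ik k0 k1 mg gC; have i1 := conv_integrable p ik mg gC.
rewrite (_ : stconv k g p - g p =
    \int[(leb N \x @lebesgue_measure R)%E]_q (k q * (g (step p q) - g p))).
  have mk := integrable_measurable ik.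
  have ms : measurable_fun setT (fun q => g (step p q)).
    exact: measurableT_comp mg (preserving_stepr p).1.
  have mF : measurable_fun setT (fun q => k q * (g (step p q) - g p)).
    by apply: measurable_funM => //; exact: measurable_funB.
  apply: le_trans (normr_Rintegral_le _ mF) _.
  rewrite le_eqVlt; apply/orP; left; apply/eqP; apply: eq_integral => q _.
  by rewrite normrM (ger0_norm (k0 q)).
have {1}-> : g p = g p * \int[(leb N \x @lebesgue_measure R)%E]_q k q by rewrite k1 mulr1.
rewrite -(RintegralZl (g p) measurableT ik) -(RintegralB measurableT i1 (integrableZ_R (g p) ik)).
by apply: eq_Rintegral => q _; rewrite mulrBr [g p * _]mulrC.
Qed.

Lemma measurable_iterated (R : realType) (N : nat) d (Y : measurableType d)
    (nu : {finite_measure set 'rV[R]_N -> \bar R}) (F : (Y * 'rV[R]_N) * 'rV[R]_N -> R) :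
  measurable_fun setT F -> (forall q, 0 <= F q) ->
  measurable_fun setT (fun t => \int[leb N]_x \int[nu]_z (F ((t, x), z))%:E)%E.
Proof.
move=> mF F0; have m1 := measurable_int2 nu mF F0.
apply: (measurable_fun_fubini_tonelli_F (m2 := leb N) _ m1).
by move=> q; apply: integral_ge0 => z _; rewrite lee_fin.
Qed.

Lemma budget (R : realFieldType) (a ep : R) : 0 <= a -> 0 <= ep -> a * (ep / (a + 1)) <= ep.
Proof.
move=> a0 ep0; rewrite mulrA ler_pdivrMr; last exact: ltr_wpDl.
by rewrite mulrC ler_wpM2l// lerDl.
Qed.

Lemma expRN_le (R : realType) (x : R) : 0 < x -> expR (- x) <= x^-1.
Proof.
move=> x0; rewrite expRN lef_pV2 ?posrE ?expR_gt0//.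
by apply: le_trans (expR_ge1Dx x); rewrite lerDr.
Qed.

(** * Choice of the parameters *)

Section local_energy_bound.
Context {R : realType} {N : nat}.
Local Notation X := 'rV[R]_N.
Local Notation Z := (X * measurableTypeR R)%type.
Local Notation leb1 := (@lebesgue_measure R).
Local Notation lZ := (leb N \x leb1)%E.
Variable mu : {measure set X -> \bar R}.
Hypothesis mu_even : even_measure mu.
Hypothesis mu_levy : levy_integrable mu.
Variables (phi : R -> R) (ut : Z -> R) (u0 : X -> R) (C T : R).
Hypothesis phi_cont : continuous phi.
Hypothesis phi_nd : {homo phi : a b / a <= b}.
Hypothesis phi0 : phi 0 = 0.
Hypothesis phiC : forall r, `|phi r| <= C.
Hypothesis iut : lZ.-integrable setT (EFin \o ut).
Hypothesis utC : forall p, `|ut p| <= C.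
Hypothesis utT : forall p : Z, ~~ (0 < p.2 < T) -> ut p = 0.
Hypothesis iu0 : (leb N).-integrable setT (EFin \o u0).
Hypothesis u0C : forall x, `|u0 x| <= C.
Hypothesis weak : forall (rho : X -> R) (e lam : R), gen rho ->
  (forall x, rho x != 0 -> cube e x) -> measurable_fun setT (levy_op mu rho) ->
  forall (y : X) tau n, 0 < tau < T ->
  \int[lZ]_p (ut p * (rho (p.1 - y) * time_test' lam tau n p.2) +
              phi (ut p) * (levy_op mu rho (p.1 - y) * time_test lam tau n p.2)) +
    \int[leb N]_x (u0 x * rho (x - y)) * time_test lam tau n 0 = 0.

Let C0 : 0 <= C. Proof. exact: le_trans (phiC 0). Qed.
Let mut : measurable_fun setT ut. Proof. exact: integrable_measurable iut. Qed.
Let mphi : measurable_fun setT phi. Proof. exact: continuous_measurable_fun. Qed.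
Let w (p : Z) := phi (ut p).
Let mw : measurable_fun setT w. Proof. exact: measurableT_comp mphi mut. Qed.
Let wC p : `|w p| <= C. Proof. exact: phiC. Qed.
Local Notation nu := (nu mu_levy).

Let box (a : R) : Z -> R :=
  kern (\1_(cube a : set X)) (\1_(`]0, T[%classic : set (measurableTypeR R))).

Let box_integrable a : lZ.-integrable setT (EFin \o box a).
Proof.
apply: kern_integrable.
  apply/integrable_nrm1; first by apply: measurable_indic; exact: measurable_cube.
  rewrite /nrm1; under eq_integral do rewrite ger0_norm//.
  rewrite integral_indic// ?setIT; last exact: measurable_cube.
  exact: leb_box_lty.
exact: integrable_indic_itv.
Qed.

Let boxE a p : cube a p.1 -> box a p * w p = w p.
Proof.
move=> pa; rewrite /box /kern !indicE (mem_set pa) mul1r.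
have [pT|pT] := boolP (0 < p.2 < T); first by rewrite mem_set ?mul1r//= in_itv.
by rewrite /w utT// phi0 mulr0.
Qed.

Let box01 a p : `|box a p| <= 1.
Proof. by rewrite /box /kern normrM !indicE !normr_nat; do 2 case: (_ \in _); rewrite ?mulr0 ?mulr1 ?mul0r. Qed.

Lemma local_energy_bound n :
  (\int[leb1]_(t in `]0%R, T[) local_energy (nu n) n (fun x => w (x, t)) <=
   (\int[leb N]_x primitive phi (u0 x))%:E)%E.
Proof.
apply/lee_addgt0Pr => ep ep0.
set m := fine (nu n setT); set K := 4 * C * m; set S := \int[leb N]_x _.
have m0 : 0 <= m by exact: fine_ge0.
have K0 : 0 <= K by rewrite !mulr_ge0.
(* Translations are continuous in L1 only for integrable functions, so [w] is cut to a cube. The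
   additional 1 is a margin for the support of the mollifier. *)
pose g p := box (n%:R + n%:R + 1) p * w p.
have ig : lZ.-integrable setT (EFin \o g) := integrableM_b mw (box_integrable _) wC.
have mg := integrable_measurable ig.
have gC p : `|g p| <= C.
  by rewrite /g normrM -[leRHS]mul1r; apply: ler_pM.
set B := \int[lZ]_p `|g p|.
have B0 : 0 <= B by exact: Rintegral_ge0.
(* Three errors receive [ep / 3] each. Adding 1 to the coefficient keeps the division meaningful
   when the coefficient is 0, here and in the choices below. *)
pose dl := ep / 3 / (K + 1).
have dl0 : 0 < dl by rewrite !divr_gt0// ltr_wpDl.
have [r1 r10 Hr1] := translation_L1 ig dl0.
(* Halving turns the non-strict bounds defining cubes into the strict ones required by
   [translation_L1]. *)
pose r := r1 / 2; have r0 : 0 < r by rewrite divr_gt0.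
pose et := ep / 3 / (2 * B * K + 1).
have et0 : 0 < et by rewrite !divr_gt0// ltr_wpDl// !mulr_ge0.
(* Since [exp(-x) <= 1/x], this choice makes the tail mass [exp(- lam r)] at most [et]. *)
pose lam := (et * r)^-1; have lam0 : 0 < lam by rewrite invr_gt0 mulr_gt0.
(* The modulus demanded of [ut] is fixed only after [lam], as it has to absorb the factor [3 C lam]
   of the energy inequality. *)
pose D := ep / 3 / (3 * C * lam + 1).
have D0 : 0 < D by rewrite !divr_gt0// ltr_wpDl// !mulr_ge0// ltW.
have [r2 r20 Hr2] := translation_L1 iut D0.
(* [h] is both the length of the time window and the radius of the mollifier: at most [r] for the
   oscillation of [g], [r2 / 2] for the modulus of [ut], and 1 for the margin of the cube. *)
pose h := Num.min (Num.min r (r2 / 2)) 1.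
have h0 : 0 < h by rewrite !lt_min r0 divr_gt0//= ltr01.
have hr : h <= r by rewrite !ge_min lexx.
have hr2 : h <= r2 / 2 by rewrite !ge_min lexx orbT.
have h1 : h <= 1 by rewrite ge_min lexx orbT.
have half (a : R) : 0 < a -> a / 2 < a by move=> a0; rewrite ltr_pdivrMr// ltr_pMr// ltr1n.
have [rho [grho rho_ge0 rho_supp rho1]] := mollifier_exists (N := N) h0.
have irho := rho_integrable grho rho_ge0 rho1.
have Irho := integral_rho rho1.
have mL := measurable_Lrho mu_even mu_levy grho rho_supp.
have modulus (x : X) s : cube h x -> 0 <= s <= h ->
    (nrm1 lZ (fun p : Z => ut (p.1 + x, p.2 - s) - ut p)%R <= D%:E)%E.
  move=> hx /andP[s0 sh]; apply: Hr2.
    by move=> i; apply: le_lt_trans (hx i) _; apply: le_lt_trans hr2 _; exact: half.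
  by rewrite normrN ger0_norm//; apply: le_lt_trans sh _; apply: le_lt_trans hr2 _; exact: half.
have EP := energy_potential mu_even mu_levy grho rho_supp rho_ge0 rho1 phi_cont phi_nd
  phi0 phiC lam0 h0 iut utC utT iu0 u0C (fun y tau n => weak lam grho rho_supp mL y n) modulus n.
rewrite -/w -/S in EP.
have OP : (\int[lZ]_p oscillation rho lam g p <= (dl + 2 * B * expR (- lam * r))%:E)%E.
  apply: (integral_oscillation irho rho_supp rho_ge0 Irho lam0 ig (ltW r0) (ltW dl0)).
  move=> x s hx /andP[s0 sr]; apply: Hr1.
    by move=> i; apply: le_lt_trans (hx i) _; apply: le_lt_trans hr _; exact: half.
  by rewrite normrN ger0_norm//; apply: le_lt_trans sr _; exact: half.
have mosc := measurable_oscillation irho rho_ge0 lam0 ig.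
have osc0 := oscillation_ge0 rho_ge0 lam0 g.
set v := potential rho w lam in EP.
have mv : measurable_fun setT v := measurable_potential grho rho_ge0 rho1 lam0 mw.
have vC p : `|v p| <= C by exact: potential_bound.
have dev p : cube (n%:R + n%:R) p.1 -> (`|w p - v p|%:E <= oscillation rho lam g p)%E.
  move=> pn; have gw : g p = w p by apply: boxE => i; rewrite (le_trans (pn i))// lerDl.
  have iE : leb1.-integrable setT (EFin \o (exponential_pdf lam : measurableTypeR R -> R)).
    exact: integrable_exponential_pdf.
  have kE q : kern rho (exponential_pdf lam) q * w (step p q) = kern rho (exponential_pdf lam) q * g (step p q).
    have [r0'|rn0] := eqVneq (rho q.1) 0; first by rewrite /kern r0' !mul0r.
    rewrite [g _]boxE// => i; rewrite mxE (le_trans (ler_normD _ _))// lerD//.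
    exact: le_trans (rho_supp _ rn0 i) h1.
  have -> : v p = stconv (kern rho (exponential_pdf lam)) g p.
    by apply: eq_Rintegral => q _; exact: kE.
  rewrite -gw distrC; apply: (kernel_deviation p (kern_integrable irho iE) _ _ mg gC).
    by move=> q; rewrite mulr_ge0// exponential_pdf_ge0// ltW.
  by rewrite integral_kern// Irho mul1r integral_E.
have mox t : measurable_fun setT (fun x : X => oscillation rho lam g (x, t)).
  by apply: (measurableT_comp mosc); mfun.
have mosct : measurable_fun setT (fun t : measurableTypeR R => \int[leb N]_x oscillation rho lam g (x, t))%E.
  exact: (measurable_fun_fubini_tonelli_G (m1 := leb N) _ mosc osc0).
have mwx t : measurable_fun setT (fun x : X => w (x, t)) by mfun.
have mvx t : measurable_fun setT (fun x : X => v (x, t)) by mfun.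
have mle : measurable_fun setT (fun t : measurableTypeR R => local_energy (nu n) n (fun x => w (x, t))).
  apply: (measurable_iterated (nu n) (F := fun q : (measurableTypeR R * X) * X =>
    window n (q.1.2, q.2) * square_diff (fun x => w (x, q.1.1)) (q.1.2, q.2))).
    have mwi := @measurable_window R N n.
    apply: measurable_funM; last by rewrite /square_diff; mfun.
    by apply: (measurableT_comp mwi); mfun.
  by move=> q; rewrite mulr_ge0 ?window_ge0 ?square_diff_ge0.
have mte : measurable_fun setT (fun t : measurableTypeR R => trunc_energy (nu n) (fun x => v (x, t))).
  apply: measurable_funeM.
  apply: (measurable_iterated (nu n) (F := fun q : (measurableTypeR R * X) * X =>
    `|v (q.1.2 + q.2, q.1.1) - v (q.1.2, q.1.1)| ^+ 2)) => //; mfun.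
have te0 t : (0 <= trunc_energy (nu n) (fun x => v (x, t)))%E.
  by rewrite mule_ge0//; do 2 apply: integral_ge0 => ? _; rewrite lee_fin sqr_ge0.
have oi0 t : (0 <= \int[leb N]_x oscillation rho lam g (x, t))%E by exact: integral_ge0.
apply: (@le_trans _ _ (\int[leb1]_(t in `]0%R, T[) (trunc_energy (nu n) (fun x => v (x, t)) +
    K%:E * \int[leb N]_x oscillation rho lam g (x, t)))%E).
  apply: ge0_le_integral => //.
  - by move=> t _; do 2 apply: integral_ge0 => ? _; rewrite lee_fin mulr_ge0 ?window_ge0 ?square_diff_ge0.
  - exact: measurable_funS mle.
  - by apply: (@measurable_funS _ _ _ _ setT) => //; apply: emeasurable_funD => //; exact: measurable_funeM.
  - by move=> t _; apply: (local_energy_le (nu n) C0 (mwx t) (mvx t) (mox t) (fun x => osc0 (x, t))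
      (fun x => wC (x, t)) (fun x => vC (x, t))) => x; exact: (dev (x, t)).
rewrite ge0_integralD//; last 3 first.
- exact: measurable_funS mte.
- by move=> t _; rewrite mule_ge0.
- by apply: (@measurable_funS _ _ _ _ setT) => //; exact: measurable_funeM.
rewrite ge0_integralZl//; last exact: measurable_funS mosct.
have LO : (\int[leb1]_(t in `]0%R, T[) \int[leb N]_x oscillation rho lam g (x, t) <=
    \int[lZ]_p oscillation rho lam g p)%E.
  rewrite (@fubini_tonelli2 _ _ _ _ _ (leb N) leb1 _ mosc osc0).
  exact: ge0_subset_integral.
apply: le_trans (leeD EP (lee_wpmul2l _ (le_trans LO OP))) _ => //.
rewrite -EFinM -!EFinD lee_fin -addrA lerD2l.
have ep3 : 0 <= ep / 3 by rewrite divr_ge0// ltW.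
have lam0' := ltW lam0.
have b1 : 3 * C * lam * D <= ep / 3.
  by apply: budget => //; rewrite !mulr_ge0.
have b2 : K * dl <= ep / 3 by exact: budget.
have b3 : K * (2 * B * expR (- lam * r)) <= ep / 3.
  apply: (@le_trans _ _ (2 * B * K * et)); last first.
    by apply: budget => //; rewrite !mulr_ge0.
  rewrite mulrA [K * _]mulrC ler_wpM2l ?mulr_ge0// mulNr.
  apply: le_trans (expRN_le _) _; first by rewrite mulr_gt0.
  by rewrite /lam invfM invrK -mulrA mulfV ?mulr1// gt_eqF.
rewrite (_ : ep = ep / 3 + (ep / 3 + ep / 3)); last by field.
by rewrite mulrDr; apply: lerD => //; exact: lerD.
Qed.

End local_energy_bound.

Section monotone_limit.
Context d (Y : measurableType d) (R : realType) (m : {measure set Y -> \bar R}).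
Variables (D : set Y) (F_ : nat -> Y -> \bar R) (F : Y -> \bar R).
Hypothesis mD : measurable D.
Hypothesis mF : forall n, measurable_fun D (F_ n).
Hypothesis F0 : forall n y, (0 <= F_ n y)%E.
Hypothesis ndF : forall y n k, (n <= k)%N -> (F_ n y <= F_ k y)%E.
Hypothesis FF : forall y, F_ ^~ y @ \oo --> F y.

Lemma monotone_limit : (\int[m]_(y in D) F_ n y)%E @[n --> \oo] --> (\int[m]_(y in D) F y)%E.
Proof.
have -> : (\int[m]_(y in D) F y = \int[m]_(y in D) limn (F_ ^~ y))%E.
  by apply: eq_integral => y _; rewrite (cvg_lim _ (@FF y)).
by apply: cvg_monotone_convergence => // y _ n k; exact: ndF.
Qed.

Lemma monotone_integral n k : (n <= k)%N ->
  (\int[m]_(y in D) F_ n y <= \int[m]_(y in D) F_ k y)%E.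
Proof. by move=> nk; apply: ge0_le_integral => // y _; exact: ndF. Qed.

End monotone_limit.

(** * Removal of the truncation and of the localization *)

Section energy_limit.
Context {R : realType} {N : nat}.
Local Notation X := 'rV[R]_N.
Local Notation Z := (X * measurableTypeR R)%type.
Local Notation leb1 := (@lebesgue_measure R).
Local Notation lZ := (leb N \x leb1)%E.
Variable mu : {measure set X -> \bar R}.
Hypothesis mu_levy : levy_integrable mu.
Local Notation nu := (nu mu_levy).
Implicit Types a b : X -> R.

Lemma cube_absorbs (x : X) n0 : exists n : nat, (n0 <= n)%N /\ cube n%:R x.
Proof.
exists (maxn n0 (Num.Def.trunc (\sum_i `|x 0 i|)).+1); split; first exact: leq_maxl.
move=> i; apply: (@le_trans _ _ (Num.Def.trunc (\sum_i `|x 0 i|)).+1%:R); last first.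
  by rewrite ler_nat leq_maxr.
apply: le_trans (ltW (truncnS_gt _)).
by rewrite (bigD1 i)//= lerDl sumr_ge0.
Qed.

Lemma cube_mono j k : (j <= k)%N -> cube j%:R `<=` (cube k%:R : set X).
Proof. by move=> jk x xj i; apply: le_trans (xj i) _; rewrite ler_nat. Qed.

Lemma window_mono j k (p : X * X) : (j <= k)%N -> window j p <= window k p.
Proof.
move=> jk; have H (x : X) : \1_(cube j%:R) x <= \1_(cube k%:R) x :> R.
  rewrite !indicE ler_nat; have [|_] := boolP (x \in _); last by [].
  by rewrite inE => /(cube_mono jk) xk; rewrite mem_set.
by apply: ler_pM.
Qed.

Lemma window_eventually (p : X * X) : \forall n \near \oo, window n p = 1.
Proof.
have [n1 [_ h1]] := cube_absorbs p.1 0; have [n2 [n12 h2]] := cube_absorbs p.2 n1.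
near=> n; have n2n : (n2 <= n)%N by near: n; exact: nbhs_infty_ge.
rewrite /window !indicE !mem_set ?mulr1//; first exact: cube_mono h2.
exact: cube_mono (leq_trans n12 n2n) _ h1.
Unshelve. all: by end_near. Qed.

Lemma far_eventually (z : X) : \forall n \near \oo, \1_(far n) z = \1_[set~ 0] z :> R.
Proof.
have [->|z0] := eqVneq z 0.
  have e0 : euclid_norm (0 : X) = 0.
    by rewrite /euclid_norm big1 ?sqrtr0// => i _; rewrite mxE expr0n.
  apply: nearW => n; have f0 : ~ far n (0 : X) by rewrite /far/= e0; apply/negP; rewrite -leNgt.
  have z0 : ~ [set~ 0] (0 : X) by apply.
  by rewrite !indicE (memNset f0) (memNset z0).
have zp : 0 < euclid_norm z.
  by rewrite lt_neqAle eq_sym euclid_ge0 andbT; apply: contra_neq z0; exact: euclid_eq0.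
have zn0 : [set~ 0] z by move=> zE; rewrite zE eqxx in z0.
near=> n; have fz : far n z by near: n; exact: (near_infty_natSinv_lt (PosNum zp)).
by rewrite !indicE (mem_set fz) (mem_set zn0).
Unshelve. all: by end_near. Qed.

Definition kernel_square a (p : X * X) : R := `|a (p.1 + p.2) - a p.1| ^+ 2.

Let measurable_square a : measurable_fun setT a -> measurable_fun setT (kernel_square a).
Proof. by move=> ma; rewrite /kernel_square; mfun. Qed.

Let square_ge0 a p : 0 <= kernel_square a p.
Proof. exact: sqr_ge0. Qed.

Let inner_limit a (x : X) : measurable_fun setT a ->
  (\int[nu n]_z (window n (x, z) * kernel_square a (x, z))%:E)%E @[n --> \oo] -->
    (\int[mu]_(z in [set~ 0%R]) (kernel_square a (x, z))%:E)%E /\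
  forall n k, (n <= k)%N ->
    (\int[nu n]_z (window n (x, z) * kernel_square a (x, z))%:E <=
     \int[nu k]_z (window k (x, z) * kernel_square a (x, z))%:E)%E.
Proof.
move=> ma; have ms := measurable_square ma; have mP := @measurable_punctured R N.
pose F_ n z := (\1_(far n) z * (window n (x, z) * kernel_square a (x, z)))%:E.
have mww n : measurable_fun setT (fun z => window n (x, z) * kernel_square a (x, z)).
  by have mw := @measurable_window R N n; mfun.
have FE n : (\int[nu n]_z (window n (x, z) * kernel_square a (x, z))%:E = \int[mu]_z F_ n z)%E.
  rewrite integral_nu; last exact/measurable_EFinP.
  rewrite integral_mkcond; apply: eq_integral => z _; rewrite /F_ patchE indicE.
  by case: ifPn => _; rewrite ?mul1r ?mul0r.
have GE : (\int[mu]_(z in [set~ 0%R]) (kernel_square a (x, z))%:E =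
    \int[mu]_z (\1_[set~ 0%R] z * kernel_square a (x, z))%:E)%E.
  rewrite integral_mkcond; apply: eq_integral => z _; rewrite patchE indicE.
  by case: ifPn => _; rewrite ?mul1r ?mul0r.
under eq_fun do rewrite FE.
have mF n : measurable_fun setT (F_ n).
  apply/measurable_EFinP; apply: measurable_funM => //.
  by apply: measurable_indic; exact: measurable_far.
have F0 n z : (0 <= F_ n z)%E by rewrite lee_fin !mulr_ge0// ?window_ge0.
have ndF z n k : (n <= k)%N -> (F_ n z <= F_ k z)%E.
  move=> nk; rewrite lee_fin; apply: ler_pM => //.
  - by rewrite mulr_ge0 ?window_ge0.
  - rewrite !indicE ler_nat; have [|_] := boolP (z \in _); last by [].
    by rewrite inE => /(far_sub nk) zk; rewrite mem_set.
  - by rewrite ler_wpM2r// window_mono.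
split; last by move=> n k nk; rewrite !FE; exact: monotone_integral.
rewrite GE; apply: monotone_limit => // z.
apply: cvg_near_cst; have := far_eventually z; have := window_eventually (x, z).
by apply: filterS2 => n w1 f1; rewrite /F_ f1 w1 mul1r.
Qed.

Let outer a n : \bar R :=
  (\int[leb N]_x \int[nu n]_z (window n (x, z) * kernel_square a (x, z))%:E)%E.

Let outer_limit a : measurable_fun setT a ->
  outer a @ \oo --> (\int[leb N]_x \int[mu]_(z in [set~ 0%R]) (kernel_square a (x, z))%:E)%E /\
  forall n k, (n <= k)%N -> (outer a n <= outer a k)%E.
Proof.
move=> ma; have ms := measurable_square ma.
have mF n : measurable_fun setT (fun x =>
    \int[nu n]_z (window n (x, z) * kernel_square a (x, z))%:E)%E.
  apply: (measurable_int2 (nu n) (F := fun p => window n p * kernel_square a p)).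
    by have mw := @measurable_window R N n; mfun.
  by move=> p; rewrite mulr_ge0 ?window_ge0.
have F0 n x : (0 <= \int[nu n]_z (window n (x, z) * kernel_square a (x, z))%:E)%E.
  by apply: integral_ge0 => z _; rewrite lee_fin mulr_ge0 ?window_ge0.
have ndF x n k : (n <= k)%N -> (\int[nu n]_z (window n (x, z) * kernel_square a (x, z))%:E <=
     \int[nu k]_z (window k (x, z) * kernel_square a (x, z))%:E)%E.
  by have [_] := inner_limit x ma; exact.
split; last by move=> n k; exact: (monotone_integral (leb N) measurableT mF F0 ndF).
apply: (monotone_limit (m := leb N) measurableT mF F0 ndF) => x.
by have [] := inner_limit x ma.
Qed.

Lemma local_energyE a n : measurable_fun setT a -> local_energy (nu n) n a = (2^-1%:E * outer a n)%E.
Proof.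
move=> ma; have ms := measurable_square ma; have mw := @measurable_window R N n.
rewrite -ge0_integralZl//; last 2 first.
- apply: (measurable_int2 (nu n) (F := fun p => window n p * kernel_square a p)); first by mfun.
  by move=> p; rewrite mulr_ge0 ?window_ge0.
- by move=> x _; apply: integral_ge0 => z _; rewrite lee_fin mulr_ge0 ?window_ge0.
apply: eq_integral => x _; rewrite -integralZl_ge0//; last 2 first.
- by mfun.
- by move=> z; rewrite mulr_ge0 ?window_ge0.
by apply: eq_integral => z _; rewrite mulrCA.
Qed.

Lemma measurable_local_energy (w : Z -> R) n : measurable_fun setT w ->
  measurable_fun setT (fun t : measurableTypeR R => local_energy (nu n) n (fun x => w (x, t))).
Proof.
move=> mw; apply: (measurable_iterated (nu n) (F := fun q : (measurableTypeR R * X) * X =>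
  window n (q.1.2, q.2) * square_diff (fun x => w (x, q.1.1)) (q.1.2, q.2))).
  have mwi := @measurable_window R N n.
  apply: measurable_funM; last by rewrite /square_diff; mfun.
  by apply: (measurableT_comp mwi); mfun.
by move=> q; rewrite mulr_ge0 ?window_ge0 ?square_diff_ge0.
Qed.

(** One index [n] opens the cubes and removes the truncation of the measure. Both effects are
    monotone, so monotone convergence applies in [z], then in [x], then in [t]. *)
Lemma energy_limit (w : Z -> R) T : measurable_fun setT w ->
  (\int[leb1]_(t in `]0%R, T[) local_energy (nu n) n (fun x => w (x, t)))%E @[n --> \oo] -->
  energy_time mu T w.
Proof.
move=> mw; have mwx t : measurable_fun setT (fun x : X => w (x, t)) by mfun.
apply: monotone_limit => //.
- by move=> n; apply: measurable_funS (measurable_local_energy n mw).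
- move=> n t; do 2 apply: integral_ge0 => ? _.
  by rewrite lee_fin mulr_ge0 ?window_ge0 ?square_diff_ge0.
- move=> t n k nk; rewrite !(local_energyE _ (mwx t)) lee_wpmul2l ?lee_fin//.
  by have [_] := outer_limit (mwx t); exact.
- move=> t; under eq_fun do rewrite local_energyE//.
  by apply: cvgeZl => //; have [] := outer_limit (mwx t).
Qed.

(** With [z] outside, which Tonelli allows, the values at [x + z] change only for [x] in a translate
    of a null set. *)
Lemma local_energy_ae a b n : measurable_fun setT a -> measurable_fun setT b ->
  {ae leb N, forall x, a x = b x} -> local_energy (nu n) n a = local_energy (nu n) n b.
Proof.
move=> ma mb ab; have mw := @measurable_window R N n.
have mF (c : X -> R) : measurable_fun setT c ->
    measurable_fun setT (fun p : X * X => window n p * square_diff c p).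
  by move=> mc; apply: measurable_funM; [exact: mw|exact: measurable_square_diff].
have F0 (c : X -> R) p : 0 <= window n p * square_diff c p by rewrite mulr_ge0 ?window_ge0 ?square_diff_ge0.
rewrite /local_energy (@tonelli _ _ _ _ _ (leb N) (nu n) _ (mF _ ma) (F0 a)).
rewrite (@tonelli _ _ _ _ _ (leb N) (nu n) _ (mF _ mb) (F0 b)).
apply: eq_integral => z _; apply: ae_eq_integral => //.
- by have := mF _ ma => mFa; apply/measurable_EFinP; apply: (measurableT_comp mFa); mfun.
- by have := mF _ mb => mFb; apply/measurable_EFinP; apply: (measurableT_comp mFb); mfun.
have abz := preserving_ae (preserving_leb z) ab.
apply: (filterS2 _ _ ab abz) => x /= e1 e2 _.
by rewrite /square_diff /= e1 e2.
Qed.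

End energy_limit.

Lemma clamp_homo (R : realType) (M : R) : {homo clamp M : a b / a <= b}.
Proof.
move=> a b ab; rewrite /clamp le_min !ge_min lexx orbT andbT; apply/orP; left.
by rewrite ge_max !le_max ab lexx/= orbT.
Qed.

Lemma clamp_continuous (R : realType) (M : R) : continuous (clamp M).
Proof.
move=> r; apply: (@continuous_min _ _ (fun r => Num.max r (- M)) (fun=> M)); last exact: cst_continuous.
by apply: (@continuous_max _ _ (fun r => r) (fun=> - M)); [exact: cvg_id|exact: cst_continuous].
Qed.

(** * The bound by the norms of the datum *)

Section norm_bound.
Context {R : realType} {N : nat}.
Local Notation X := 'rV[R]_N.
Variables (phi : R -> R) (u0 P : X -> R) (C : R).
Hypothesis iu0 : (leb N).-integrable setT (EFin \o u0).
Hypothesis mP : measurable_fun setT P.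
Hypothesis P0 : forall x, 0 <= P x.
Hypothesis Pu : {ae leb N, forall x, P x <= `|phi (u0 x)| * `|u0 x|}.
Hypothesis phiC : {ae leb N, forall x, `|phi (u0 x)| <= C}.

(** The norm with exponent [+oo] is the essential supremum only when the whole space has positive
    measure. *)
Let lebT : (0 < leb N [set: X])%E.
Proof.
apply: (@lt_le_trans _ _ (leb N (cube 1))).
  by rewrite leb_cube// lte_fin exprn_gt0// mulrn_wgt0.
by apply: le_measure => //; rewrite inE//; exact: measurable_cube.
Qed.

Let sup_normE : 'N[leb N]_+oo[EFin \o (phi \o u0)]%E = ess_sup (leb N) (abse \o (EFin \o (phi \o u0))).
Proof. by rewrite unlock lebT. Qed.

Let mu0 : measurable_fun setT u0. Proof. exact: integrable_measurable iu0. Qed.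

Lemma integral_le_Lnorm :
  (\int[leb N]_x (P x)%:E <=
    'N[leb N]_+oo[EFin \o (phi \o u0)] * 'N[leb N]_1[EFin \o u0])%E.
Proof.
have A0 := Lnorm_ge0 (leb N) +oo (EFin \o (phi \o u0)).
rewrite Lnorm1 -ge0_integralZl//; last first.
  by apply/measurable_EFinP; apply: measurableT_comp.
have mE : measurable_fun setT (fun x => `|(EFin \o u0) x|)%E.
  by apply/measurable_EFinP; apply: measurableT_comp.
apply: integral_le_ae.
- by mfun.
- exact: measurable_funeM.
- by [].
- by move=> x; rewrite mule_ge0.
have := ess_sup_ge (leb N) (abse \o (EFin \o (phi \o u0))); rewrite -sup_normE.
apply: (filterS2 _ _ Pu) => x Px /= Ax.
by apply: (@le_trans _ _ (`|phi (u0 x)| * `|u0 x|)%:E) => //; rewrite EFinM lee_wpmul2r.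
Qed.

Lemma Lnorm_product_lty :
  ('N[leb N]_+oo[EFin \o (phi \o u0)] * 'N[leb N]_1[EFin \o u0] < +oo)%E.
Proof.
have A0 := Lnorm_ge0 (leb N) +oo (EFin \o (phi \o u0)).
have AC : ('N[leb N]_+oo[EFin \o (phi \o u0)] <= C%:E)%E.
  by rewrite sup_normE; apply/ess_supP; apply: filterS phiC => x /=; rewrite lee_fin.
have Afin : 'N[leb N]_+oo[EFin \o (phi \o u0)]%E \is a fin_num.
  by rewrite ge0_fin_numE//; apply: le_lt_trans AC (ltry _).
rewrite Lnorm1 -(fineK Afin) lte_mul_pinfty//; first by rewrite lee_fin fine_ge0.
exact: (integrable_nrm1 (leb N) mu0).1 iu0.
Qed.

End norm_bound.

Theorem corollary2p20 (R : realType) (N : nat) (hN : (0 < N)%N)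
    (T : R) (hT : 0 < T)
    (phi : R -> R) (phi_cont : continuous phi)
    (phi_nd : {homo phi : a b / a <= b}) (phi0 : phi 0 = 0)
    (mu : {measure set 'rV[R]_N -> \bar R}) (mu0 : mu [set 0] = 0%E)
    (mu_radon : radon_punctured mu) (mu_even : even_measure mu)
    (mu_levy : levy_integrable mu)
    (u0 : 'rV[R]_N -> R) (u0_L1 : in_L1 (lebesgue_rV N) setT u0)
    (u0_Linfty : in_Linfty (lebesgue_rV N) setT u0)
    (u : 'rV[R]_N * R -> R) (u_L1 : in_L1 lebesgue_spacetime (QT T) u)
    (u_Linfty : in_Linfty lebesgue_spacetime (QT T) u)
    (u_C : in_C_L1loc T u)
    (u_sol : distributional_solution T phi mu u0 u) :
  (energy_time mu T (phi \o u) <=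
     'N[lebesgue_rV N]_+oo[EFin \o (phi \o u0)] *
     'N[lebesgue_rV N]_1[EFin \o u0])%E /\
  ('N[lebesgue_rV N]_+oo[EFin \o (phi \o u0)] *
     'N[lebesgue_rV N]_1[EFin \o u0] < +oo)%E.
Proof.
pose X := 'rV[R]_N; pose Z := (X * measurableTypeR R)%type.
pose leb1 := @lebesgue_measure R; pose lZ := (leb N \x leb1)%E.
have iu0 : (leb N).-integrable setT (EFin \o u0) := u0_L1.
have iu : lZ.-integrable (QT T : set Z) (EFin \o (u : Z -> R)) := u_L1.
have [_ [M1 uM1]] := u_Linfty; have [_ [M2 u0M2]] := u0_Linfty.
pose M := `|M1| + `|M2|; have M0 : 0 <= M by exact: addr_ge0.
have uM : {ae lZ, forall p : Z, QT T p -> `|u p| <= M}.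
  apply: filterS uM1 => p H /H pM; apply: le_trans pM _.
  by apply: le_trans (ler_norm _) _; rewrite lerDl.
have u0M : {ae leb N, forall x, `|u0 x| <= M}.
  apply: filterS u0M2 => x /(_ I) xM; apply: le_trans xM _.
  by apply: le_trans (ler_norm _) _; rewrite lerDr.
have mphi : measurable_fun setT phi by exact: continuous_measurable_fun.
have mu0' := integrable_measurable iu0.
(* Bounded, still continuous and nondecreasing, and equal to [phi] on the range of the clamped
   functions. *)
pose phic := phi \o clamp M.
have phic_cont : continuous phic.
  by move=> r; apply: continuous_comp; [exact: clamp_continuous|exact: phi_cont].
have phic_nd : {homo phic : a b / a <= b} by move=> a b ab; apply: phi_nd; exact: clamp_homo.
have phicE r : `|r| <= M -> phic r = phi r by move=> rM; rewrite /phic/= clampE.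
have phic0 : phic 0 = 0 by rewrite phicE ?normr0.
(* A single constant has to bound the solution, the datum and the nonlinearity; monotonicity bounds
   the latter by its values at the two ends of the interval. *)
pose C := M + (`|phi M| + `|phi (- M)|).
have MC : M <= C by rewrite lerDl addr_ge0.
have phicC r : `|phic r| <= C.
  apply: (@le_trans _ _ (`|phi M| + `|phi (- M)|)); last by rewrite lerDr.
  have /ler_normlP[c1 c2] := clamp_bound r M0.
  have l1 : phi (- M) <= phic r by apply: phi_nd; rewrite lerNl.
  have l2 : phic r <= phi M by exact: phi_nd.
  rewrite ler_norml; apply/andP; split.
    rewrite lerNl; apply: (@le_trans _ _ (- phi (- M))); first by rewrite lerN2.
    by apply: le_trans (ler_norm _) _; rewrite normrN lerDr.
  by apply: le_trans l2 _; apply: le_trans (ler_norm _) _; rewrite lerDl.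
have mphic : measurable_fun setT phic by exact: continuous_measurable_fun.
pose ut : Z -> R := cutoff T M u.
have utM p : `|ut p| <= M by exact: cutoff_bound.
have utC p : `|ut p| <= C := le_trans (utM p) MC.
have iut : lZ.-integrable setT (EFin \o ut) by exact: cutoff_integrable.
pose u0c x := clamp M (u0 x).
have mu0c : measurable_fun setT u0c := measurableT_comp (measurable_clamp M) mu0'.
have u0cE : {ae leb N, forall x, u0 x = u0c x}.
  by apply: filterS u0M => x xM; rewrite /u0c clampE.
have iu0c : (leb N).-integrable setT (EFin \o u0c).
  by apply: (integrable_dom mu0c (integrable_norm iu0)) => x; exact: clamp_le.
have u0cM x : `|u0c x| <= M by exact: clamp_bound.
have u0cC x : `|u0c x| <= C := le_trans (u0cM x) MC.
have weak (rho : X -> R) (e lam : R) : gen rho -> (forall x, rho x != 0 -> cube e x) ->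
    measurable_fun setT (levy_op mu rho) -> forall (y : X) tau n, 0 < tau < T ->
    \int[lZ]_p (ut p * (rho (p.1 - y) * time_test' lam tau n p.2) +
                phic (ut p) * (levy_op mu rho (p.1 - y) * time_test lam tau n p.2)) +
      \int[leb N]_x (u0c x * rho (x - y)) * time_test lam tau n 0 = 0.
  move=> grho rho_supp mL y tau n tT.
  rewrite -[RHS](weak_product mu_levy phi_cont phi0 iu uM iu0 u_sol lam grho rho_supp mL y n tT).
  congr (_ + _ * _); first by apply: eq_Rintegral => p _; rewrite phicE.
  have mr : measurable_fun setT (fun x : X => rho (x - y)) by have := measurable_rho grho => mr; mfun.
  by apply: ae_eq_Rintegral; [mfun|mfun|apply: filterS u0cE => x ->].
have bound n := local_energy_bound mu_even mu_levy phic_cont phic_nd phic0 phicC iut utC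
  (@cutoff_out _ _ T M u) iu0c u0cC weak n.
have mres : measurable_fun setT ((u : Z -> R) \_ (QT T)).
  apply/(measurable_restrictT _ (@measurable_QT R N T)).
  by case/integrableP : iu => /measurable_EFinP.
(* The energy to be bounded is that of the given representative [u], which is measurable on the slab
   only. Extending [u] by zero makes it measurable everywhere without changing it at times in (0,
   T). *)
pose w : Z -> R := phi \o ((u : Z -> R) \_ (QT T)).
have mw : measurable_fun setT w by exact: measurableT_comp mphi mres.
have mut := integrable_measurable iut.
have mF : measurable_fun setT (fun p : Z => ((u : Z -> R) \_ (QT T)) p - ut p) by exact: measurable_funB.
have F0 : (\int[leb N \x leb1]_p `|((u : Z -> R) \_ (QT T)) p - ut p|%:E = 0)%E.
  have mFE : measurable_fun setT (fun p : Z => (((u : Z -> R) \_ (QT T)) p - ut p)%:E).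
    exact/measurable_EFinP.
  apply: (ae_eq_integral_abs lZ measurableT mFE).2.
  apply: filterS (cutoff_ae uM) => p H _; rewrite patchE; case: ifPn => [|/negP].
    by rewrite inE => /H uE; rewrite -/ut /= uE subrr.
  by rewrite inE => pT; rewrite /ut cutoff_out ?subrr//; exact/negP.
(* Agreement almost everywhere in space-time gives, at almost every time, agreement almost
   everywhere in space, which is what [local_energy_ae] consumes. *)
have secs := ae_sections mF F0.
have -> : energy_time mu T (phi \o u) = energy_time mu T w.
  apply: eq_integral => t; rewrite inE/= in_itv/= => tT; congr energy.
  by apply/funext => x; rewrite /w/= patchE mem_set.
have lim := @energy_limit _ _ _ mu_levy w T mw.
set S := \int[leb N]_x primitive phic (u0c x) in bound.
have boundw n : (\int[leb1]_(t in `]0%R, T[) local_energy (nu mu_levy n) n (fun x => w (x, t)) <= S%:E)%E.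
  apply: le_trans (bound n); rewrite le_eqVlt; apply/orP; left; apply/eqP.
  have mphicut : measurable_fun setT (phic \o ut) := measurableT_comp mphic mut.
  apply: ae_eq_integral => //.
  - exact: measurable_funS (measurable_local_energy mu_levy n mw).
  - exact: measurable_funS (measurable_local_energy mu_levy n mphicut).
  apply: filterS secs => t sec _.
  apply: local_energy_ae; [by mfun|by have := mphicut => mm; apply: (measurableT_comp mm); mfun|].
  apply: filterS sec => x /eqP; rewrite subr_eq0 => /eqP E.
  by rewrite /w /= E phicE.
have enS : (energy_time mu T w <= S%:E)%E.
  rewrite -(cvg_lim _ lim)//; apply: lime_le; first by apply/cvg_ex; eexists; exact: lim.
  exact: nearW.
have phiu0C : {ae leb N, forall x, `|phi (u0 x)| <= C}.
  by apply: filterS u0M => x xM; rewrite -phicE.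
have mP : measurable_fun setT (primitive phic \o u0c).
  exact: measurableT_comp (measurable_primitive mphic) mu0c.
have P0 x : 0 <= (primitive phic \o u0c) x by exact: primitive_ge0 mphic phic_nd phic0 phicC _.
have Pu : {ae leb N, forall x, (primitive phic \o u0c) x <= `|phi (u0 x)| * `|u0 x|}.
  apply: filterS2 u0M u0cE => x xM xE /=; rewrite -xE -normrM -phicE//.
  apply: le_trans (ler_norm _); exact: primitive_le_mul mphic phic_nd phicC _.
have LE p (f : X -> \bar R) : 'N[lebesgue_rV N]_p[f]%E = 'N[leb N]_p[f]%E by rewrite unlock.
rewrite !LE; split; last exact: (Lnorm_product_lty iu0 phiu0C).
apply: le_trans enS _; apply: le_trans (integral_le_Lnorm iu0 mP P0 Pu).
rewrite /S /Rintegral fineK//; apply: integrable_fin_num => //.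
apply: (integrable_dom mP (integrableZ_R C (integrable_norm iu0c))) => x.
exact: primitive_le mphic phic_nd phic0 phicC _.
Qed.
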